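(* Let $N\ge 2$ and let $\Omega\subset\mathbb{R}^N$ be a bounded domain with smooth boundary. Let $m:\mathbb{R}\times[0,+\infty)\to(0,+\infty)$ satisfy: (m0) $m$ is continuous; (m1) there is $\mathfrak m>0$ such that $m(t,r)\ge \mathfrak m$ for all $t\in\mathbb{R}$ and $r\in[0,\infty)$; (m2) for each $r\in[0,+\infty)$ the map $t\mapsto m(t,r)$ is strictly decreasing in $(-\infty,0)$ and strictly increasing in $(0,+\infty)$. Let $f\in L^q(\Omega)$ with $q>N/2$ and $f\not\equiv 0$. Then the problem $$-\mathrm{div}\big(m(u,|\nabla u|_2^2)\nabla u\big)=f(x)\ \text{ in }\Omega,\qquad u=0\ \text{ on }\partial\Omega,$$ has a nontrivial weak solution $u_*$.
   Context: $|\cdot|_p$ denotes the usual $L^p(\Omega)$-norm, so $|\nabla u|_2^2=\int_\Omega|\nabla u|^2dx$. A weak solution of the problem is a function $u_*\in H^1_0(\Omega)\cap L^\infty(\Omega)$ such that for all $\varphi\in H^1_0(\Omega)$, $\int_\Omega m(u_*(x),|\nabla u_*|_2^2)\nabla u_*\nabla\varphi\,dx=\int_\Omega f(x)\varphi\,dx$. Nontrivial means $u_*\not\equiv 0$. *)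

(* Defs.v *)
From HB Require Import structures.
From mathcomp Require Import all_boot all_order all_algebra.
From mathcomp Require Import all_classical all_reals all_analysis.

Set Implicit Arguments.
Unset Strict Implicit.
Unset Printing Implicit Defensive.

Import Order.TTheory GRing.Theory Num.Theory.
Import numFieldNormedType.Exports.

Local Open Scope classical_set_scope.
Local Open Scope ring_scope.

(* R^n is 'rV[R]_n with its library topology (that of the sup norm). As the
   library does for n.-tuple, the sigma-algebra is the one generated by the
   coordinates, i.e. the Borel sigma-algebra of R^n. *)
Definition measure_row_display : measure_display.
Proof. exact: default_measure_display. Qed.

Section measurable_row.
Context {R : realType} (n : nat).

Definition row_coord (i : 'I_n) (x : 'rV[R]_n) : measurableTypeR R := x ord0 i.

Let row_set0 : g_sigma_preimage row_coord set0.
Proof. exact: sigma_algebra0. Qed.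

Let row_setC A : g_sigma_preimage row_coord A ->
  g_sigma_preimage row_coord (~` A).
Proof. exact: sigma_algebraC. Qed.

Let row_bigcup (F : _^nat) : (forall i, g_sigma_preimage row_coord (F i)) ->
  g_sigma_preimage row_coord (\bigcup_i (F i)).
Proof. exact: sigma_algebra_bigcup. Qed.

HB.instance Definition _ := @isMeasurable.Build measure_row_display
  'rV[R]_n (g_sigma_preimage row_coord) row_set0 row_setC row_bigcup.

End measurable_row.

Lemma measurable_row_coord (R : realType) n (i : 'I_n) :
  measurable_fun [set: 'rV[R]_n] (row_coord i).
Proof.
move=> _ Y mY; rewrite setTI; apply: sub_sigma_algebra => /=.
rewrite -bigcup_seq/=; exists i => /=; first by rewrite mem_index_enum.
by exists Y => //; rewrite setTI.
Qed.

Lemma measurable_fun_row d (T : measurableType d) (R : realType) n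
    (f : T -> 'rV[R]_n) :
  (forall i, measurable_fun [set: T] (row_coord i \o f)) ->
  measurable_fun [set: T] f.
Proof.
move=> mf _ A mA.
have : preimage_set_system [set: T] f (@measurable _ 'rV[R]_n) `<=` measurable.
  have := @g_sigma_preimage_comp _ _ n 'rV[R]_n (@row_coord R n) T f.
  rewrite /measurable/= => <-.
  apply: smallest_sub; first exact: sigma_algebra_measurable.
  by rewrite -bigcup_seq => B [i _ [C mC <-]]; exact: mf.
by apply; exists A.
Qed.

Section row_cons.
Context {R : realType} (n : nat).

Definition row_cons (p : measurableTypeR R * 'rV[R]_n) : 'rV[R]_n.+1 :=
  \row_i oapp (p.2 ord0) p.1 (unlift ord0 i).

Definition row_uncons (x : 'rV[R]_n.+1) : measurableTypeR R * 'rV[R]_n :=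
  (x ord0 ord0, \row_j x ord0 (lift ord0 j)).

Lemma row_consK : cancel row_cons row_uncons.
Proof.
move=> [a x]; rewrite /row_cons /row_uncons/=; congr pair.
  by rewrite mxE unlift_none.
by apply/rowP => j; rewrite !mxE liftK.
Qed.

Lemma measurable_row_cons : measurable_fun setT row_cons.
Proof.
apply: measurable_fun_row => i.
case: (unliftP ord0 i) => [j|] ->.
  rewrite (_ : _ \o _ = row_coord j \o snd); last first.
    by apply/funext => p /=; rewrite /row_coord mxE liftK.
  apply: measurableT_comp => //; exact: measurable_row_coord.
rewrite (_ : _ \o _ = fst)//.
by apply/funext => p /=; rewrite /row_coord mxE unlift_none.
Qed.

Lemma measurable_row_uncons : measurable_fun setT row_uncons.
Proof.
apply/measurable_fun_pair; first exact: (@measurable_row_coord R n.+1 ord0).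
apply: measurable_fun_row => i.
rewrite (_ : _ \o _ = row_coord (lift ord0 i)).
  exact: measurable_row_coord.
by apply/funext => x; rewrite /row_coord /= mxE.
Qed.

Variable mu : {sigma_finite_measure set 'rV[R]_n -> \bar R}.

Definition lebesgue_row_succ : set 'rV[R]_n.+1 -> \bar R :=
  pushforward (@lebesgue_measure R \x mu)%E row_cons.

Let push : {measure set 'rV[R]_n.+1 -> \bar R} :=
  measure_function_pushforward__canonical__measure_function_Measure
    (@lebesgue_measure R \x mu)%E measurable_row_cons.

Let succ0 : lebesgue_row_succ set0 = 0%E.
Proof. exact: (measure0 push). Qed.

Let succ_ge0 A : (0 <= lebesgue_row_succ A)%E.
Proof. exact: (measure_ge0 push). Qed.

Let succ_sigma_additive : semi_sigma_additive lebesgue_row_succ.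
Proof. exact: (@measure_semi_sigma_additive _ _ _ push). Qed.

HB.instance Definition _ := isMeasure.Build _ _ _ lebesgue_row_succ
  succ0 succ_ge0 succ_sigma_additive.

(* The library's sigma-finiteness instance for products is shadowed by the one
   for finite measures, hence this proof. *)
Let prod_sigma_finite : sigma_finite setT (@lebesgue_measure R \x mu)%E.
Proof.
have /sigma_finiteP[F [TF ndF Foo]] := sigma_finiteT (@lebesgue_measure R).
have /sigma_finiteP[G [TG ndG Goo]] := sigma_finiteT mu.
exists (fun k => F k `*` G k).
  rewrite -setXTT TF TG predeqE => -[x y]; split.
    move=> [/= [j _ Fjx] [k _ Gky]]; exists (maxn j k) => //; split.
    - by move: x Fjx; exact/subsetPset/ndF/leq_maxl.
    - by move: y Gky; exact/subsetPset/ndG/leq_maxr.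
  by move=> [k _ []/= ? ?]; split; exists k.
move=> k; have [? ?] := Foo k; have [? ?] := Goo k.
split; first exact: measurableX.
by rewrite product_measure1E// lte_mul_pinfty// ge0_fin_numE.
Qed.

Let succ_sigma_finite : sigma_finite setT lebesgue_row_succ.
Proof.
have [F FT Foo] := prod_sigma_finite.
exists (fun i => row_uncons @^-1` F i).
  by rewrite -preimage_bigcup -FT preimage_setT.
move=> i; have [mF Fi] := Foo i; split.
  by rewrite -[X in measurable X]setTI; exact: measurable_row_uncons.
rewrite /lebesgue_row_succ /pushforward -comp_preimage.
rewrite (_ : _ \o _ = id) ?preimage_id//.
by apply/funext => p; exact: row_consK.
Qed.

HB.instance Definition _ := Measure_isSigmaFinite.Build _ _ _ lebesgue_row_succ
  succ_sigma_finite.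

End row_cons.

Section lebesgue_row.
Context {R : realType}.

Definition lebesgue_row0 : set 'rV[R]_0 -> \bar R :=
  dirac (0 : 'rV[R]_0).

HB.instance Definition _ := Measure.on lebesgue_row0.

Let row0_sigma_finite : sigma_finite setT lebesgue_row0.
Proof.
apply: fin_num_fun_sigma_finite; first by rewrite measure0.
by move=> A mA; rewrite /lebesgue_row0 /dirac.
Qed.

HB.instance Definition _ := Measure_isSigmaFinite.Build _ _ _ lebesgue_row0
  row0_sigma_finite.

(* The n-dimensional Lebesgue measure, as an iterated product. *)
Fixpoint lebesgue_row n : {sigma_finite_measure set 'rV[R]_n -> \bar R} :=
  if n is k.+1 then lebesgue_row_succ (lebesgue_row k) else lebesgue_row0.

End lebesgue_row.

Section smooth_functions.
Context {R : realType} (n : nat).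

Definition partial (i : 'I_n) (u : 'rV[R]_n -> R) (x : 'rV[R]_n) : R :=
  'D_(delta_mx ord0 i) u x.

Definition iter_partial (s : seq 'I_n) (u : 'rV[R]_n -> R) : 'rV[R]_n -> R :=
  foldr partial u s.

(* C^oo: partial derivatives of all orders exist and are continuous. *)
Definition smooth (u : 'rV[R]_n -> R) : Prop :=
  forall s : seq 'I_n, continuous (iter_partial s u) /\
    forall i x, derivable (iter_partial s u) x (delta_mx ord0 i).

(* C_c^oo(Omega), extended by 0 to R^n. *)
Definition test_function (Omega : set 'rV[R]_n) (phi : 'rV[R]_n -> R) : Prop :=
  [/\ smooth phi, compact (closure [set x | phi x != 0]) &
      closure [set x | phi x != 0] `<=` Omega].

End smooth_functions.

Section domains.
Context {R : realType} (n : nat).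

Definition bounded_domain (Omega : set 'rV[R]_n) : Prop :=
  [/\ Omega !=set0, open Omega, connected Omega & bounded_set Omega].

(* Near each boundary point, up to relabelling and reorienting the coordinate
   axes, Omega is the region above the graph of a C^oo function gamma of the
   n - 1 remaining coordinates (col' i x is x without its i-th coordinate). *)
Definition smooth_boundary (Omega : set 'rV[R]_n) : Prop :=
  forall x0, (closure Omega `\` interior Omega) x0 ->
  exists (i : 'I_n) (b : bool) (gamma : 'rV[R]_n.-1 -> R),
    smooth gamma /\
    \forall x \near x0, Omega x <-> gamma (col' i x) < (-1) ^+ b * x ord0 i.

End domains.

(* Functions on Omega are represented by total functions on R^n, whose values
   outside Omega are irrelevant; elements of L^p(Omega) are represented by
   Borel measurable functions. *)
Section sobolev.
Context {R : realType} (n : nat).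
Variable Omega : set 'rV[R]_n.
Implicit Types u v phi : 'rV[R]_n -> R.

Local Notation mu := (@lebesgue_row R n).

(* The exponent p ranges over the extended reals. *)
Definition in_Lp (p : \bar R) u : Prop := (u \_ Omega) \in Lfun mu p.

Definition Lp_norm (p : \bar R) u : \bar R := 'N[mu]_p[EFin \o (u \_ Omega)].

(* u is not the zero class of functions on Omega. *)
Definition nontrivial u : Prop := ~ {ae mu, forall x, Omega x -> u x = 0}.

Definition weak_partial (i : 'I_n) u v : Prop :=
  forall phi, test_function Omega phi ->
    (\int[mu]_(x in Omega) (u x * partial i phi x)%:E =
     - \int[mu]_(x in Omega) (v x * phi x)%:E)%E.

(* G represents the weak gradient of u, and belongs to L^2(Omega)^n. *)
Definition L2_weak_gradient u (G : 'rV[R]_n -> 'rV[R]_n) : Prop :=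
  forall i, in_Lp 2%:E (fun x => G x ord0 i) /\
            weak_partial i u (fun x => G x ord0 i).

Definition H1 u : Prop := in_Lp 2%:E u /\ exists G, L2_weak_gradient u G.

(* A representative of the weak gradient, meaningful when H1 u holds. *)
Definition grad u : 'rV[R]_n -> 'rV[R]_n :=
  xget (fun=> 0) [set G | L2_weak_gradient u G].

(* H^1_0(Omega) is the closure of C_c^oo(Omega) in H^1(Omega). *)
Definition H10 u : Prop := H1 u /\
  exists phi_ : nat -> 'rV[R]_n -> R,
    [/\ forall k, test_function Omega (phi_ k),
        Lp_norm 2%:E (fun x => phi_ k x - u x) @[k --> \oo] --> 0%E &
        forall i, Lp_norm 2%:E (fun x => partial i (phi_ k) x - grad u x ord0 i)
                    @[k --> \oo] --> 0%E].

Definition dotrow (x y : 'rV[R]_n) : R := \sum_(i < n) x ord0 i * y ord0 i.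

(* |grad u|_2^2 *)
Definition grad_norm2 u : R :=
  \int[mu]_(x in Omega) dotrow (grad u x) (grad u x).

(* The integrals are equated in the extended reals rather than as reals, so
   that a non-integrable integrand cannot count for 0. *)
Definition weak_solution (m : R -> R -> R) (f u : 'rV[R]_n -> R) : Prop :=
  [/\ H10 u, in_Lp +oo%E u &
    forall phi, H10 phi ->
      (\int[mu]_(x in Omega)
         (m (u x) (grad_norm2 u) * dotrow (grad u x) (grad phi x))%:E =
       \int[mu]_(x in Omega) (f x * phi x)%:E)%E].

End sobolev.

(* Main.v *)
Require Import Defs.
From mathcomp Require Import all_boot all_order all_algebra.
From mathcomp Require Import all_classical all_reals all_analysis.
From mathcomp Require Import measurable_realfun ess_sup_inf.
From mathcomp Require Import ring lra.

Set Implicit Arguments.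
Unset Strict Implicit.
Unset Printing Implicit Defensive.

Import Order.TTheory GRing.Theory Num.Theory.
Import numFieldNormedType.Exports.

Local Open Scope classical_set_scope.
Local Open Scope ring_scope.

(** The difficulty is that the coefficient depends on the energy of the unknown.
    Fix a number r in place of |grad u|^2. If M_r denotes the primitive of
    m (., r) that vanishes at 0, then m (u, r) grad u = grad (M_r (u)), so the
    equation becomes the Poisson equation - Delta w = f for w = M_r (u), which
    does not involve r. Since m is bounded below by a positive constant m1,
    M_r is a bijection of the line whose inverse is C^1 with derivative at most
    1 / m1. Thus u_r = M_r^-1 (w) solves the equation with r, and it remains to
    choose r such that the energy h (r) of u_r is r. As
    grad u_r = grad w / m (u_r, r), the function h is continuous, by dominated
    convergence, and takes its values between 0 and |grad w|^2 / m1^2: by the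
    intermediate value theorem it has a fixed point (quasilinear_solution).

    What is left is a bounded solution w in H^1_0 of the Poisson equation for f
    in L^q, q > N/2 (linear_solution). By Hoelder's inequality the integral of
    |f| over a set A is at most F |A|^th with th > 1 - 2/N, and this is the form
    in which the hypothesis on f is used (Lq_small_sets); it is inherited by the
    truncations of f. The proof has three ingredients.
    - Existence for a datum in the dual of H^1_0 (riesz_representation): the
      energy is minimised along test functions, which converge by completeness
      of L^2 and the Poincare inequality.
    - An a priori bound, by Stampacchia's method of truncation: testing the
      equation with a truncation of w between two levels k < h, and using
      Sobolev's inequality for functions with an integrable gradient, bounds a
      power of the measure of the set where w > h by a strictly larger power of
      that of the set where w > k; iteration makes it vanish at a finite level
      (stampacchia_step, stampacchia_iteration).
    - The fact that f belongs to the dual of H^1_0 (integral_mul_test_le). The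
      solutions for the truncations of |f| are uniformly bounded, so their
      energies are, and testing their equations with |phi| gives a bound of the
      integral of |f phi| by the norm of grad phi.

    Throughout, an element of H^1_0 is a pair (w, G) that is a limit in L^2 of
    pairs (phi, grad phi) with phi a test function (h10). Everything is proved
    for test functions and passes to the limit. The chain rule (h10_comp) is
    obtained by approximating a C^1 function by polynomials, since these
    operate on test functions; Sobolev's inequality
    (gagliardo_nirenberg_sobolev) by induction on the dimension along
    slices; and the uniqueness of weak gradients, as well as the fact that the
    solution is not 0 when f is not, from the fundamental lemma of the calculus
    of variations (fundamental_lemma). *)

(** * Lebesgue measure on R^n *)

Section row_measure.
Context {R : realType}.

Lemma measurable_row_forall n (F : 'I_n -> set R) :
  (forall i, measurable (F i)) ->
  measurable [set x : 'rV[R]_n | forall i, F i (x ord0 i)].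
Proof.
move=> mF.
have -> : [set x : 'rV[R]_n | forall i, F i (x ord0 i)] =
    \bigcap_(i in [set: 'I_n]) (row_coord i @^-1` F i).
  by apply/seteqP; split => y /= h i; [move=> _|]; apply: h.
apply: fin_bigcap_measurable => // i _; rewrite -[X in measurable X]setTI.
by apply: measurable_row_coord => //; exact: mF.
Qed.

Definition open_box n (a b : 'rV[R]_n) : set 'rV[R]_n :=
  [set x | forall i, a ord0 i < x ord0 i < b ord0 i].

Definition rat_box n (p : 'rV[rat]_n * nat) : 'rV[R]_n * 'rV[R]_n :=
  (\row_i (ratr (p.1 ord0 i) - p.2.+1%:R^-1), \row_i (ratr (p.1 ord0 i) + p.2.+1%:R^-1)).

(** Every open set is a countable union of boxes with rational data whose
    closures it contains. Measurability of open sets and the approximation of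
    their indicators by test functions both come from this countable family. *)
Lemma open_rat_box n (U : set 'rV[R]_n) x : open U -> U x ->
  exists p, open_box (rat_box p).1 (rat_box p).2 x /\
    forall y : 'rV[R]_n, (forall i, (rat_box p).1 ord0 i <= y ord0 i <= (rat_box p).2 ord0 i) ->
    U y.
Proof.
move=> oU Ux.
have /nbhs_ballP[e /= e0 xeU] : nbhs x U by exact: open_nbhs_nbhs.
have [k ke] : exists k : nat, 2 * k.+1%:R^-1 < e.
  have e20 : 0 < e / 2 by rewrite divr_gt0.
  have [k _ /(_ _ (leqnn k))] := near_infty_natSinv_lt (PosNum e20).
  by move=> /= h; exists k; rewrite mulrC -ltr_pdivlMr.
have [q qx] : exists q : 'rV[rat]_n,
    forall i, `|ratr (q ord0 i) - x ord0 i| < k.+1%:R^-1.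
  suff /choice[q qP] : forall i : 'I_n, exists r : rat,
      `|ratr r - x ord0 i| < k.+1%:R^-1.
    by exists (\row_i q i) => i; rewrite mxE.
  move=> i; have [|r] := @rat_in_itvoo _ (x ord0 i - k.+1%:R^-1)
    (x ord0 i + k.+1%:R^-1).
    by rewrite ltrD2l gtrN// invr_gt0.
  by rewrite in_itv/= => h; exists r; rewrite ltr_distl.
exists (q, k); split.
  by move=> i; rewrite !mxE/=; have := qx i; rewrite distrC ltr_distl.
move=> y hy; apply: xeU; split => // i j; rewrite (ord1 i) /ball/=.
have := qx j; have := hy j; rewrite !mxE/= -ler_distl => h1 h2.
rewrite (le_lt_trans (ler_distD (ratr (q ord0 j)) _ _))//.
by rewrite (lt_trans _ ke)// mulr2n mulrDl mul1r ltr_leD// distrC.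
Qed.

Lemma open_measurable_row n (U : set 'rV[R]_n) : open U -> measurable U.
Proof.
move=> oU.
have -> : U = \bigcup_(p : 'rV[rat]_n * nat)
    (if `[< forall y : 'rV[R]_n, (forall i, (rat_box p).1 ord0 i <= y ord0 i <=
       (rat_box p).2 ord0 i) -> U y >]
     then open_box (rat_box p).1 (rat_box p).2 else set0).
  apply/seteqP; split => [x Ux|x [p _]].
    have [p [xp pU]] := open_rat_box oU Ux.
    by exists p => //; rewrite ifT//; exact/asboolP.
  case: ifPn => // /asboolP pU xp; apply: pU => i.
  by have /andP[/ltW-> /ltW->] := xp i.
apply: countable_bigcupT_measurable => // p; case: ifPn => // _.
have := @measurable_row_forall n (fun i => `](rat_box p).1 ord0 i, (rat_box p).2 ord0 i[%classic)
  (fun i => measurable_itv _).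
by congr measurable; apply/seteqP; split => x h i; have := h i; rewrite /= in_itv.
Qed.

Lemma continuous_measurable_row n (u : 'rV[R]_n -> R) :
  continuous u -> measurable_fun setT u.
Proof.
move=> cu; apply: (measurability _ (RGenOpens.measurableE R)).
move=> _ [_ [a [b ->]] <-]; rewrite setTI; apply: open_measurable_row.
by move/continuousP : cu; apply; exact: interval_open.
Qed.

Lemma ge0_integral_rowS n (f : 'rV[R]_n.+1 -> \bar R) :
  measurable_fun setT f -> (forall x, 0 <= f x)%E ->
  (\int[lebesgue_row n.+1]_x f x =
   \int[@lebesgue_measure R]_t \int[lebesgue_row n]_y f (row_cons (t, y)))%E.
Proof.
move=> mf f0.
rewrite -[LHS]/(\int[pushforward (@lebesgue_measure R \x lebesgue_row n)%E
  (@row_cons R n)]_x f x)%E.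
rewrite ge0_integral_pushforward//; last exact: measurable_row_cons.
rewrite preimage_setT (fubini_tonelli1 (f \o @row_cons R n))//; last first.
  by move=> x; exact: f0.
apply: measurableT_comp => //; exact: measurable_row_cons.
Qed.

Lemma ge0_integral_rowS2 n (f : 'rV[R]_n.+1 -> \bar R) :
  measurable_fun setT f -> (forall x, 0 <= f x)%E ->
  (\int[lebesgue_row n.+1]_x f x =
   \int[lebesgue_row n]_y \int[@lebesgue_measure R]_t f (row_cons (t, y)))%E.
Proof.
move=> mf f0.
rewrite -[LHS]/(\int[pushforward (@lebesgue_measure R \x lebesgue_row n)%E
  (@row_cons R n)]_x f x)%E.
rewrite ge0_integral_pushforward//; last exact: measurable_row_cons.
rewrite preimage_setT (fubini_tonelli2 (f \o @row_cons R n))//; last first.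
  by move=> x; exact: f0.
apply: measurableT_comp => //; exact: measurable_row_cons.
Qed.

Lemma integrable_rowS n (f : 'rV[R]_n.+1 -> \bar R) :
  (lebesgue_row n.+1).-integrable setT f ->
  (@lebesgue_measure R \x lebesgue_row n)%E.-integrable setT
    (f \o @row_cons R n).
Proof.
move=> /integrableP[mf foo]; apply/integrableP; split.
  by apply: measurableT_comp => //; exact: measurable_row_cons.
rewrite -(@ge0_integral_pushforward _ _ _ _ _ _ (@measurable_row_cons R n)
  _ setT (abse \o f))//; last by move=> x _ /=; exact: abse_ge0.
by apply: measurableT_comp.
Qed.

Lemma integral_rowS n (f : 'rV[R]_n.+1 -> \bar R) :
  (lebesgue_row n.+1).-integrable setT f ->
  (\int[lebesgue_row n.+1]_x f x =
   \int[@lebesgue_measure R]_t \int[lebesgue_row n]_y f (row_cons (t, y)))%E.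
Proof.
move=> intf.
rewrite -[LHS]/(\int[pushforward (@lebesgue_measure R \x lebesgue_row n)%E
  (@row_cons R n)]_x f x)%E.
rewrite integral_pushforward//; last 2 first.
- exact: measurable_int intf.
- exact: integrable_rowS.
- rewrite preimage_setT -(integral12_prod_meas1 (integrable_rowS intf))//.
- exact: measurable_row_cons.
Qed.

Lemma integral_rowS2 n (f : 'rV[R]_n.+1 -> \bar R) :
  (lebesgue_row n.+1).-integrable setT f ->
  (\int[lebesgue_row n.+1]_x f x =
   \int[lebesgue_row n]_y \int[@lebesgue_measure R]_t f (row_cons (t, y)))%E.
Proof.
move=> intf.
rewrite -[LHS]/(\int[pushforward (@lebesgue_measure R \x lebesgue_row n)%E
  (@row_cons R n)]_x f x)%E.
rewrite integral_pushforward//; last 2 first.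
- exact: measurable_int intf.
- exact: integrable_rowS.
- rewrite preimage_setT -(integral21_prod_meas1 (integrable_rowS intf))//.
- exact: measurable_row_cons.
Qed.

(** The closed ball of the sup norm; it is used in this form because it splits
    along the coordinates. *)
Definition row_box n (M : R) : set 'rV[R]_n :=
  [set x | forall i, `|x ord0 i| <= M].

Lemma measurable_row_box n M : measurable (@row_box n M).
Proof.
have -> : @row_box n M =
    [set x : 'rV[R]_n | forall i, `[-M, M]%classic (x ord0 i)].
  by apply/seteqP; split => y /= h i; have := h i; rewrite /= in_itv/= -ler_norml.
exact: (measurable_row_forall (F := fun=> `[-M, M]%classic)).
Qed.

Lemma row_box_cons n M t (y : 'rV[R]_n) :
  row_box M (row_cons (t, y)) <-> `|t| <= M /\ row_box M y.
Proof.
split=> [h|[h1 h2] i].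
  split; first by have := h ord0; rewrite mxE unlift_none.
  by move=> i; have := h (lift ord0 i); rewrite mxE liftK.
by case: (unliftP ord0 i) => [j|] ->; rewrite mxE ?liftK ?unlift_none//=; exact: h2.
Qed.

Lemma row_box_fin n M : (lebesgue_row n (@row_box n M) < +oo)%E.
Proof.
elim: n => [|n IH].
  by rewrite /= /lebesgue_row0 diracE ltry.
rewrite -(setIT (row_box M)) -integral_indic//; last exact: measurable_row_box.
rewrite ge0_integral_rowS//=; last first.
  apply: measurableT_comp => //; apply: measurable_indic.
  exact: measurable_row_box.
under eq_integral => t _.
  under eq_integral => y _.
    have -> : (\1_(row_box M) (row_cons (t, y)))%:E =
       ((\1_(`[-M, M]%classic) t)%:E * (\1_(row_box M) y)%:E)%E :> \bar R.
      rewrite -EFinM !indicE; congr EFin.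
      rewrite -natrM mulnb; congr (_%:R); congr nat_of_bool.
      apply/idP/andP => [/set_mem/row_box_cons[h1 h2]|[/set_mem h1 /set_mem h2]].
        by split; apply/mem_set => //=; rewrite in_itv/= -ler_norml.
      apply/mem_set/row_box_cons; split => //.
      by rewrite ler_norml; rewrite /= in_itv/= in h1.
    over.
  rewrite ge0_integralZl//; last first.
    apply: measurableT_comp => //; apply: measurable_indic.
    exact: measurable_row_box.
  rewrite integral_indic//; last exact: measurable_row_box.
  rewrite setIT; over.
rewrite ge0_integralZr//; last first.
  by apply: measurableT_comp => //; exact: measurable_indic.
have Moo : (lebesgue_measure (`[(- M)%R, M]%classic : set R) < +oo)%E.
  by rewrite lebesgue_measure_itv/=; case: ifPn => // _; rewrite -EFinB ltry.
rewrite integral_indic// setIT; apply: lte_mul_pinfty => //.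
by rewrite ge0_fin_numE.
Qed.

End row_measure.

(** * Smooth functions and test functions *)

Section line_derivative.
Context {R : realType} {V : normedModType R}.

(** A derivative in the direction v is a derivative in one variable along the
    line through x, which gives access to the one-variable rules. *)
Lemma is_derive_line (u : V -> R) (x v : V) (t d : R) :
  is_derive (t *: v + x) v u d <-> is_derive t 1 (fun s : R => u (s *: v + x)) d.
Proof.
have E : (fun h : R => h^-1 *: ((u \o shift (t *: v + x)) (h *: v) - u (t *: v + x)))
    = (fun h : R => h^-1 *: (((fun s : R => u (s *: v + x)) \o shift t) (h *: (1:R))
        - u (t *: v + x))).
  apply/funext => h /=; rewrite /shift/=.
  have -> : h *: (1 : R) = h by rewrite /GRing.scale/= mulr1.
  by rewrite scalerDl addrA.
split=> -[h1 h2]; split.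
- by rewrite /derivable/= -E.
- by rewrite -h2 /derive/= -E.
- by rewrite /derivable/= E.
- by rewrite -h2 /derive/= E.
Qed.

Lemma is_derive_line0 (u : V -> R) (x v : V) (d : R) :
  is_derive x v u d <-> is_derive (0 : R) 1 (fun s : R => u (s *: v + x)) d.
Proof. by rewrite -is_derive_line scale0r add0r. Qed.

Lemma is_derive_comp1 (g : R -> R) (u : V -> R) (x v : V) (dg du : R) :
  is_derive (u x) 1 g dg -> is_derive x v u du ->
  is_derive x v (fun y => g (u y)) (dg * du).
Proof.
move=> hg /is_derive_line0 hu; apply/is_derive_line0.
apply: (@is_derive1_comp _ g (fun s : R => u (s *: v + x))) => //.
by rewrite scale0r add0r.
Qed.

End line_derivative.

Section Ck.
Context {R : realType}.

Fixpoint C1k (k : nat) (g : R -> R) : Prop :=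
  if k is j.+1 then
    continuous g /\ exists2 g' : R -> R, (forall t : R, is_derive t 1 g (g' t)) & C1k j g'
  else continuous g.

Lemma C1k_horner k (p : {poly R}) : C1k k (horner p).
Proof.
elim: k p => [p|k IH p]; first exact: continuous_horner.
split; first exact: continuous_horner.
exists (horner p^`()) => // t; exact: is_derive_poly.
Qed.

Variable n : nat.
Implicit Types u v : 'rV[R]_n -> R.

(** Being C^k, with the partial derivatives as witnesses instead of iterates
    of [partial]: the closure properties are then inductions on k in which the
    derivatives are exhibited, and smoothP transfers them to C^oo functions. *)
Fixpoint Ck (k : nat) u : Prop :=
  if k is j.+1 then
    continuous u /\ forall i : 'I_n, exists2 u' : 'rV[R]_n -> R,
      (forall x, is_derive x (delta_mx ord0 i) u (u' x)) & Ck j u'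
  else continuous u.

Lemma Ck_continuous k u : Ck k u -> continuous u.
Proof. by case: k => [|k] //= []. Qed.

Lemma CkS k u : Ck k.+1 u -> Ck k u.
Proof.
elim: k u => [u [] //|k IH u [cu du]]; split => // i.
by have [u' hu' /IH h] := du i; exists u'.
Qed.

Lemma smooth_partial u i : smooth u -> smooth (partial i u).
Proof.
move=> su s; have := su (rcons s i); rewrite /iter_partial foldr_rcons.
exact.
Qed.

Lemma smooth_derivable u i x : smooth u ->
  is_derive x (delta_mx ord0 i) u (partial i u x).
Proof. by move=> /(_ [::])[_ /(_ i x)] /derivableP. Qed.

Lemma smooth_continuous u : smooth u -> continuous u.
Proof. by move=> /(_ [::])[]. Qed.

Lemma smoothP u : smooth u <-> forall k, Ck k u.
Proof.
split=> [su k|].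
  elim: k u su => [|k IH] u su; first exact: smooth_continuous.
  split; first exact: smooth_continuous.
  move=> i; exists (partial i u); first by move=> x; exact: smooth_derivable.
  exact/IH/smooth_partial.
move=> hu s; elim/last_ind: s u hu => [|s i IH] u hu.
  split; first exact: (Ck_continuous (hu 0)).
  by move=> i x; have [_ /(_ i)[u' /(_ x)[]]] := hu 1%N.
rewrite /iter_partial foldr_rcons; apply: IH => k.
have [_ /(_ i)[u' du' hu']] := hu k.+1.
rewrite (_ : partial i u = u')//; apply/funext => x.
by have [] := du' x.
Qed.

Lemma Ck_add k u v : Ck k u -> Ck k v -> Ck k (fun x => u x + v x).
Proof.
elim: k u v => [u v /= cu cv x|k IH u v [cu du] [cv dv]].
  exact: (cvgD (cu x) (cv x)).
split=> [x|i]; first exact: (cvgD (cu x) (cv x)).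
have [u' hu cu'] := du i; have [v' hv cv'] := dv i.
exists (fun x => u' x + v' x); last exact: IH.
by move=> x; apply: is_deriveD.
Qed.

Lemma Ck_mul k u v : Ck k u -> Ck k v -> Ck k (fun x => u x * v x).
Proof.
elim: k u v => [u v /= cu cv x|k IH u v Cu Cv].
  exact: (cvgM (cu x) (cv x)).
have [cu du] := Cu; have [cv dv] := Cv.
split=> [x|i]; first exact: (cvgM (cu x) (cv x)).
have [u' hu cu'] := du i; have [v' hv cv'] := dv i.
exists (fun x => u x * v' x + v x * u' x); last first.
  by apply: Ck_add; apply: IH => //; exact: CkS.
by move=> x; apply: is_deriveM.
Qed.

Lemma Ck_comp k (g : R -> R) u : C1k k g -> Ck k u -> Ck k (fun x => g (u x)).
Proof.
elim: k g u => [g u cg cu x|k IH g u Cg Cu].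
  by apply: continuous_comp; [exact: cu|exact: cg].
have [cg [g' dg Cg']] := Cg; have [cu du] := Cu.
split=> [x|i]; first by apply: continuous_comp; [exact: cu|exact: cg].
have [u' hu cu'] := du i.
exists (fun x => g' (u x) * u' x); last first.
  by apply: Ck_mul => //; apply: IH => //; exact: CkS.
by move=> x; apply: is_derive_comp1.
Qed.

Lemma smooth_add u v : smooth u -> smooth v -> smooth (fun x => u x + v x).
Proof. by move=> /smoothP su /smoothP sv; apply/smoothP => k; exact: Ck_add. Qed.

Lemma smooth_mul u v : smooth u -> smooth v -> smooth (fun x => u x * v x).
Proof. by move=> /smoothP su /smoothP sv; apply/smoothP => k; exact: Ck_mul. Qed.

Lemma smooth_comp (g : R -> R) u : (forall k, C1k k g) -> smooth u ->
  smooth (fun x => g (u x)).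
Proof. by move=> sg /smoothP su; apply/smoothP => k; exact: Ck_comp. Qed.

Lemma Ck_cst k (c : R) : Ck k (fun=> c).
Proof.
elim: k c => [c /= x|k IH c]; first exact: cst_continuous.
split=> [x|j]; first exact: cst_continuous.
by exists (fun=> 0) => // x; exact: is_derive_cst.
Qed.

Lemma is_derive_coord i j (x : 'rV[R]_n) :
  is_derive x (delta_mx ord0 j) (fun x : 'rV[R]_n => x ord0 i) (i == j)%:R.
Proof.
apply/is_derive_line0.
rewrite (_ : (fun _ => _) = (fun s : R => s * (i == j)%:R + x ord0 i)); last first.
  by apply/funext => s; rewrite !mxE eqxx.
apply: (is_derive_eq (is_deriveD (is_deriveM
  (is_derive_id (0 : R) (1 : R)) (is_derive_cst ((i == j)%:R : R) (0 : R) (1 : R)))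
  (is_derive_cst (x ord0 i : R) (0 : R) (1 : R)))).
by rewrite addr0 scaler0 add0r /GRing.scale/= mulr1.
Qed.

Lemma smooth_coord i : smooth (fun x : 'rV[R]_n => x ord0 i).
Proof.
apply/smoothP => -[|k /=]; first exact: coord_continuous.
split=> [x|j]; first exact: coord_continuous.
by exists (fun=> (i == j)%:R); [move=> x; exact: is_derive_coord|exact: Ck_cst].
Qed.

Lemma partial_coord i (x : 'rV[R]_n) : partial i (fun x => x ord0 i) x = 1.
Proof. by have [_] := is_derive_coord i i x; rewrite eqxx. Qed.

Lemma smooth_cst c : smooth (fun _ : 'rV[R]_n => c : R).
Proof.
by apply/smoothP => k; exact: Ck_cst.
Qed.

Lemma smooth_prod (I : Type) (r : seq I) (F : I -> 'rV[R]_n -> R) :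
  (forall i, smooth (F i)) -> smooth (fun x => \prod_(i <- r) F i x).
Proof.
move=> sF; elim: r => [|a r IH].
  rewrite (_ : (fun _ => _) = (fun=> 1)); first exact: smooth_cst.
  by apply/funext => x; rewrite big_nil.
rewrite (_ : (fun _ => _) = (fun x => F a x * \prod_(i <- r) F i x)).
  exact: (smooth_mul (sF a) IH).
by apply/funext => x; rewrite big_cons.
Qed.

Lemma partial_add u v i x : smooth u -> smooth v ->
  partial i (fun y => u y + v y) x = partial i u x + partial i v x.
Proof.
move=> su sv; have hu := smooth_derivable i x su.
have hv := smooth_derivable i x sv.
exact: (@derive_val _ _ _ _ _ _ _ (is_deriveD hu hv)).
Qed.

Lemma partial_mul u v i x : smooth u -> smooth v ->
  partial i (fun y => u y * v y) x = u x * partial i v x + v x * partial i u x.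
Proof.
move=> su sv; have hu := smooth_derivable i x su.
have hv := smooth_derivable i x sv.
exact: (@derive_val _ _ _ _ _ _ _ (is_deriveM hu hv)).
Qed.

Lemma partial_comp (g g' : R -> R) u i x : smooth u ->
  (forall t : R, is_derive t 1 g (g' t)) ->
  partial i (fun y => g (u y)) x = g' (u x) * partial i u x.
Proof.
move=> su dg; have hu := smooth_derivable i x su.
exact: (@derive_val _ _ _ _ _ _ _ (is_derive_comp1 (dg _) hu)).
Qed.

Lemma smooth_scale c u : smooth u -> smooth (fun x => c * u x).
Proof. by move=> su; exact: (smooth_mul (smooth_cst c) su). Qed.

Lemma partial_scale c u i x : smooth u ->
  partial i (fun y => c * u y) x = c * partial i u x.
Proof.
move=> su; apply: (partial_comp (g := *%R c) (g' := fun=> c)) => // t.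
apply: (is_derive_eq (is_deriveM (is_derive_cst c t 1) (is_derive_id t 1))).
by rewrite scaler0 addr0 /GRing.scale/= mulr1.
Qed.

End Ck.

(** * A smooth bump function *)

Section bump.
Context {R : realType}.

Definition exp_inv_pow (n : nat) (t : R) : R :=
  if 0 < t then t ^- n * expR (- t^-1) else 0.

(** exp (1 / t) dominates (1 / t)^(n + 1) / (n + 1)!. This linear bound gives
    continuity at 0 directly, and, used for n + 1, the derivative 0 there. *)
Lemma exp_inv_pow_le n (t : R) : 0 < t -> 
  0 <= exp_inv_pow n t <= (n.+1)`!%:R * t.
Proof.
move=> t0; rewrite /exp_inv_pow t0; apply/andP; split.
  by rewrite mulr_ge0 ?expR_ge0// invr_ge0 exprn_ge0// ltW.
have ti0 : 0 <= t^-1 by rewrite invr_ge0 ltW.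
have h := expR_ge1Dxn n ti0.
have {}h : t^-1 ^+ n.+1 / (n.+1)`!%:R <= expR t^-1.
  by apply: le_trans h; rewrite lerDr.
rewrite expRN ler_pdivrMr ?expR_gt0//.
have f0 : 0 < (n.+1)`!%:R :> R by rewrite ltr0n fact_gt0.
rewrite ler_pdivrMr// exprS exprVn in h.
have -> : t ^- n = t * (t^-1 * t ^- n) by rewrite mulrA divff ?mul1r// gt_eqF.
have -> : (n.+1)`!%:R * t * expR t^-1 = t * (expR t^-1 * (n.+1)`!%:R) by ring.
by rewrite ler_pM2l.
Qed.

(** The derivative stays in the linear span of the family, so that one
    induction on k proves that all its members are C^k. *)
Lemma is_derive_exp_inv_pow n (t : R) :
  is_derive t 1 (exp_inv_pow n)
    (- n%:R * exp_inv_pow n.+1 t + exp_inv_pow n.+2 t).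
Proof.
have [t0|t0|t0] := ltgtP t 0.
- have h0 m : exp_inv_pow m t = 0 by rewrite /exp_inv_pow ltNge ltW.
  rewrite !h0 mulr0 addr0.
  have hc : is_derive t 1 (cst 0 : R -> R) 0 := is_derive_cst 0 t 1.
  apply: (near_eq_is_derive _ hc).
  near=> s; rewrite /exp_inv_pow ifF//; apply/negbTE; rewrite -leNgt.
  apply/ltW; near: s; exact: lt_nbhsl.
- have e m : exp_inv_pow m t = t ^- m * expR (- t^-1).
    by rewrite /exp_inv_pow t0.
  rewrite !e.
  have tn0 : t != 0 by rewrite gt_eqF.
  have dV : is_derive t 1 (fun s : R => s^-1) (- t ^- 2).
    apply: (is_derive_eq (is_deriveV tn0 (is_derive_id t 1))).
    by rewrite /GRing.scale/= mulr1.
  have dVn : is_derive t 1 (fun s : R => s ^- n) (- n%:R * t ^- n.+1).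
    have -> : (fun s : R => s ^- n) = (fun s => (horner ('X^n)) s^-1).
      by apply/funext => s; rewrite hornerXn exprVn.
    apply: (is_derive_eq (is_derive_comp1 (is_derive_poly _ _) dV)).
    rewrite derivXn hornerMn hornerXn; case: (n) => [|k] /=.
      by rewrite mulr0n mul0r oppr0 mul0r.
    rewrite -mulr_natl -!exprVn !exprS; ring.
  have dE : is_derive t 1 (fun s : R => expR (- s^-1)) (expR (- t^-1) * t ^- 2).
    apply: (is_derive_comp1 (u := fun s : R => - s^-1) (is_derive_expR _)).
    by apply: (is_derive_eq (is_deriveN dV)); rewrite opprK.
  have hp : is_derive t 1 (fun s : R => (s ^- n) * expR (- s^-1))
      (- n%:R * (t ^- n.+1 * expR (- t^-1)) + t ^- n.+2 * expR (- t^-1)).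
    apply: (is_derive_eq (is_deriveM dVn dE)).
    rewrite /GRing.scale/= -!exprVn !exprS; ring.
  apply: (near_eq_is_derive _ hp).
  near=> s; rewrite /exp_inv_pow ifT//; near: s; exact: lt_nbhsr.
- rewrite t0.
  have e m : exp_inv_pow m 0 = 0 by rewrite /exp_inv_pow ltxx.
  rewrite !e mulr0 addr0.
  have hc : h^-1 *: ((exp_inv_pow n \o shift 0) (h *: (1:R)) - exp_inv_pow n 0) @[h --> 0^']
      --> (0 : R).
    apply/cvgrPdist_le => eps eps0; near=> h.
    rewrite sub0r normrN /shift/= addr0 e subr0 /GRing.scale/= mulr1.
    rewrite normrM normfV ler_pdivrMl ?normr_gt0; last by near: h; exact: nbhs_dnbhs_neq.
    have [h0|h0] := ltP 0 h; last first.
      by rewrite /exp_inv_pow ltNge h0/= normr0 mulr_ge0// ltW.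
    have -> : exp_inv_pow n h = h * exp_inv_pow n.+1 h.
      by rewrite /exp_inv_pow h0 exprS invfM !mulrA divff ?mul1r// gt_eqF.
    rewrite normrM (gtr0_norm h0) ler_pM2l//.
    have /andP[a b] := exp_inv_pow_le n.+1 h0.
    rewrite ger0_norm// (le_trans b)//.
    rewrite -ler_pdivlMl ?ltr0n ?fact_gt0// -(gtr0_norm h0).
    near: h; apply: dnbhs0_le.
    by rewrite mulr_gt0// invr_gt0 ltr0n fact_gt0.
  by split; [apply/cvg_ex; exists 0|exact/cvg_lim].
Unshelve. all: by end_near. Qed.

Lemma C1k_add k (g h : R -> R) : C1k k g -> C1k k h -> C1k k (fun x => g x + h x).
Proof.
elim: k g h => [u v /= cu cv x|k IH u v [cu du] [cv dv]].
  exact: (cvgD (cu x) (cv x)).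
split=> [x|]; first exact: (cvgD (cu x) (cv x)).
have [u' hu cu'] := du; have [v' hv cv'] := dv.
exists (fun x => u' x + v' x); last exact: IH.
by move=> x; apply: is_deriveD.
Qed.

Lemma C1k_scale k c (g : R -> R) : C1k k g -> C1k k (fun x => c * g x).
Proof.
elim: k g => [u /= cu x|k IH u [cu du]].
  exact: (cvgM (cvg_cst _) (cu x)).
split=> [x|]; first exact: (cvgM (cvg_cst _) (cu x)).
have [u' hu cu'] := du.
exists (fun x => c * u' x); last exact: IH.
by move=> x; apply: (is_deriveZ c (hu x)).
Qed.

Lemma C1k_exp_inv_pow k n : C1k k (exp_inv_pow n).
Proof.
have cont m : continuous (exp_inv_pow m).
  move=> t; apply: differentiable_continuous.
  by apply/derivable1_diffP; have [] := is_derive_exp_inv_pow m t.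
elim: k n => [|k IH] n; first exact: cont.
split; first exact: cont.
exists (fun t => - n%:R * exp_inv_pow n.+1 t + exp_inv_pow n.+2 t).
  by move=> t; exact: is_derive_exp_inv_pow.
by apply: C1k_add => //; exact: C1k_scale.
Qed.

(** A product of factors exp (- 1 / t), C^oo and nonzero exactly on the open
    box. *)
Definition box_bump n (a b : 'rV[R]_n) (x : 'rV[R]_n) : R :=
  \prod_(i <- index_enum 'I_n) (exp_inv_pow 0 (x ord0 i - a ord0 i) *
     exp_inv_pow 0 (b ord0 i - x ord0 i)).

Lemma smooth_box_bump n (a b : 'rV[R]_n) : smooth (box_bump a b).
Proof.
apply: smooth_prod => i; apply: smooth_mul.
  apply: (smooth_comp (g := exp_inv_pow 0)); first by move=> k; exact: C1k_exp_inv_pow.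
  by apply: smooth_add; [exact: smooth_coord|exact: smooth_cst].
apply: (smooth_comp (g := exp_inv_pow 0)); first by move=> k; exact: C1k_exp_inv_pow.
apply: smooth_add; first exact: smooth_cst.
rewrite (_ : (fun _ => _) = (fun x : 'rV[R]_n => -1 * x ord0 i)); last first.
  by apply/funext => x; rewrite mulN1r.
by apply: smooth_scale; exact: smooth_coord.
Qed.

Lemma exp_inv_pow01 (t : R) : 0 <= exp_inv_pow 0 t <= 1.
Proof.
rewrite /exp_inv_pow; case: ifPn => t0; last by rewrite lexx ler01.
rewrite expr0 invr1 mul1r expR_ge0/= -expR0 ler_expR.
by rewrite oppr_le0 invr_ge0 ltW.
Qed.

Lemma exp_inv_pow_neq0 n (t : R) : (exp_inv_pow n t != 0) = (0 < t).
Proof.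
rewrite /exp_inv_pow; case: ifPn => t0; last by rewrite eqxx.
by rewrite mulf_neq0// ?gt_eqF ?expR_gt0// invr_gt0 exprn_gt0.
Qed.

Lemma box_bump01 n (a b : 'rV[R]_n) x : 0 <= box_bump a b x <= 1.
Proof.
rewrite /box_bump; apply/andP; split.
  apply: prodr_ge0 => i _; apply: mulr_ge0.
    by case/andP: (exp_inv_pow01 (x ord0 i - a ord0 i)).
  by case/andP: (exp_inv_pow01 (b ord0 i - x ord0 i)).
apply: prodr_ile1 => i _.
have /andP[h1 h2] := exp_inv_pow01 (x ord0 i - a ord0 i).
have /andP[h3 h4] := exp_inv_pow01 (b ord0 i - x ord0 i).
by rewrite mulr_ge0//= mulr_ile1.
Qed.

Lemma box_bump_neq0 n (a b : 'rV[R]_n) x : box_bump a b x != 0 <-> open_box a b x.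
Proof.
rewrite /box_bump prodf_seq_neq0; split.
  move=> /allP h i; have /= := h i (mem_index_enum _).
  by rewrite mulf_eq0 negb_or !exp_inv_pow_neq0 !subr_gt0.
move=> h; apply/allP => i _ /=.
by rewrite mulf_eq0 negb_or !exp_inv_pow_neq0 !subr_gt0.
Qed.

End bump.

(** * Test functions *)

Section test_functions.
Context {R : realType} {n : nat} (Omega : set 'rV[R]_n).
Implicit Types phi psi : 'rV[R]_n -> R.

Lemma test_smooth phi : test_function Omega phi -> smooth phi.
Proof. by case. Qed.

Lemma test_function_sub phi psi : test_function Omega phi -> smooth psi ->
  [set x | psi x != 0] `<=` closure [set x | phi x != 0] ->
  test_function Omega psi.
Proof.
move=> [sphi cphi phiO] spsi h.
have cl : closure [set x | psi x != 0] `<=` closure [set x | phi x != 0].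
  by rewrite [X in _ `<=` X](closure_id _).1; [exact: closureS|exact: closed_closure].
split => //; last exact: subset_trans cl phiO.
exact: subclosed_compact (@closed_closure _ _) cphi cl.
Qed.

Lemma test_function_mul phi psi : test_function Omega phi -> smooth psi ->
  test_function Omega (fun x => phi x * psi x).
Proof.
move=> tphi spsi; apply: (test_function_sub tphi).
  exact: (smooth_mul (test_smooth tphi) spsi).
move=> x /=; rewrite mulf_eq0 negb_or => /andP[h _]; exact: subset_closure.
Qed.

Lemma test_function_scale c phi : test_function Omega phi ->
  test_function Omega (fun x => c * phi x).
Proof.
move=> tphi; have := test_function_mul tphi (smooth_cst c).
by rewrite (_ : (fun x => c * phi x) = (fun x => phi x * c))//;
  apply/funext => x; rewrite mulrC.
Qed.

Lemma test_function_add phi psi : test_function Omega phi ->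
  test_function Omega psi -> test_function Omega (fun x => phi x + psi x).
Proof.
move=> [sphi cphi phiO] [spsi cpsi psiO].
have cl : closure [set x | phi x + psi x != 0] `<=`
    closure [set x | phi x != 0] `|` closure [set x | psi x != 0].
  rewrite -closureU; apply: closureS => x /= h.
  have [p0|] := eqVneq (phi x) 0; last by left.
  by right; move: h; rewrite p0 add0r.
split; first exact: smooth_add.
  apply: (subclosed_compact _ _ cl); first exact: closed_closure.
  exact: compactU.
by apply: (subset_trans cl); rewrite subUset.
Qed.

(** A function vanishes near each point outside its closed support, hence so
    do its partial derivatives. *)
Lemma partial_out phi i x : ~ closure [set x | phi x != 0] x ->
  partial i phi x = 0.
Proof.
move=> nx; have hc : is_derive x (delta_mx ord0 i) (cst 0 : 'rV[R]_n -> R) 0 :=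
  is_derive_cst 0 x _.
suff : is_derive x (delta_mx ord0 i) phi 0 by case.
apply: (near_eq_is_derive _ hc).
have : open (~` closure [set x | phi x != 0]).
  by apply: closed_openC; exact: closed_closure.
move=> oC; have := open_nbhs_nbhs (conj oC nx); apply: filterS => y ny.
apply/esym/eqP; apply: contrapT => /negP h'; apply: ny; exact: subset_closure.
Qed.

Lemma test_function_partial phi i : test_function Omega phi ->
  test_function Omega (partial i phi).
Proof.
move=> tphi; apply: (test_function_sub tphi).
  exact/smooth_partial/(test_smooth tphi).
by move=> x /= h; apply: contrapT => /(partial_out i)/eqP; rewrite (negbTE h).
Qed.

Lemma test_function0 : test_function Omega (fun=> 0).
Proof.
have e : [set x : 'rV[R]_n | (0 : R) != 0] = set0.
  by apply/seteqP; split => // x /=; rewrite eqxx.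
rewrite /test_function e closure0.
by split => //; [exact: smooth_cst|exact: compact0].
Qed.

(** Test functions form an algebra, so polynomials without constant term act
    on them. Composition with a function that is only C^1 leaves the class; it
    is reached later as a limit of polynomials. *)
Lemma test_function_horner phi (p : {poly R}) : p.[0] = 0 ->
  test_function Omega phi -> test_function Omega (fun x => p.[phi x]).
Proof.
move=> p0 tphi; apply: (test_function_sub tphi).
  by apply: smooth_comp; [move=> k; exact: C1k_horner|exact: test_smooth].
move=> x /= h; apply: subset_closure => /=; apply: contraNN h => /eqP ->.
by rewrite p0.
Qed.

Lemma test_function_out phi x : test_function Omega phi -> ~ Omega x -> phi x = 0.
Proof.
move=> [_ _ h] nx; apply/eqP; apply: contrapT => /negP px; apply/nx/h.
exact: subset_closure.
Qed.

Lemma bounded_row_box (A : set 'rV[R]_n) : bounded_set A ->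
  exists M, A `<=` row_box M.
Proof.
move=> [M [Mr h]]; exists (M + 1) => x /(h (M + 1)).
rewrite ltrDl ltr01 => /(_ isT) xM i; apply: le_trans xM.
have : `|x ord0 i| \in [seq `|x j.1 j.2| | j : 'I_1 * 'I_n].
  by apply/mapP; exists (ord0, i) => //=; rewrite mem_enum.
move=> /mapP[j _ ->]; have -> : `|x| = mx_norm x by [].
rewrite mx_normrE; by apply/bigmax_geP; right; exists j.
Qed.

Lemma test_function_box_bump (a b : 'rV[R]_n) :
  (forall x : 'rV[R]_n, (forall i, a ord0 i <= x ord0 i <= b ord0 i) -> Omega x) ->
  test_function Omega (box_bump a b).
Proof.
move=> abO.
have cl : closure [set x | box_bump a b x != 0] `<=`
   [set x | forall i, `[a ord0 i, b ord0 i]%classic (x ord0 i)].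
  have cbox : closed [set x : 'rV[R]_n |
      forall i, `[a ord0 i, b ord0 i]%classic (x ord0 i)].
    apply: compact_closed; first exact: norm_hausdorff.
    apply: (rV_compact (A := fun i => `[a ord0 i, b ord0 i]%classic)) => i.
  exact: segment_compact.
  move=> y hy; apply: cbox; move: y hy; apply: closureS => x /=.
  move=> /box_bump_neq0 h i; rewrite in_itv/=.
  by have /andP[/ltW-> /ltW->] := h i.
split; first exact: smooth_box_bump.
  apply: (subclosed_compact _ _ cl); first exact: closed_closure.
  apply: (rV_compact (A := fun i => `[a ord0 i, b ord0 i]%classic)) => i.
  exact: segment_compact.
move=> x /cl h; apply: abO => i; have := h i.
by rewrite /= in_itv.
Qed.

End test_functions.

(** * Slices, integration by parts and the Gagliardo-Nirenberg-Sobolev inequality *)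

Section c1c.
Context {R : realType}.
Local Notation leb := (@lebesgue_measure R).

(** C^1 functions supported in a box. Unlike test functions of a fixed open
    set, they are stable under freezing the first coordinate, which is what
    induction on the dimension requires. *)
Definition C1c n (M : R) (u : 'rV[R]_n -> R) : Prop :=
  [/\ continuous u, (forall x, ~ row_box M x -> u x = 0) &
   forall i, [/\ forall x, is_derive x (delta_mx ord0 i) u (partial i u x),
     continuous (partial i u) & forall x, ~ row_box M x -> partial i u x = 0]].

Lemma row_cons_line0 n (t : R) (y : 'rV[R]_n) :
  row_cons (t, y) = t *: delta_mx ord0 ord0 + row_cons (0, y).
Proof.
apply/rowP => i; rewrite !mxE eqxx/=; case: (unliftP ord0 i) => [j|] ->.
  by rewrite mulr0 add0r.
by rewrite mulr1 addr0.
Qed.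

Lemma row_cons_lineS n (t h : R) (y : 'rV[R]_n) j :
  row_cons (t, h *: delta_mx ord0 j + y) =
  h *: delta_mx ord0 (lift ord0 j) + row_cons (t, y).
Proof.
apply/rowP => i; rewrite !mxE eqxx/=; case: (unliftP ord0 i) => [k|] ->.
  by rewrite /= !mxE eqxx/= (inj_eq lift_inj).
by rewrite /= -[_%:R]/(0 : R) mulr0 add0r.
Qed.

Lemma continuous_row_cons1 n (y : 'rV[R]_n) :
  continuous (fun t : R => row_cons (t, y)).
Proof.
move=> t A /nbhs_ballP[e /= e0 eA]; apply/nbhs_ballP; exists e => //= s ts.
apply: eA; split => // i j; rewrite !mxE.
case: (unliftP ord0 j) => [k|] _ /=; [exact: ballxx|exact: ts].
Qed.

Lemma continuous_row_cons2 n (t : R) :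
  continuous (fun y : 'rV[R]_n => row_cons (t, y)).
Proof.
move=> y A /nbhs_ballP[e /= e0 eA]; apply/nbhs_ballP; exists e => //= z yz.
apply: eA; split => // i j; rewrite !mxE.
case: (unliftP ord0 j) => [k|] _ /=; last exact: ballxx.
by case: yz => _ /(_ ord0 k).
Qed.

Lemma C1c_slice n M (u : 'rV[R]_n.+1 -> R) t : C1c M u ->
  C1c M (fun y => u (row_cons (t, y))) /\
  forall i y, partial i (fun y => u (row_cons (t, y))) y =
    partial (lift ord0 i) u (row_cons (t, y)).
Proof.
move=> [cu su du].
have dS i y : is_derive y (delta_mx ord0 i) (fun y => u (row_cons (t, y)))
    (partial (lift ord0 i) u (row_cons (t, y))).
  have [d _ _] := du (lift ord0 i); have /is_derive_line0 := d (row_cons (t, y)).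
  move=> h; apply/is_derive_line0; move: h; congr is_derive.
  by apply/funext => s; rewrite row_cons_lineS.
have pE i y : partial i (fun y => u (row_cons (t, y))) y =
    partial (lift ord0 i) u (row_cons (t, y)) by have [] := dS i y.
split=> //; split.
- move=> y; apply: continuous_comp; [exact: continuous_row_cons2|exact: cu].
- by move=> y ny; apply: su => /row_box_cons[].
- move=> i; have [_ c s] := du (lift ord0 i); split.
  + by move=> y; rewrite pE.
  + rewrite (_ : partial i _ = fun y => partial (lift ord0 i) u (row_cons (t, y))).
      move=> y; apply: continuous_comp; [exact: continuous_row_cons2|exact: c].
    by apply/funext => y; rewrite pE.
  + by move=> y ny; rewrite pE s// => /row_box_cons[].
Qed.

Lemma C1c_line n M (u : 'rV[R]_n.+1 -> R) y : C1c M u ->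
  [/\ forall t : R, is_derive t 1 (fun s : R => u (row_cons (s, y)))
       (partial ord0 u (row_cons (t, y))),
     continuous (fun t : R => partial ord0 u (row_cons (t, y))),
     forall t, M < `|t| -> u (row_cons (t, y)) = 0 &
     forall t, M < `|t| -> partial ord0 u (row_cons (t, y)) = 0].
Proof.
move=> [cu su du]; have [d c s] := du ord0; split.
- move=> t; have := d (row_cons (t, y)); rewrite {1}row_cons_line0.
  move=> /is_derive_line; congr is_derive.
  by apply/funext => r; rewrite -row_cons_line0.
- move=> t; apply: (@continuous_comp _ _ _ (fun t : R => row_cons (t, y)) (partial ord0 u)).
    exact: continuous_row_cons1.
  exact: c.
- by move=> t Mt; apply: su => /row_box_cons[]; rewrite leNgt Mt.
- by move=> t Mt; apply: s => /row_box_cons[]; rewrite leNgt Mt.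
Qed.

Lemma integral_itv_derivative (g g' : R -> R) a b : a < b ->
  (forall t : R, is_derive t 1 g (g' t)) -> continuous g' ->
  (\int[leb]_(x in `[a, b]) (g' x)%:E = (g b - g a)%:E)%E.
Proof.
move=> ab dg cg'.
have cg : continuous g.
  move=> t; apply: differentiable_continuous.
  by apply/derivable1_diffP; have [] := dg t.
rewrite (@continuous_FTC2 _ _ g)//.
- exact: continuous_subspaceT.
- split.
  + by move=> x _; have [] := dg x.
  + exact/cvg_at_right_filter/cg.
  + exact/cvg_at_left_filter/cg.
- by move=> x _; rewrite derive1E; have [] := dg x.
Qed.

(** The fundamental theorem of calculus on an interval that contains the
    support in its interior. *)
Lemma integral_derivative0 (g g' : R -> R) M :
  (forall t : R, is_derive t 1 g (g' t)) -> continuous g' ->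
  (forall t, M < `|t| -> g t = 0) -> (forall t, M < `|t| -> g' t = 0) ->
  (\int[leb]_x (g' x)%:E = 0)%E.
Proof.
move=> dg cg' g0 g'0; pose K := `|M| + 1.
have MK : M < K by rewrite (le_lt_trans (ler_norm _))// ltrDl.
have K0 : 0 < K by rewrite ltr_wpDl.
have -> : (\int[leb]_x (g' x)%:E = \int[leb]_(x in `[(- K)%R, K]) (g' x)%:E)%E.
  rewrite [RHS]integral_mkcond; apply: eq_integral => x _.
  rewrite patchE; case: ifPn => //; rewrite notin_setE/= in_itv/= -ler_norml.
  by move=> /negP; rewrite -ltNge => Kx; rewrite g'0// (lt_trans MK).
rewrite (integral_itv_derivative (g := g))//.
  by rewrite !g0 ?subrr// ?normrN gtr0_norm.
by rewrite gtrN.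
Qed.

(** g t is the integral of g' from a point to the left of the support. *)
Lemma sup_le_integral_derivative (g g' : R -> R) M t :
  (forall t : R, is_derive t 1 g (g' t)) -> continuous g' ->
  (forall t, M < `|t| -> g t = 0) ->
  (`|g t|%:E <= \int[leb]_x `|g' x|%:E)%E.
Proof.
move=> dg cg' g0.
have mg' : measurable_fun setT (fun x : R => `|g' x|%:E : \bar R).
  apply: measurableT_comp => //; apply: measurableT_comp => //.
  exact: continuous_measurable_fun.
have [tM|Mt] := ltP M `|t|.
  by rewrite g0// normr0; apply: integral_ge0 => x _; rewrite lee_fin.
pose K := `|M| + 1 + `|t|.
have MK : M < K by rewrite (le_lt_trans (ler_norm _))// /K -addrA ltrDl ltr_pwDl.
have Kt : - K < t.
  rewrite ltrNl /K; apply: (le_lt_trans (y := `|t|)); first by rewrite -normrN ler_norm.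
  by rewrite ltrDr ltr_wpDl.
have K0 : 0 < K by rewrite /K -addrA ltr_wpDl// ltr_pwDl.
have h := integral_itv_derivative Kt dg cg'.
have gK : g (- K) = 0 by rewrite g0// normrN gtr0_norm.
rewrite gK subr0 in h.
rewrite -[leLHS]/(`|(g t)%:E|)%E -h.
apply: (le_trans (le_abse_integral _ _ _)) => //.
  apply: measurableT_comp => //; apply: measurable_funTS.
  exact: continuous_measurable_fun.
exact: ge0_subset_integral.
Qed.

Lemma C1c_bounded n M (w : 'rV[R]_n -> R) : continuous w ->
  (forall x, ~ row_box M x -> w x = 0) ->
  exists2 B : R, 0 <= B & forall x, `|w x| <= B * \1_(row_box M) x.
Proof.
move=> cw sw.
have cb : compact (row_box M : set 'rV[R]_n).
  rewrite (_ : row_box M = [set x | forall i, `[-M, M]%classic (x ord0 i)]).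
    apply: (rV_compact (A := fun=> `[-M, M]%classic)) => i.
    exact: segment_compact.
  by apply/seteqP; split => y /= h i; have := h i; rewrite /= in_itv/= -ler_norml.
have : compact (w @` row_box M).
  by apply: continuous_compact => //; exact: continuous_subspaceT.
move=> /compact_bounded[B [Br hB]].
have B1 : B < `|B| + 1 by rewrite (le_lt_trans (ler_norm _))// ltrDl.
exists (`|B| + 1); first by rewrite addr_ge0.
move=> x; rewrite indicE; case: (boolP (x \in _)) => [|] xM; last first.
  by rewrite sw ?normr0 ?mulr0// => h; move: xM; rewrite notin_setE; exact.
rewrite mulr1; apply: (hB _ B1); exists x => //; exact: set_mem xM.
Qed.

Lemma C1c_integrable n M (w : 'rV[R]_n -> R) : continuous w ->
  (forall x, ~ row_box M x -> w x = 0) ->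
  (lebesgue_row n).-integrable setT (EFin \o w).
Proof.
move=> cw sw; have [B B0 hB] := C1c_bounded cw sw.
apply/integrableP; split.
  by apply: measurableT_comp => //; exact: continuous_measurable_row.
apply: (@le_lt_trans _ _ (\int[lebesgue_row n]_x
    (B%:E * (\1_(row_box M) x)%:E)))%E.
  apply: ge0_le_integral => //.
  - apply: measurableT_comp => //; apply: measurableT_comp => //.
    exact: continuous_measurable_row.
  - apply: measurable_funeM; apply: measurableT_comp => //.
    by apply: measurable_indic; exact: measurable_row_box.
  - by move=> x _; rewrite -EFinM lee_fin; exact: hB.
rewrite ge0_integralZl//; last first.
  by apply: measurableT_comp => //; apply: measurable_indic; exact: measurable_row_box.
rewrite integral_indic// ?setIT; last exact: measurable_row_box.
by apply: lte_mul_pinfty => //; exact: row_box_fin.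
Qed.

(** Fubini: for the first coordinate the inner integral vanishes on each line;
    for the other ones the slices are handled by induction on the dimension. *)
Lemma integral_partial0 n M (u : 'rV[R]_n -> R) i : C1c M u ->
  (\int[lebesgue_row n]_x (partial i u x)%:E = 0)%E.
Proof.
elim: n u i => [|n IH] u i; first by case: i.
move=> Cu; have [_ _ du] := Cu; have [_ ci si] := du i.
case: (unliftP ord0 i) ci si => [j|] -> ci si.
  rewrite integral_rowS; last exact: C1c_integrable ci si.
  rewrite integral0_eq// => t _.
  have [Ct pE] := C1c_slice t Cu.
  by rewrite -[RHS](IH _ j Ct); apply: eq_integral => y _; rewrite pE.
rewrite integral_rowS2; last exact: C1c_integrable ci si.
rewrite integral0_eq// => y _.
have [d c s1 s2] := C1c_line y Cu.
exact: integral_derivative0 d c s1 s2.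
Qed.

Lemma lee_poweR (a b : \bar R) (r : R) : 0 <= r -> (0 <= a)%E -> (a <= b)%E ->
  (a `^ r <= b `^ r)%E.
Proof.
move=> r0 a0 ab; apply: (gt0_ler_poweR r0) => //.
  by rewrite in_itv/= a0 leey.
by rewrite in_itv/= (le_trans a0 ab) leey.
Qed.

(** The gradient is measured in the l^1 norm because it is additive over the
    coordinates, and so splits along slices. *)
Definition grad1 n (u : 'rV[R]_n -> R) (x : 'rV[R]_n) : R :=
  \sum_(i < n) `|partial i u x|.

Lemma grad1_ge0 n (u : 'rV[R]_n -> R) x : 0 <= grad1 u x.
Proof. by apply: sumr_ge0. Qed.

Lemma measurable_grad1 n M (u : 'rV[R]_n -> R) : C1c M u ->
  measurable_fun setT (grad1 u).
Proof.
move=> [_ _ du]; apply: measurable_sum => i; apply: measurableT_comp => //.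
by apply: continuous_measurable_row; have [] := du i.
Qed.

(** In dimension n the Sobolev inequality is a bound on |w| in
    L^(n / (n - 1)). By duality it says that the integral of |w| v^(1/n) is at
    most that of the gradient times the power 1/n of the integral of v. This
    form also makes sense for n = 1, where it starts the induction, and
    applies to slices: there v is the integral of |d_0 u| along the first
    axis, which bounds |u|. *)
Definition slice_bound n := forall M (w : 'rV[R]_n -> R), C1c M w ->
  forall v : 'rV[R]_n -> R, measurable_fun setT v -> (forall x, 0 <= v x) ->
  (\int[lebesgue_row n]_x (`|w x| * v x `^ n%:R^-1)%:E <=
   (\int[lebesgue_row n]_x (grad1 w x)%:E) *
   (\int[lebesgue_row n]_x (v x)%:E) `^ n%:R^-1)%E.

(** On the line |w| is at most the integral of |w'|. *)
Lemma slice_bound1 : slice_bound 1.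
Proof.
move=> M w Cw v mv v0; have [cw _ _] := Cw.
have mg := measurable_grad1 Cw.
set W := (\int[lebesgue_row 1]_x (grad1 w x)%:E)%E.
have W0 : (0 <= W)%E by apply: integral_ge0 => x _; rewrite lee_fin grad1_ge0.
have wW x : (`|w x|%:E <= W)%E.
  rewrite /W ge0_integral_rowS2//; last 2 first.
  - exact: measurableT_comp.
  - by move=> y; rewrite lee_fin grad1_ge0.
  have [t [y ->]] : exists t y, x = row_cons (t, y).
    exists (row_uncons x).1, (row_uncons x).2; apply/rowP => i.
    by rewrite !mxE; case: (unliftP ord0 i) => [j|] -> //=; rewrite mxE.
  have yE (z : 'rV[R]_0) : z = y by apply/rowP => -[].
  rewrite (eq_integral (fun=> \int[leb]_s (grad1 w (row_cons (s, y)))%:E)%E);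
    last by move=> z _; rewrite (yE z).
  rewrite integral_cst//= /lebesgue_row0 diracT mule1.
  have [d c s1 s2] := C1c_line y Cw.
  apply: (le_trans (sup_le_integral_derivative t d c s1)).
  apply: ge0_le_integral => //.
  - apply: measurableT_comp => //; apply: measurableT_comp => //.
    exact: continuous_measurable_fun.
  - apply: measurableT_comp => //.
    apply: (measurableT_comp mg); apply: (measurableT_comp (@measurable_row_cons R 0)).
    exact: measurable_pair2.
  - by move=> s _; rewrite lee_fin /grad1 big_ord_recl lerDl sumr_ge0.
rewrite invr1; under eq_integral => x _ do rewrite powRr1//.
rewrite poweRe1; last by apply: integral_ge0 => x _; rewrite lee_fin.
rewrite -ge0_integralZl//; last 2 first.
- exact: measurableT_comp.
- by move=> x _; rewrite lee_fin.
apply: ge0_le_integral => //.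
- by move=> x _; rewrite lee_fin mulr_ge0.
- apply: measurableT_comp => //; apply: measurable_funM => //.
  by apply: measurableT_comp => //; exact: continuous_measurable_row.
- by apply: measurable_funeM; exact: measurableT_comp.
- by move=> x _; rewrite EFinM lee_wpmul2r// lee_fin.
Qed.

(** Let v y be the integral of |d_0 u| over the line through (0, y). It bounds
    |u|, so |u|^(1 + 1/(n + 1)) <= |u| v^(1/(n + 1)), and the slice bound
    applies on each hyperplane t = const; integrating over t and using that v
    has integral at most that of the gradient gives the claim. *)
Lemma sobolev_of_slice_bound n M (u : 'rV[R]_n.+2 -> R) : slice_bound n.+1 ->
  C1c M u ->
  (\int[lebesgue_row n.+2]_x (`|u x| `^ (1 + n.+1%:R^-1))%:E <=
   (\int[lebesgue_row n.+2]_x (grad1 u x)%:E) `^ (1 + n.+1%:R^-1))%E.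
Proof.
move=> sb Cu; have [cu _ du] := Cu; have [_ c0 _] := du ord0.
have mg := measurable_grad1 Cu.
pose q : R := n.+1%:R^-1.
have q0 : 0 < q by rewrite invr_gt0.
set D := (\int[lebesgue_row n.+2]_x (grad1 u x)%:E)%E.
have D0 : (0 <= D)%E by apply: integral_ge0 => x _; rewrite lee_fin grad1_ge0.
have mc : measurable_fun setT (fun p : measurableTypeR R * 'rV[R]_n.+1 =>
    `|partial ord0 u (row_cons p)|%:E : \bar R).
  apply: measurableT_comp => //; apply: measurableT_comp => //.
  apply: measurableT_comp; last exact: measurable_row_cons.
  exact: continuous_measurable_row.
pose ve (y : 'rV[R]_n.+1) := (\int[leb]_t `|partial ord0 u (row_cons (t, y))|%:E)%E.
have mve : measurable_fun setT ve.
  have h := @measurable_fun_fubini_tonelli_G _ _ _ _ _ leb _ mc.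
  by apply: h => x; rewrite lee_fin.
have ve0 y : (0 <= ve y)%E by apply: integral_ge0 => x _; rewrite lee_fin.
have vef y : ve y \is a fin_num.
  have [d c s1 s2] := C1c_line y Cu; rewrite ge0_fin_numE// /ve.
  (* v is finite: the integrand is bounded and supported in an interval. *)
  have [B B0 hB] := C1c_bounded c0 (let: And3 _ _ s := du ord0 in s).
  apply: (@le_lt_trans _ _ (\int[leb]_t
    (B%:E * (\1_(`[(- M)%R, M]%classic : set R) t)%:E)))%E.
    apply: ge0_le_integral => //.
    - exact: (measurableT_comp mc (measurable_pair2 y)).
    - by apply: measurable_funeM; apply: measurableT_comp => //; exact: measurable_indic.
    - move=> t _; rewrite -EFinM lee_fin; apply: le_trans (hB _) _.
      rewrite ler_wpM2l// !indicE ler_nat; case: (boolP (_ \in _)) => //.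
      move=> /set_mem/row_box_cons[+ _]; rewrite ler_norml => h.
      by rewrite mem_set//= in_itv.
  rewrite ge0_integralZl//; last by apply: measurableT_comp => //; exact: measurable_indic.
  rewrite integral_indic// setIT; apply: lte_mul_pinfty => //.
  have Moo : (lebesgue_measure (`[(- M)%R, M]%classic : set R) < +oo)%E.
    by rewrite lebesgue_measure_itv/=; case: ifPn => // _; rewrite -EFinB ltry.
  exact: Moo.
pose v y := fine (ve y).
have vE y : (v y)%:E = ve y by rewrite /v fineK.
have mv : measurable_fun setT v by exact: measurableT_comp.
have v0 y : 0 <= v y by exact: fine_ge0.
have uv t y : `|u (row_cons (t, y))| <= v y.
  rewrite -lee_fin vE; have [d c s1 s2] := C1c_line y Cu.
  exact: sup_le_integral_derivative t d c s1.
have VD : (\int[lebesgue_row n.+1]_y (v y)%:E <= D)%E.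
  under eq_integral => y _ do rewrite vE.
  rewrite /D ge0_integral_rowS2//; last 2 first.
  - exact: measurableT_comp.
  - by move=> x; rewrite lee_fin grad1_ge0.
  have mg' : measurable_fun setT (fun p : measurableTypeR R * 'rV[R]_n.+1 =>
      (grad1 u (row_cons p))%:E : \bar R).
    by apply: measurableT_comp => //; apply: measurableT_comp => //; exact: measurable_row_cons.
  apply: ge0_le_integral => //.
  - have h := @measurable_fun_fubini_tonelli_G _ _ _ _ _ leb _ mg'.
    by apply: h => x; rewrite lee_fin grad1_ge0.
  - move=> y _; apply: ge0_le_integral => //.
    + exact: (measurableT_comp mc (measurable_pair2 y)).
    + exact: (measurableT_comp mg' (measurable_pair2 y)).
    + by move=> s _; rewrite lee_fin /grad1 big_ord_recl lerDl sumr_ge0.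
have mg' : measurable_fun setT (fun p : measurableTypeR R * 'rV[R]_n.+1 =>
      (grad1 u (row_cons p))%:E : \bar R).
  by apply: measurableT_comp => //; apply: measurableT_comp => //; exact: measurable_row_cons.
have mu' : measurable_fun setT (fun p : measurableTypeR R * 'rV[R]_n.+1 =>
      `|u (row_cons p)|).
  apply: measurableT_comp => //; apply: measurableT_comp; last exact: measurable_row_cons.
  exact: continuous_measurable_row.
have mFg : measurable_fun setT (fun t : measurableTypeR R =>
    \int[lebesgue_row n.+1]_y (grad1 u (row_cons (t, y)))%:E)%E.
  have h := @measurable_fun_fubini_tonelli_F _ _ _ _ _ (lebesgue_row n.+1) _ mg'.
  by apply: h => x; rewrite lee_fin grad1_ge0.
have mup : measurable_fun setT (fun p : measurableTypeR R * 'rV[R]_n.+1 =>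
      (`|u (row_cons p)| `^ (1 + q))%:E : \bar R).
  by apply: measurableT_comp => //; exact: (measurableT_comp (measurable_powR _) mu').
have mFu : measurable_fun setT (fun t : measurableTypeR R =>
    \int[lebesgue_row n.+1]_y (`|u (row_cons (t, y))| `^ (1 + q))%:E)%E.
  have h := @measurable_fun_fubini_tonelli_F _ _ _ _ _ (lebesgue_row n.+1) _ mup.
  by apply: h => x; rewrite lee_fin powR_ge0.
set V := (\int[lebesgue_row n.+1]_y (v y)%:E)%E in VD *.
have V0 : (0 <= V)%E by apply: integral_ge0 => x _; rewrite lee_fin.
rewrite ge0_integral_rowS; last 2 first.
- apply: measurableT_comp => //; apply: (measurableT_comp (measurable_powR _)).
  by apply: measurableT_comp => //; exact: continuous_measurable_row.
- by move=> x; rewrite lee_fin powR_ge0.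
apply: (@le_trans _ _ (\int[leb]_t
   ((\int[lebesgue_row n.+1]_y (grad1 u (row_cons (t, y)))%:E) * V `^ q)))%E.
  apply: ge0_le_integral => //.
  - by move=> t _; apply: integral_ge0 => x _; rewrite lee_fin powR_ge0.
  - exact: emeasurable_funM.
  (* The slice bound on the hyperplane of abscissa t. *)
  - move=> t _; have [Ct pE] := C1c_slice t Cu.
    apply: (@le_trans _ _ (\int[lebesgue_row n.+1]_y
       (`|u (row_cons (t, y))| * v y `^ q)%:E)%E).
      apply: ge0_le_integral => //.
      + exact: (measurableT_comp mup (measurable_pair1 t)).
      + apply: measurableT_comp => //; apply: measurable_funM.
          exact: (measurableT_comp mu' (measurable_pair1 t)).
        exact: (measurableT_comp (measurable_powR _) mv).
      + move=> y _; rewrite lee_fin.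
        have [->|un0] := eqVneq `|u (row_cons (t, y))| 0.
          by rewrite powR0 ?mul0r// gt_eqF// addr_gt0.
        rewrite powRD ?un0 ?implybT// powRr1// ler_pM2l; last first.
          by rewrite lt_neqAle eq_sym un0 normr_ge0.
        by apply: ge0_ler_powR; rewrite ?nnegrE// ltW.
    apply: (le_trans (sb _ _ Ct v mv v0)); apply: lee_wpmul2r.
      exact: poweR_ge0.
    apply: ge0_le_integral => //.
    + by move=> y _; rewrite lee_fin grad1_ge0.
    + by apply: measurableT_comp => //; exact: measurable_grad1 Ct.
    + exact: (measurableT_comp mg' (measurable_pair1 t)).
    + move=> y _; rewrite lee_fin /grad1 [leRHS]big_ord_recl.
      by under eq_bigr => i _ do rewrite pE; rewrite lerDr.
rewrite ge0_integralZr//; last 2 first.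
- by move=> t _; apply: integral_ge0 => x _; rewrite lee_fin grad1_ge0.
- exact: poweR_ge0.
rewrite -(ge0_integral_rowS (f := fun x => (grad1 u x)%:E)); last 2 first.
- exact: measurableT_comp.
- by move=> x; rewrite lee_fin grad1_ge0.
rewrite -/D poweRD; last by rewrite /poweRD_def gt_eqF// addr_gt0.
rewrite poweRe1//; apply: lee_wpmul2l => //.
by apply: lee_poweR => //; exact: ltW.
Qed.

(** Hoelder's inequality with the exponents p = 1 + 1/(n + 1) and n + 2, the
    first factor being bounded by the Sobolev inequality. *)
Lemma slice_boundS n : slice_bound n.+1 -> slice_bound n.+2.
Proof.
move=> sb M w Cw v mv v0; have [cw _ _] := Cw.
have GN := sobolev_of_slice_bound sb Cw.
set D := (\int[lebesgue_row n.+2]_x (grad1 w x)%:E)%E in GN *.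
have D0 : (0 <= D)%E by apply: integral_ge0 => x _; rewrite lee_fin grad1_ge0.
pose p : R := 1 + n.+1%:R^-1.
have p0 : 0 < p by rewrite addr_gt0// invr_gt0.
have mw : measurable_fun setT (fun x => `|w x|).
  by apply: measurableT_comp => //; exact: continuous_measurable_row.
have mvq : measurable_fun setT (fun x => v x `^ n.+2%:R^-1).
  exact: (measurableT_comp (measurable_powR _) mv).
have pq : p^-1 + n.+2%:R^-1 = 1.
  rewrite /p -(natr1 n.+1); have : 0 < n.+1%:R :> R by []; move: (n.+1%:R : R) => a a0.
  clear -a0; field; lra.
have := hoelder (lebesgue_row n.+2) mw mvq p0 (ltr0Sn _ _) pq.
rewrite Lnorm1 unlock => H.
apply: le_trans; last (apply: le_trans H _).
  apply: ge0_le_integral => //.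
  - by move=> x _; rewrite lee_fin mulr_ge0// powR_ge0.
  - by apply: measurableT_comp => //; exact: measurable_funM.
  - apply: measurableT_comp => //; apply: measurableT_comp => //; exact: measurable_funM.
  - by move=> x _; rewrite /= lee_fin ler_norm.
apply: lee_pmul; rewrite ?poweR_ge0//.
  rewrite -[leRHS]poweRe1// -(divff (lt0r_neq0 p0)) poweRrM.
  apply: lee_poweR.
  - by rewrite invr_ge0 ltW.
  - by apply: integral_ge0 => x _; exact: poweR_ge0.
  - rewrite (eq_integral (fun x => (`|w x| `^ p)%:E)); first exact: GN.
    by move=> x _ /=; rewrite normr_id.
rewrite (eq_integral (fun x => (v x)%:E))// => x _ /=.
by rewrite ger0_norm ?powR_ge0// -powRrM mulVf ?powRr1.
Qed.

Lemma slice_boundP n : slice_bound n.+1.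
Proof. by elim: n => [|n IH]; [exact: slice_bound1|exact: slice_boundS]. Qed.

Theorem gagliardo_nirenberg_sobolev n M (u : 'rV[R]_n.+2 -> R) : C1c M u ->
  (\int[lebesgue_row n.+2]_x (`|u x| `^ (1 + n.+1%:R^-1))%:E <=
   (\int[lebesgue_row n.+2]_x (grad1 u x)%:E) `^ (1 + n.+1%:R^-1))%E.
Proof. exact/sobolev_of_slice_bound/slice_boundP. Qed.

End c1c.

(** * Square-integrable functions *)

Section subsequences.

(** Taking N k for the k-th threshold, the k-th index is chosen above it and
    above the previous index. *)
Lemma exists_subsequence (P : nat -> nat -> Prop) :
  (forall k, exists N, forall m, (N <= m)%N -> P k m) ->
  exists s : nat -> nat, (forall k, (s k < s k.+1)%N) /\
    forall k m, (s k <= m)%N -> P k m.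
Proof.
move=> /choice[N HN].
pose s := fix s k := if k is j.+1 then maxn (s j).+1 (N k) else N 0%N.
exists s; split => [k|k m sm]; first by rewrite /= leq_maxl.
apply: HN; apply: leq_trans sm.
by case: k => //= k; exact: leq_maxr.
Qed.

Lemma subsequence_ge (s : nat -> nat) k : (forall k, (s k < s k.+1)%N) -> (k <= s k)%N.
Proof. by move=> h; elim: k => // k IH; exact: leq_ltn_trans IH (h k). Qed.

Lemma cvg_subsequence (T : topologicalType) (u : nat -> T) (l : T) (s : nat -> nat) :
  (forall k, (s k < s k.+1)%N) -> u k @[k --> \oo] --> l ->
  u (s k) @[k --> \oo] --> l.
Proof.
move=> hs ul; apply: cvg_comp ul => A [N _ NA]; exists N => // k /= Nk.
by apply: NA => /=; apply: leq_trans Nk _; exact: subsequence_ge.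
Qed.

End subsequences.

Lemma eq_cvgn {R : realType} (a b : nat -> R) (l : R) : (forall k, a k = b k) ->
  a k @[k --> \oo] --> l -> b k @[k --> \oo] --> l.
Proof. by move=> /funext ->. Qed.

Section L2.
Context d {T : measurableType d} {R : realType} (mu : {measure set T -> \bar R}).
Context (D : set T) (mD : measurable D).
Implicit Types u v w : T -> R.

Definition rintegrable u : Prop := mu.-integrable D (EFin \o u).

Lemma rintegrableP u : rintegrable u <->
  measurable_fun D u /\ (\int[mu]_(x in D) `|u x|%:E < +oo)%E.
Proof.
split=> [/integrableP[mu1 h]|[mu1 h]].
  by split => //; apply/measurable_EFinP.
by apply/integrableP; split => //; apply/measurable_EFinP.
Qed.

Lemma rintegrable_measurable u : rintegrable u -> measurable_fun D u.
Proof. by move=> /rintegrableP[]. Qed.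

Lemma rintegrableD u v : rintegrable u -> rintegrable v ->
  rintegrable (fun x => u x + v x).
Proof. by move=> iu iv; exact: (integrableD mD iu iv). Qed.

Lemma rintegrableZ c u : rintegrable u -> rintegrable (fun x => c * u x).
Proof. by move=> iu; exact: (integrableZl mD c iu). Qed.

Lemma rintegrableB u v : rintegrable u -> rintegrable v ->
  rintegrable (fun x => u x - v x).
Proof. by move=> iu iv; exact: (integrableB mD iu iv). Qed.

Lemma rintegrable_le u v : measurable_fun D u -> rintegrable v ->
  (forall x, D x -> `|u x| <= v x) -> rintegrable u.
Proof.
move=> mu1 iv uv; apply: le_integrable iv => //; first exact/measurable_EFinP.
by move=> x Dx /=; rewrite lee_fin (le_trans (uv x Dx))// ler_norm.
Qed.

Lemma rintegrable_norm u : rintegrable u -> rintegrable (fun x => `|u x|).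
Proof. exact: integrable_norm. Qed.

Lemma rintegrable_sum (I : Type) (r : seq I) (F : I -> T -> R) :
  (forall i, rintegrable (F i)) -> rintegrable (fun x => \sum_(i <- r) F i x).
Proof.
move=> iF; elim: r => [|a r IH].
  rewrite (_ : (fun _ => _) = cst 0); first exact: integrable0.
  by apply/funext => x; rewrite big_nil.
rewrite (_ : (fun _ => _) = (fun x => F a x + \sum_(i <- r) F i x)).
  exact: rintegrableD.
by apply/funext => x; rewrite big_cons.
Qed.

Lemma EFin_Rintegral u : rintegrable u ->
  ((\int[mu]_(x in D) u x)%:E = \int[mu]_(x in D) (u x)%:E)%E.
Proof. by move=> iu; rewrite /Rintegral fineK//; exact: integrable_fin_num. Qed.

Lemma Rintegral_sum (I : Type) (r : seq I) (F : I -> T -> R) :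
  (forall i, rintegrable (F i)) ->
  \int[mu]_(x in D) (\sum_(i <- r) F i x) = \sum_(i <- r) \int[mu]_(x in D) F i x.
Proof.
move=> iF; elim: r => [|a r IH].
  rewrite big_nil (@eq_Rintegral _ _ _ mu D (fun=> 0)); last by move=> x _; rewrite big_nil.
  by rewrite Rintegral_cst// mul0r.
rewrite big_cons -IH (@eq_Rintegral _ _ _ mu D (fun x => F a x + \sum_(i <- r) F i x)).
  by rewrite (RintegralD mD (iF a) (rintegrable_sum r iF)).
by move=> x _; rewrite big_cons.
Qed.

Definition sqint u : Prop := measurable_fun D u /\ rintegrable (fun x => u x ^+ 2).
Definition ip u v : R := \int[mu]_(x in D) (u x * v x).
(** The square of the L^2 norm: squares keep the algebra polynomial, and
    convergence to 0 is the same. *)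
Definition nrm2 u : R := \int[mu]_(x in D) (u x ^+ 2).

Lemma nrm2_ge0 u : 0 <= nrm2 u.
Proof. by apply: Rintegral_ge0 => x _; exact: sqr_ge0. Qed.

Lemma sqint_mul u v : sqint u -> sqint v -> rintegrable (fun x => u x * v x).
Proof.
move=> [mu1 iu] [mv iv].
apply: (rintegrable_le _ (rintegrableD iu iv)); first exact: measurable_funM.
move=> x _; rewrite normrM.
rewrite -(real_normK (num_real (u x))) -(real_normK (num_real (v x))).
by have := sqr_ge0 (`|u x| - `|v x|); nra.
Qed.

Lemma sqintZ c u : sqint u -> sqint (fun x => c * u x).
Proof.
move=> [mu1 iu]; split; first exact: measurable_funM.
have := rintegrableZ (c ^+ 2) iu; congr (mu.-integrable D).
by apply/funext => x /=; rewrite exprMn.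
Qed.

Lemma sqintD u v : sqint u -> sqint v -> sqint (fun x => u x + v x).
Proof.
move=> su sv; have [mu1 iu] := su; have [mv iv] := sv.
split; first exact: measurable_funD.
have := rintegrableD (rintegrableD iu iv) (rintegrableZ 2 (sqint_mul su sv)).
congr (mu.-integrable D); apply/funext => x /=; congr EFin; ring.
Qed.

Lemma sqintB u v : sqint u -> sqint v -> sqint (fun x => u x - v x).
Proof.
move=> su sv; have := sqintD su (sqintZ (-1) sv).
by congr sqint; apply/funext => x; rewrite mulN1r.
Qed.

Lemma ipC u v : ip u v = ip v u.
Proof. by apply: eq_Rintegral => x _; rewrite mulrC. Qed.

Lemma ip_nrm2 u : ip u u = nrm2 u.
Proof. by apply: eq_Rintegral => x _; rewrite expr2. Qed.

Lemma ipDl u v w : sqint u -> sqint v -> sqint w ->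
  ip (fun x => u x + v x) w = ip u w + ip v w.
Proof.
move=> su sv sw; rewrite /ip -RintegralD//; last 2 first.
- exact: sqint_mul.
- exact: sqint_mul.
by apply: eq_Rintegral => x _; rewrite mulrDl.
Qed.

Lemma ipZl c u v : sqint u -> sqint v -> ip (fun x => c * u x) v = c * ip u v.
Proof.
move=> su sv; rewrite /ip -RintegralZl//; last exact: sqint_mul.
by apply: eq_Rintegral => x _; rewrite mulrA.
Qed.

Lemma ipBl u v w : sqint u -> sqint v -> sqint w ->
  ip (fun x => u x - v x) w = ip u w - ip v w.
Proof.
move=> su sv sw; rewrite /ip -RintegralB//; last 2 first.
- exact: sqint_mul.
- exact: sqint_mul.
by apply: eq_Rintegral => x _; rewrite mulrBl.
Qed.

Lemma nrm2D c u v : sqint u -> sqint v ->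
  nrm2 (fun x => u x + c * v x) = nrm2 u + 2 * c * ip u v + c ^+ 2 * nrm2 v.
Proof.
move=> su sv; have sw := sqintZ c sv; have s1 := sqintD su sw.
rewrite -ip_nrm2 ipDl// ipZl// [ip u _]ipC [ip v _]ipC ipDl// ipDl// !ipZl//.
by rewrite !ip_nrm2 (ipC v u); ring.
Qed.

Lemma nrm2B u v : sqint u -> sqint v ->
  nrm2 (fun x => u x - v x) = nrm2 u - 2 * ip u v + nrm2 v.
Proof.
move=> su sv; have := nrm2D (-1) su sv.
rewrite (_ : (fun x => u x + -1 * v x) = (fun x => u x - v x)).
  by move=> ->; ring.
by apply/funext => x; rewrite mulN1r.
Qed.

Lemma nrm2Z c u : sqint u -> nrm2 (fun x => c * u x) = c ^+ 2 * nrm2 u.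
Proof.
move=> [_ su]; rewrite /nrm2 -RintegralZl//.
by apply: eq_Rintegral => x _; rewrite exprMn.
Qed.

Lemma nrm2_tri u v : sqint u -> sqint v ->
  nrm2 (fun x => u x + v x) <= 2 * nrm2 u + 2 * nrm2 v.
Proof.
move=> su sv; have h := nrm2D 1 su sv; have h' := nrm2B su sv.
have h3 : nrm2 (fun x => u x + 1 * v x) = nrm2 (fun x => u x + v x).
  by apply: eq_Rintegral => x _; rewrite mul1r.
have := nrm2_ge0 (fun x => u x - v x); rewrite h' -h3 h; lra.
Qed.

(** The discriminant of c |-> |u + c v|^2, which is nonnegative; if |v| = 0
    this is an affine function of c, hence constant. *)
Lemma cauchy_schwarz u v : sqint u -> sqint v -> ip u v ^+ 2 <= nrm2 u * nrm2 v.
Proof.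
move=> su sv; have [v0|v0] := eqVneq (nrm2 v) 0.
  have [->|i0] := eqVneq (ip u v) 0; first by rewrite v0 mulr0 expr0n.
  pose c := - (nrm2 u + 1) / (2 * ip u v).
  have := nrm2_ge0 (fun x => u x + c * v x); rewrite nrm2D// v0.
  have -> : 2 * c * ip u v = - (nrm2 u + 1) by rewrite /c; field; rewrite i0.
  by move=> h; exfalso; lra.
pose c := - ip u v / nrm2 v.
have := nrm2_ge0 (fun x => u x + c * v x); rewrite nrm2D//.
have vp : 0 < nrm2 v by rewrite lt_neqAle eq_sym v0 nrm2_ge0.
have -> : nrm2 u + 2 * c * ip u v + c ^+ 2 * nrm2 v =
  (nrm2 u * nrm2 v - ip u v ^+ 2) / nrm2 v by rewrite /c; field; rewrite v0.
by rewrite pmulr_lge0 ?invr_gt0// subr_ge0.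
Qed.

Lemma cauchy_schwarz_norm u v : sqint u -> sqint v ->
  `|ip u v| <= Num.sqrt (nrm2 u) * Num.sqrt (nrm2 v).
Proof.
move=> su sv; rewrite -sqrtrM ?nrm2_ge0//.
rewrite -(ler_pXn2r (n := 2))// ?nnegrE ?sqrtr_ge0//.
by rewrite real_normK ?num_real// sqr_sqrtr ?mulr_ge0 ?nrm2_ge0// cauchy_schwarz.
Qed.

Lemma sqint_norm u : sqint u -> sqint (fun x => `|u x|).
Proof.
move=> [mu1 iu]; split; first exact: measurableT_comp.
by move: iu; congr (mu.-integrable D); apply/funext => x /=; rewrite real_normK ?num_real.
Qed.

Lemma nrm2_norm u : nrm2 (fun x => `|u x|) = nrm2 u.
Proof. by apply: eq_Rintegral => x _; rewrite real_normK ?num_real. Qed.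

Lemma sqint_bounded_mul (c : T -> R) u B : measurable_fun D c -> (forall x, D x -> `|c x| <= B) ->
  sqint u -> sqint (fun x => c x * u x).
Proof.
move=> mc cB [mu1 iu]; split; first exact: measurable_funM.
apply: (rintegrable_le _ (rintegrableZ (B ^+ 2) iu)).
  by apply: measurable_funX; exact: measurable_funM.
move=> x Dx; rewrite normrX normrM exprMn real_normK ?num_real//.
rewrite real_normK ?num_real// ler_wpM2r ?sqr_ge0// -(real_normK (num_real (c x))).
by apply: lerXn2r; rewrite ?nnegrE// ?cB// (le_trans _ (cB x Dx)).
Qed.

Lemma nrm2_ae_eq u v : measurable_fun D u -> measurable_fun D v ->
  (\forall x \ae mu, D x -> u x = v x) -> nrm2 u = nrm2 v.
Proof.
move=> mu1 mv uv; congr fine; apply: ae_eq_integral => //.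
- by apply/measurable_EFinP; exact: measurable_funX.
- by apply/measurable_EFinP; exact: measurable_funX.
- by apply: filterS uv => x h Dx; rewrite h.
Qed.

End L2.

Section L2_limits.
Context d {T : measurableType d} {R : realType} (mu : {measure set T -> \bar R}).
Context (D : set T) (mD : measurable D) (fD : (mu D < +oo)%E).
Implicit Types u v w : T -> R.
Local Notation sqint := (sqint mu D).
Local Notation ip := (ip mu D).
Local Notation nrm2 := (nrm2 mu D).
Local Notation rintegrable := (rintegrable mu D).

Definition L2cvg (u_ : nat -> T -> R) u :=
  nrm2 (fun x => u_ k x - u x) @[k --> \oo] --> (0 : R).

Lemma rintegrable_cst (c : R) : rintegrable (fun=> c).
Proof.
apply/rintegrableP; split => //.
by rewrite integral_cst//; exact: lte_mul_pinfty.
Qed.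

Lemma rintegrable_bounded (c : T -> R) B : measurable_fun D c ->
  (forall x, D x -> `|c x| <= B) -> rintegrable c.
Proof. by move=> mc cB; exact: (rintegrable_le mD mc (rintegrable_cst B)). Qed.

Lemma sqint_bounded (c : T -> R) B : measurable_fun D c ->
  (forall x, D x -> `|c x| <= B) -> sqint c.
Proof.
move=> mc cB; split => //; apply: (@rintegrable_bounded _ (B ^+ 2)).
  exact: measurable_funX.
move=> x Dx; rewrite normrX.
by apply: lerXn2r; rewrite ?nnegrE ?cB// (le_trans _ (cB x Dx)).
Qed.

Lemma sqint_rintegrable u : sqint u -> rintegrable u.
Proof.
move=> su; have s1 : sqint (fun=> 1).
  by apply: (@sqint_bounded _ 1) => // x _; rewrite normr1.
have := sqint_mul mD su s1; congr (mu.-integrable D).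
by apply/funext => x /=; rewrite mulr1.
Qed.

Lemma L1_le_L2 u : sqint u ->
  \int[mu]_(x in D) `|u x| <= Num.sqrt (nrm2 u) * Num.sqrt (fine (mu D)).
Proof.
move=> su; have s1 : sqint (fun=> 1).
  by apply: (@sqint_bounded _ 1) => // x _; rewrite normr1.
have := cauchy_schwarz_norm mD (sqint_norm su) s1.
rewrite nrm2_norm.
have -> : nrm2 (fun=> 1) = fine (mu D).
  by rewrite /nrm2 (@eq_Rintegral _ _ _ mu D (fun=> 1)) ?Rintegral_cst ?mul1r// => x _; rewrite expr1n.
apply: le_trans; apply: le_trans (ler_norm _).
have -> : ip (fun x => `|u x|) (fun=> 1) = \int[mu]_(x in D) `|u x|.
  by apply: eq_Rintegral => x _; rewrite mulr1.
exact: lexx.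
Qed.

Lemma cvg_sqrt0 (a_ : nat -> R) : (forall k, 0 <= a_ k) ->
  a_ k @[k --> \oo] --> (0 : R) -> Num.sqrt (a_ k) @[k --> \oo] --> (0 : R).
Proof.
move=> a0 h; rewrite -[X in _ --> X](sqrtr0 R).
apply: (cvg_comp _ _ h); exact: sqrt_continuous.
Qed.

Lemma squeeze0 (a_ b_ : nat -> R) : (forall k, `|a_ k| <= b_ k) ->
  b_ k @[k --> \oo] --> (0 : R) -> a_ k @[k --> \oo] --> (0 : R).
Proof.
move=> ab b0; apply/norm_cvg0P.
apply: (squeeze_cvgr _ (cvg_cst 0) b0).
by apply: nearW => k; rewrite normr_ge0 ab.
Qed.

Lemma cvg_EFin_real (c_ : nat -> R) c : c_ k @[k --> \oo] --> c ->
  (c_ k)%:E @[k --> \oo] --> c%:E.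
Proof. by move=> cc; apply: cvg_EFin => //; exact: nearW. Qed.

Lemma le_limn_einf (a b : nat -> \bar R) : (forall k, (a k <= b k)%E) ->
  (limn_einf a <= limn_einf b)%E.
Proof.
move=> ab; rewrite !limn_einf_lim; apply: lee_lim; [exact: is_cvg_einfs..|].
apply: nearW => n; apply: le_ereal_inf_tmp => _ [m /= nm <-].
by apply: (le_trans _ (ab m)); apply: ereal_inf_lbound; exists m.
Qed.

(** Fatou's lemma in the form in which it passes bounds to the limit. *)
Lemma fatou_cvg (f_ : nat -> T -> R) (f : T -> R) (c_ : nat -> R) c :
  (forall k, measurable_fun D (f_ k)) -> measurable_fun D f ->
  (forall k x, 0 <= f_ k x) -> (forall x, 0 <= f x) ->
  {ae mu, forall x, D x -> f_ k x @[k --> \oo] --> f x} ->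
  (forall k, \int[mu]_(x in D) (f_ k x)%:E <= (c_ k)%:E)%E ->
  c_ k @[k --> \oo] --> c ->
  (\int[mu]_(x in D) (f x)%:E <= c%:E)%E.
Proof.
move=> mf_ mf f_0 f0 ff fc cc.
have mE k : measurable_fun D (fun x => (f_ k x)%:E : \bar R) by exact/measurable_EFinP.
rewrite (_ : (\int[mu]_(x in D) _)%E = (\int[mu]_(x in D) limn_einf (fun k => (f_ k x)%:E))%E).
  apply: le_trans (fatou mu mD mE _) _.
    by move=> k x _; rewrite lee_fin.
  have <- : limn_einf (fun k => (c_ k)%:E) = c%:E.
    by have [->] := cvg_limn_einf_sup (cvg_EFin_real cc).
  exact: le_limn_einf.
apply: ae_eq_integral => //.
- exact/measurable_EFinP.
- by apply: measurableT_comp => //; apply: measurable_fun_limn_esup => k; exact: measurableT_comp.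
- apply: filterS ff => x h Dx.
  by have [->] := cvg_limn_einf_sup (cvg_EFin_real (h Dx)).
Qed.

Lemma dominated_cvg_real (f_ : nat -> T -> R) (f g : T -> R) :
  (forall k, measurable_fun D (f_ k)) -> measurable_fun D f -> rintegrable g ->
  {ae mu, forall x, D x -> f_ k x @[k --> \oo] --> f x} ->
  (forall k x, D x -> `|f_ k x| <= g x) ->
  rintegrable f /\ \int[mu]_(x in D) f_ k x @[k --> \oo] --> \int[mu]_(x in D) f x.
Proof.
move=> mf_ mf ig ff fg.
have ae1 : {ae mu, forall x, D x -> (f_ k x)%:E @[k --> \oo] --> (f x)%:E}.
  by apply: filterS ff => x h Dx; exact: cvg_EFin_real (h Dx).
have ae2 : {ae mu, forall x, forall k, D x -> (`|(f_ k x)%:E| <= (g x)%:E)%E}.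
  by apply: aeW => x k Dx; rewrite lee_fin fg.
have mE k : measurable_fun D (fun x => (f_ k x)%:E) by exact/measurable_EFinP.
have [iF _ h] := @dominated_convergence _ _ _ mu D mD _ _ _ mE
  (proj2 (measurable_EFinP _ _) mf) ae1 ig ae2.
split => //; apply: fine_cvg; rewrite EFin_Rintegral//; exact: iF.
Qed.

(** The sum of the |d_k| has a finite integral, hence is finite almost
    everywhere. *)
Lemma ae_summable (d_ : nat -> T -> R) :
  (forall k, measurable_fun D (d_ k)) ->
  (forall k, \int[mu]_(x in D) `|d_ k x|%:E <= (1 / (2 ^ k.+1)%:R)%:E)%E ->
  {ae mu, forall x, D x -> cvgn [normed series (fun k => d_ k x)]}.
Proof.
move=> md dle.
have mE k : measurable_fun D (fun x => `|d_ k x|%:E : \bar R).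
  by apply/measurable_EFinP; exact: measurableT_comp.
have : mu.-integrable D (fun x => \sum_(0 <= k <oo) `|d_ k x|%:E)%E.
  apply/integrableP; split.
    by apply: ge0_emeasurable_sum => // k x _ _; rewrite lee_fin.
  under eq_integral => x _.
    rewrite gee0_abs; last by apply: nneseries_ge0 => k _ _; rewrite lee_fin.
    over.
  rewrite integral_nneseries//.
  apply: (@le_lt_trans _ _ 1%E); last by rewrite ltry.
  apply: le_trans (epsilon_trick0 xpredT ler01).
  apply: lee_nneseries => k _ //.
  by move=> _; apply: integral_ge0 => x _; rewrite lee_fin.
move=> /(integrable_ae mD); apply: filterS => x h Dx; have {}h := h Dx.
apply: nondecreasing_is_cvgn.
  by apply: nondecreasing_series => k _ _ /=.
exists (fine (\sum_(0 <= k <oo) `|d_ k x|%:E)%E) => _ [n _ <-].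
rewrite -lee_fin fineK// /series/= -sumEFin.
by apply: nneseries_lim_ge => k _ _; rewrite lee_fin.
Qed.

Lemma L2_L1_cvg (d_ : nat -> T -> R) : (forall k, sqint (d_ k)) ->
  nrm2 (d_ k) @[k --> \oo] --> (0 : R) ->
  \int[mu]_(x in D) `|d_ k x| @[k --> \oo] --> (0 : R).
Proof.
move=> sd dd.
apply: (@squeeze0 _ (fun k => Num.sqrt (nrm2 (d_ k)) * Num.sqrt (fine (mu D)))).
  move=> k; rewrite ger0_norm ?L1_le_L2//.
  by apply: Rintegral_ge0.
rewrite -(mul0r (Num.sqrt (fine (mu D)))).
by apply: cvgMr_tmp; apply: cvg_sqrt0 => // k; exact: nrm2_ge0.
Qed.

Lemma cvgn_series0 (u : nat -> R) : cvgn [normed series u] ->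
  u k @[k --> \oo] --> (0 : R).
Proof. by move=> h; apply: cvg_series_cvg_0; exact: normed_cvg. Qed.

(** A subsequence whose L^1 distances to the limit are summable converges
    almost everywhere. *)
Lemma L2cvg_ae_subsequence (u_ : nat -> T -> R) u :
  (forall k, sqint (u_ k)) -> sqint u -> L2cvg u_ u ->
  exists s : nat -> nat, (forall k, (s k < s k.+1)%N) /\
    {ae mu, forall x, D x -> u_ (s k) x @[k --> \oo] --> u x}.
Proof.
move=> su_ su uu.
have sd k := sqintB mD (su_ k) su.
have h := L2_L1_cvg sd uu.
have [|s [hs P]] := @exists_subsequence (fun k m =>
    \int[mu]_(x in D) `|u_ m x - u x| <= 1 / (2 ^ k.+1)%:R).
  move=> k; have e0 : 0 < 1 / (2 ^ k.+1)%:R :> R by rewrite divr_gt0// ltr0n expn_gt0.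
  move/cvgrPdist_le : h => /(_ _ e0)[N _ hN]; exists N => m Nm.
  have := hN m Nm; rewrite sub0r normrN; apply: le_trans; exact: ler_norm.
exists s; split => //.
have md k : measurable_fun D (fun x => u_ (s k) x - u x).
  exact: rintegrable_measurable (sqint_rintegrable (sd (s k))).
have hd k : (\int[mu]_(x in D) `|u_ (s k) x - u x|%:E <= (1 / (2 ^ k.+1)%:R)%:E)%E.
  rewrite -(EFin_Rintegral mD); first by rewrite lee_fin; exact: P.
  exact/rintegrable_norm/sqint_rintegrable.
apply: filterS (ae_summable md hd) => x hx Dx.
by apply/subr_cvg0; exact: cvgn_series0 (hx Dx).
Qed.

(** The Riesz-Fischer theorem: a subsequence with summable increments
    converges almost everywhere, and Fatou's lemma shows that its limit is the
    L^2 limit of the whole sequence. *)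
Lemma L2_complete (u_ : nat -> T -> R) : (forall k, sqint (u_ k)) ->
  (forall e : R, 0 < e -> exists N, forall j k, (N <= j)%N -> (N <= k)%N ->
     nrm2 (fun x => u_ j x - u_ k x) <= e) ->
  exists u, sqint u /\ L2cvg u_ u.
Proof.
move=> su_ cu.
have sd j k := sqintB mD (su_ j) (su_ k).
have [|s [hs P]] := @exists_subsequence (fun k N => forall j, (N <= j)%N ->
    \int[mu]_(x in D) `|u_ j x - u_ N x| <= 1 / (2 ^ k.+1)%:R).
  move=> k; pose e : R := 1 / (2 ^ k.+1)%:R.
  have e0 : 0 < e by rewrite divr_gt0// ltr0n expn_gt0.
  pose c : R := Num.sqrt (fine (mu D)) + 1.
  have c0 : 0 < c by rewrite ltr_wpDl// sqrtr_ge0.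
  have [N hN] := cu _ (exprn_gt0 2 (divr_gt0 e0 c0)).
  exists N => m Nm j mj; apply: le_trans (L1_le_L2 (sd j m)) _.
  apply: (@le_trans _ _ (e / c * Num.sqrt (fine (mu D)))).
    rewrite ler_wpM2r ?sqrtr_ge0// -[leRHS]ger0_norm ?(ltW (divr_gt0 e0 c0))//.
    rewrite -sqrtr_sqr ler_wsqrtr// hN// (leq_trans Nm)//.
  by rewrite -/e mulrAC -mulrA ler_piMr ?(ltW e0)// ler_pdivrMr// mul1r /c lerDl.
have md k : measurable_fun D (fun x => u_ (s k.+1) x - u_ (s k) x).
  exact: rintegrable_measurable (sqint_rintegrable (sd _ _)).
have hd k : (\int[mu]_(x in D) `|u_ (s k.+1) x - u_ (s k) x|%:E <=
    (1 / (2 ^ k.+1)%:R)%:E)%E.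
  rewrite -(EFin_Rintegral mD); last exact/rintegrable_norm/sqint_rintegrable.
  by rewrite lee_fin; apply: P => //; exact: ltnW.
have mu_ k : measurable_fun D (u_ k) by have [] := su_ k.
(* The upper limit provides a measurable representative on the whole of D. *)
pose u x := fine (limn_esup (fun k => (u_ (s k) x)%:E)).
have mu1 : measurable_fun D u.
  apply: measurableT_comp => //; apply: measurable_fun_limn_esup => k.
  exact/measurable_EFinP.
have aeu : {ae mu, forall x, D x -> u_ (s k) x @[k --> \oo] --> u x}.
  apply: filterS (ae_summable md hd) => x hx Dx.
  have : cvgn (fun k => u_ (s k) x).
    have := normed_cvg (hx Dx); move=> /cvg_ex[l hl]; apply/cvg_ex.
    exists (l + u_ (s 0%N) x).
    rewrite (_ : (fun k => u_ (s k) x) =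
      (fun n => series (fun k => u_ (s k.+1) x - u_ (s k) x) n + u_ (s 0%N) x)).
      exact: (cvgD hl (cvg_cst _)).
    by apply/funext => n; rewrite /series/= telescope_sumr// subrK.
  move=> /cvg_ex[l hl]; rewrite /u.
  by have [_ ->] := cvg_limn_einf_sup (cvg_EFin_real hl).
have fat N e : (forall j k, (N <= j)%N -> (N <= k)%N ->
     nrm2 (fun x => u_ j x - u_ k x) <= e) ->
   forall j, (N <= j)%N -> (\int[mu]_(x in D) ((u_ j x - u x) ^+ 2)%:E <= e%:E)%E.
  move=> hN j Nj.
  apply: (@fatou_cvg (fun k x => (u_ j x - u_ (s (k + N)%N) x) ^+ 2) _ (fun=> e) e).
  - by move=> k; apply: measurable_funX; exact: measurable_funB.
  - by apply: measurable_funX; exact: measurable_funB.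
  - by move=> k x; exact: sqr_ge0.
  - by move=> x; exact: sqr_ge0.
  - apply: filterS aeu => x hx Dx; have {}hx := hx Dx.
    have {}hx : u_ (s (k + N)%N) x @[k --> \oo] --> u x.
      by move: hx; rewrite -(cvg_shiftn N).
    have h2 : (u_ j x - u_ (s (k + N)%N) x) @[k --> \oo] --> u_ j x - u x.
      exact: (cvgB (cvg_cst _) hx).
    exact: (cvgM h2 h2).
  - move=> k; rewrite -(EFin_Rintegral mD).
      rewrite lee_fin; apply: hN => //; rewrite (leq_trans _ (subsequence_ge _ hs))//.
      exact: leq_addl.
    by have [] := sd j (s (k + N)%N).
  - exact: cvg_cst.
have sqd : exists N, sqint (fun x => u_ N x - u x).
  have [N hN] := cu 1 ltr01; exists N; split; first exact: measurable_funB.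
  apply/rintegrableP; split; first by apply: measurable_funX; exact: measurable_funB.
  under eq_integral => x _ do rewrite ger0_norm ?sqr_ge0//.
  exact: le_lt_trans (fat N 1 hN N (leqnn _)) (ltry _).
have su : sqint u.
  have [N hN] := sqd; have := sqintB mD (su_ N) hN.
  by congr sqint; apply/funext => x; rewrite subKr.
exists u; split => //.
apply/cvgrPdist_le => e e0; have [N hN] := cu e e0.
exists N => // k /= Nk; rewrite sub0r normrN ger0_norm ?nrm2_ge0//.
have := fat N e hN k Nk; rewrite -(EFin_Rintegral mD); last by have [] := sqintB mD (su_ k) su.
by rewrite lee_fin.
Qed.

Lemma ip_cvg (u_ : nat -> T -> R) u v : (forall k, sqint (u_ k)) -> sqint u ->
  sqint v -> L2cvg u_ u -> ip (u_ k) v @[k --> \oo] --> ip u v.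
Proof.
move=> su_ su sv uu; apply/subr_cvg0.
have sd k := sqintB mD (su_ k) su.
apply: (@squeeze0 _ (fun k => Num.sqrt (nrm2 (fun x => u_ k x - u x)) * Num.sqrt (nrm2 v))).
  by move=> k; rewrite -ipBl//; exact: cauchy_schwarz_norm.
rewrite -(mul0r (Num.sqrt (nrm2 v))).
by apply: cvgMr_tmp; apply: cvg_sqrt0 => // k; exact: nrm2_ge0.
Qed.

Lemma nrm2_cvg (u_ : nat -> T -> R) u : (forall k, sqint (u_ k)) -> sqint u ->
  L2cvg u_ u -> nrm2 (u_ k) @[k --> \oo] --> nrm2 u.
Proof.
move=> su_ su uu; have h := ip_cvg su_ su su uu.
have -> : (fun k => nrm2 (u_ k)) =
    (fun k => nrm2 (fun x => u_ k x - u x) + 2 * ip (u_ k) u - nrm2 u).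
  by apply/funext => k; rewrite nrm2B//; ring.
have e : nrm2 u = 0 + 2 * ip u u - nrm2 u by rewrite ip_nrm2; ring.
rewrite [X in _ --> X]e.
apply: cvgB; last exact: cvg_cst.
by apply: cvgD => //; exact: cvgMl_tmp.
Qed.

(** Dominated convergence, by 4 B^2 u^2, for multipliers bounded by B. *)
Lemma nrm2_dominated (c_ : nat -> T -> R) (c u : T -> R) B :
  (forall k, measurable_fun D (c_ k)) -> measurable_fun D c ->
  (forall k x, D x -> `|c_ k x| <= B) ->
  (forall x, D x -> `|c x| <= B) ->
  {ae mu, forall x, D x -> c_ k x @[k --> \oo] --> c x} -> sqint u ->
  L2cvg (fun k x => c_ k x * u x) (fun x => c x * u x).
Proof.
move=> mc_ mc cB cB' cc [mu1 iu]; rewrite /L2cvg.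
pose f_ k x := ((c_ k x * u x - c x * u x) ^+ 2)%:E : \bar R.
have mf k : measurable_fun D (f_ k).
  apply/measurable_EFinP; apply: measurable_funX; apply: measurable_funB; exact: measurable_funM.
have cvf : {ae mu, forall x, D x -> f_ k x @[k --> \oo] --> (cst 0%E) x}.
  apply: filterS cc => x h Dx; apply: cvg_EFin_real.
  have h1 : c_ k x * u x - c x * u x @[k --> \oo] --> (0 : R).
    by apply/subr_cvg0; exact: cvgMr_tmp (h Dx).
  have h2 := cvgM h1 h1; rewrite mulr0 in h2; exact: h2.
have dom : {ae mu, forall x, forall k, D x -> (`|f_ k x| <= (4 * B ^+ 2 * u x ^+ 2)%:E)%E}.
  apply: nearW => x k Dx; rewrite /f_ /= lee_fin ger0_norm ?sqr_ge0//.
  rewrite -mulrBl exprMn ler_wpM2r ?sqr_ge0//.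
  have := cB k x Dx; have := cB' x Dx; rewrite !ler_norml => /andP[h1 h2] /andP[h3 h4].
  have -> : 4 * B ^+ 2 = (2 * B) ^+ 2 by ring.
  rewrite -ler_sqrt; last by rewrite exprn_ge0//; nra.
  rewrite !sqrtr_sqr [leRHS]ger0_norm; last lra.
  by rewrite ler_norml; apply/andP; split; lra.
have [_ _ h] := @dominated_convergence _ _ _ mu D mD f_ (cst 0%E) _ mf
  (measurable_cst _) cvf (rintegrableZ mD (4 * B ^+ 2) iu) dom.
move: h; rewrite integral0 => h.
exact: (fine_cvg h).
Qed.

(** c_k u_k - c u = c_k (u_k - u) + (c_k - c) u, where the first term is small
    because the c_k are bounded and the second by dominated convergence. *)
Lemma L2cvg_mul (c_ : nat -> T -> R) (c : T -> R) (u_ : nat -> T -> R) u B :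
  (forall k, measurable_fun D (c_ k)) -> measurable_fun D c ->
  (forall k x, D x -> `|c_ k x| <= B) ->
  (forall x, D x -> `|c x| <= B) ->
  {ae mu, forall x, D x -> c_ k x @[k --> \oo] --> c x} ->
  (forall k, sqint (u_ k)) -> sqint u -> L2cvg u_ u ->
  L2cvg (fun k x => c_ k x * u_ k x) (fun x => c x * u x).
Proof.
move=> mc_ mc cB cB' cc su_ su uu.
have h1 := nrm2_dominated mc_ mc cB cB' cc su.
have sd k := sqintB mD (su_ k) su.
have s1 k : sqint (fun x => c_ k x * (u_ k x - u x)).
  exact: (sqint_bounded_mul mD (mc_ k) (cB k) (sd k)).
have s2 k : sqint (fun x => c_ k x * u x - c x * u x).
  apply: (sqintB mD); first exact: (sqint_bounded_mul mD (mc_ k) (cB k) su).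
  exact: (sqint_bounded_mul mD mc cB' su).
apply: (@squeeze0 _ (fun k => 2 * (B ^+ 2 * nrm2 (fun x => u_ k x - u x)) +
   2 * nrm2 (fun x => c_ k x * u x - c x * u x))).
  move=> k; rewrite ger0_norm ?nrm2_ge0//.
  apply: (@le_trans _ _ (2 * nrm2 (fun x => c_ k x * (u_ k x - u x)) +
      2 * nrm2 (fun x => c_ k x * u x - c x * u x))).
    apply: le_trans (nrm2_tri mD (s1 k) (s2 k)).
    rewrite le_eqVlt; apply/orP; left; apply/eqP.
    by apply: eq_Rintegral => x _; congr (_ ^+ 2); ring.
  rewrite lerD2r ler_pM2l//.
  rewrite /nrm2 -RintegralZl//; last by have [] := sd k.
  apply: le_Rintegral => //.
  - by have [] := s1 k.
  - by apply: rintegrableZ => //; have [] := sd k.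
  - move=> x Dx; rewrite exprMn ler_wpM2r ?sqr_ge0//.
    rewrite -(real_normK (num_real (c_ k x))).
    by apply: lerXn2r; rewrite ?nnegrE ?cB// (le_trans _ (cB k x Dx)).
rewrite -[X in _ --> X](_ : 2 * (B ^+ 2 * 0) + 2 * 0 = 0); last by rewrite !mulr0 addr0.
apply: cvgD; apply: cvgMl_tmp => //; exact: cvgMl_tmp.
Qed.

End L2_limits.

(** * Weierstrass approximation and primitives *)

Section bernstein.
Context {R : realType}.

(** The Bernstein polynomial of the values F 0, ..., F n, by the recurrence of
    the binomial law: (bernstein n F).[x] is the expectation of F at the
    number of successes in n trials of probability x. *)
Fixpoint bernstein (n : nat) (F : nat -> R) : {poly R} :=
  if n is n'.+1 then
    'X * bernstein n' (fun k => F k.+1) + (1 - 'X) * bernstein n' F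
  else (F 0%N)%:P.

Lemma bernstein_le n F G x : 0 <= x <= 1 ->
  (forall k, (k <= n)%N -> F k <= G k) -> (bernstein n F).[x] <= (bernstein n G).[x].
Proof.
move=> /andP[x0 x1]; elim: n F G => [|n IH] F G FG /=.
  by rewrite !hornerC FG.
rewrite !hornerE; apply: lerD; apply: ler_wpM2l => //.
- by apply: IH => k kn; exact: FG.
- by rewrite subr_ge0.
- by apply: IH => k kn; apply: FG; exact: leqW.
Qed.

(** The binomial law has mean n x and variance n x (1 - x). *)
Lemma bernstein_quadratic n a b c x :
  (bernstein n (fun k => a + b * (k%:R - c) ^+ 2)).[x] =
  a + b * ((n%:R * x - c) ^+ 2 + n%:R * x * (1 - x)).
Proof.
elim: n c => [|n IH] c /=.
  by rewrite hornerC mul0r sub0r; ring.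
rewrite !hornerE IH.
have -> : (fun k : nat => a + b * (k.+1%:R - c) ^+ 2) =
          (fun k : nat => a + b * (k%:R - (c - 1)) ^+ 2).
  by apply/funext => k; rewrite -natr1; congr (_ + _ * _ ^+ 2); ring.
by rewrite IH -natr1; ring.
Qed.

Lemma uniform_continuity (f : R -> R) (a b : R) e : continuous f -> 0 < e ->
  exists2 del : R, 0 < del & forall x y, x \in `[a, b] -> `|x - y| < del ->
    `|f x - f y| <= e.
Proof.
move=> cf e0.
have : near_covering `[a, b]%classic by apply/compact_near_coveringP; exact: segment_compact.
move=> /(_ _ (0^'+ : set_system R) (fun del x => forall y, `|x - y| < del -> `|f x - f y| <= e)).
case.
  move=> x xab.
  have e20 : 0 < e / 2 by rewrite divr_gt0.
  have /cvgrPdist_le/(_ _ e20)/nbhs_ballP[r /= r0 hr] := cf x.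
  exists (ball x (r / 2), [set del | del < r / 2]).
    split; first by apply: nbhsx_ballx; rewrite divr_gt0.
    by apply: nbhs_right_lt; rewrite divr_gt0.
  move=> [z del] /= [xz dr] y zy.
  have h1 : `|f x - f z| <= e / 2.
    by apply: hr; rewrite /ball/= (lt_trans xz)// ltr_pdivrMr// ltr_pMr// ltr1n.
  have h2 : `|f x - f y| <= e / 2.
    apply: hr; rewrite /ball/=.
    have -> : x - y = (x - z) + (z - y) by ring.
    rewrite (le_lt_trans (ler_normD _ _))// (splitr r) ltrD//.
    exact: lt_trans dr.
  have -> : f z - f y = (f x - f y) - (f x - f z) by ring.
  by rewrite (le_trans (ler_normB _ _))// (splitr e) lerD.
move=> del /= d0 hd; exists (del / 2); first by rewrite divr_gt0.
move=> x y xab xy; apply: (hd (del / 2)) => //=.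
- rewrite sub0r normrN gtr0_norm ?divr_gt0//.
  by rewrite ltr_pdivrMr// ltr_pMr// ltr1n.
- by rewrite divr_gt0.
Qed.

(** Bernstein's proof: by uniform continuity the values of f lie between two
    parabolas centred at x, up to e / 2, and the curvature term is averaged to
    K x (1 - x) / n by the variance of the binomial law. *)
Lemma weierstrass01 (f : R -> R) e : continuous f -> 0 < e ->
  exists p : {poly R}, forall x, 0 <= x <= 1 -> `|p.[x] - f x| <= e.
Proof.
move=> cf e0; have e20 : 0 < e / 2 by rewrite divr_gt0.
have [del d0 hd] := uniform_continuity 0 1 cf e20.
have [B hB] : exists B : R, forall x, 0 <= x <= 1 -> `|f x| <= B.
  have cn : {within `[0, 1], continuous (fun x => `|f x|)}.
    apply: continuous_subspaceT => x; apply: continuous_comp; first exact: cf.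
    exact: norm_continuous.
  have [c _ hc] := EVT_max ler01 cn.
  by exists `|f c| => x x01; apply: hc; rewrite in_itv.
have B0 : 0 <= B by apply: le_trans (hB 0 _); rewrite ?lexx ?ler01.
pose K : R := 2 * B / del ^+ 2.
have K0 : 0 <= K by rewrite /K divr_ge0 ?sqr_ge0// mulr_ge0.
have fK x y : 0 <= x <= 1 -> 0 <= y <= 1 -> `|f y - f x| <= e / 2 + K * (y - x) ^+ 2.
  move=> x01 y01; have [dxy|dxy] := ltP `|y - x| del.
    apply: (@le_trans _ _ (e / 2)); last by rewrite lerDl mulr_ge0 ?sqr_ge0.
    by apply: hd => //; rewrite in_itv.
  apply: (@le_trans _ _ (2 * B)).
    rewrite (le_trans (ler_normB _ _))// mulr2n mulrDl mul1r lerD// hB//.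
  apply: (@le_trans _ _ (K * (y - x) ^+ 2)); last by rewrite lerDr ltW.
  rewrite /K mulrAC ler_pdivlMr ?exprn_gt0//.
  rewrite ler_wpM2l ?mulr_ge0// -(real_normK (num_real (y - x))).
  by apply: lerXn2r; rewrite ?nnegrE// ltW.
have [n hn] : exists n : nat, K / n.+1%:R <= e / 2.
  pose n := Num.truncn (K / (e / 2)).
  exists n; rewrite ler_pdivrMr// mulrC -ler_pdivrMr//.
  by apply/ltW; exact: truncnS_gt.
exists (bernstein n.+1 (fun k => f (k%:R / n.+1%:R))) => x x01.
have n0 : 0 < n.+1%:R :> R by [].
have kb k : (k <= n.+1)%N -> 0 <= (k%:R / n.+1%:R : R) <= 1.
  by move=> kn; rewrite divr_ge0//= ler_pdivrMr// mul1r ler_nat.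
pose N : R := n.+1%:R.
have sq k : K * (k%:R / N - x) ^+ 2 = K / N ^+ 2 * (k%:R - N * x) ^+ 2.
  by field; rewrite gt_eqF.
have quad : K / N ^+ 2 * ((N * x - N * x) ^+ 2 + N * x * (1 - x)) <= e / 2.
  have -> : K / N ^+ 2 * ((N * x - N * x) ^+ 2 + N * x * (1 - x)) =
    K / N * (x * (1 - x)) by field; rewrite gt_eqF.
  apply: le_trans hn; rewrite ler_piMr//; first by rewrite divr_ge0.
  by case/andP: x01 => x0 x1; nra.
rewrite ler_norml; apply/andP; split.
  have := @bernstein_le n.+1 (fun k => (f x - e / 2) + - (K / N ^+ 2) * (k%:R - N * x) ^+ 2)
    (fun k => f (k%:R / N)) x x01.
  rewrite bernstein_quadratic -/N => h.
  rewrite lerBrDl; apply: le_trans (h _).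
    by rewrite mulNr; move: quad; set Q := K / N ^+ 2 * _; lra.
  move=> k kn; rewrite mulNr -sq.
  have := fK x _ x01 (kb k kn); rewrite -/N ler_norml.
  by set Q := K * _ => /andP[]; lra.
have := @bernstein_le n.+1 (fun k => f (k%:R / N))
  (fun k => (f x + e / 2) + K / N ^+ 2 * (k%:R - N * x) ^+ 2) x x01.
rewrite bernstein_quadratic -/N => h.
rewrite lerBlDl; apply: le_trans (h _) _; last first.
  by move: quad; set Q := K / N ^+ 2 * _; lra.
move=> k kn; rewrite -sq.
have := fK x _ x01 (kb k kn); rewrite -/N ler_norml.
by set Q := K * _ => /andP[_]; lra.
Qed.

Lemma weierstrass (f : R -> R) K e : continuous f -> 0 < K -> 0 < e ->
  exists p : {poly R}, forall x, `|x| <= K -> `|p.[x] - f x| <= e.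
Proof.
move=> cf K0 e0.
have cg : continuous (fun t : R => f (2 * K * t - K)).
  move=> t; apply: (@continuous_comp _ _ _ (fun t : R => 2 * K * t - K) f); last exact: cf.
  by apply: cvgB; [exact: (cvgM (cvg_cst _) cvg_id)|exact: cvg_cst].
have [p hp] := weierstrass01 cg e0.
exists (p \Po ((2 * K)^-1 *: ('X + K%:P))) => x; rewrite ler_norml => /andP[x1 x2].
rewrite horner_comp !hornerE.
have := hp ((2 * K)^-1 * (x + K)).
rewrite (_ : 2 * K * ((2 * K)^-1 * (x + K)) - K = x); last first.
  by field; rewrite gt_eqF.
apply; apply/andP; split.
  by rewrite mulr_ge0 ?invr_ge0 ?mulr_ge0// ?(ltW K0)//; lra.
by rewrite ler_pdivrMl ?mulr_gt0//; lra.
Qed.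

Lemma poly_primitive (p : {poly R}) : exists2 P : {poly R}, P^`() = p & P.[0] = 0.
Proof.
exists (\poly_(i < (size p).+1) (if i is j.+1 then p`_j / j.+1%:R else 0)).
  apply/polyP => i; rewrite coef_deriv coef_poly ltnS /=.
  case: ltnP => ip; last by rewrite mul0rn nth_default.
  by rewrite -[LHS]mulr_natr mulfVK// pnatr_eq0.
by rewrite horner_coef0 coef_poly/=.
Qed.

Lemma mean_value_bound (g g' : R -> R) (L : R) t s : (forall x : R, is_derive x 1 g (g' x)) ->
  (forall x, Num.min t s <= x <= Num.max t s -> `|g' x| <= L) -> `|g t - g s| <= L * `|t - s|.
Proof.
move=> dg.
have cg : continuous g.
  move=> x; apply: differentiable_continuous.
  by apply/derivable1_diffP; have [] := dg x.
wlog st : t s / s <= t => [H hL|].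
  have [st|ts] := leP s t; first exact: H.
  rewrite distrC [`|t - s|]distrC; apply: H; first exact: ltW.
  by move=> x; rewrite minC maxC; exact: hL.
rewrite min_r// max_l// => hL.
have [c] := MVT_segment st (fun x _ => dg x) (continuous_subspaceT cg).
rewrite in_itv/= => csb ->; rewrite normrM ler_wpM2r// hL//.
Qed.

(** Approximate the derivative by a polynomial and integrate. *)
Lemma C1_polynomial_approx (g g' : R -> R) K e :
  (forall t : R, is_derive t 1 g (g' t)) -> continuous g' -> g 0 = 0 ->
  0 < K -> 0 < e ->
  exists P : {poly R}, P.[0] = 0 /\ forall t, `|t| <= K ->
    `|P.[t] - g t| <= e /\ `|P^`().[t] - g' t| <= e.
Proof.
move=> dg cg' g0 K0 e0.
have K1 : 0 < K + 1 by rewrite addr_gt0.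
have eK : 0 < e / (K + 1) by rewrite divr_gt0.
have [p hp] := weierstrass cg' K0 eK.
have [P P'p P0] := poly_primitive p; exists P; split => // t tK.
have eKe : e / (K + 1) * K <= e.
  by rewrite mulrAC -mulrA ler_piMr ?(ltW e0)// ler_pdivrMr// mul1r lerDl.
have eKe1 : e / (K + 1) <= e.
  by rewrite ler_pdivrMr// ler_pMr// lerDr ltW.
split; last by rewrite P'p (le_trans (hp _ tK)).
have dd (x : R) : is_derive x 1 (fun t => P.[t] - g t) (p.[x] - g' x).
  by rewrite -P'p; apply: is_deriveB.
have := @mean_value_bound _ _ (e / (K + 1)) t 0 dd.
rewrite P0 g0 !subr0 => h; apply: le_trans (h _) _; last first.
  by apply: le_trans eKe; rewrite ler_wpM2l// ltW.
move=> x; rewrite ge_min le_max => /andP[h1 h2]; apply: hp.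
move: tK; rewrite !ler_norml; case/orP: h1; case/orP: h2; lra.
Qed.

End bernstein.

Section primitive.
Context {R : realType}.
Local Notation leb := (@lebesgue_measure R).

Definition primitive (f : R -> R) (t : R) : R :=
  if 0 <= t then \int[leb]_(x in `]0, t]) f x else - \int[leb]_(x in `]t, 0]) f x.

Lemma primitive0 f : primitive f 0 = 0.
Proof. by rewrite /primitive lexx set_itvoc0 Rintegral_set0. Qed.

Lemma continuous_integrable_itv (f : R -> R) a b : continuous f ->
  leb.-integrable `[a, b] (EFin \o f).
Proof.
move=> cf; apply: continuous_compact_integrable; first exact: segment_compact.
exact: continuous_subspaceT.
Qed.

(** Integrals from a fixed point a to the left of t, to which the first
    fundamental theorem of calculus applies. *)
Lemma primitiveE (f : R -> R) a t : continuous f -> a < 0 -> a < t ->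
  primitive f t = \int[leb]_(x in `[a, t]) f x - \int[leb]_(x in `[a, 0]) f x.
Proof.
move=> cf a0 at0; rewrite /primitive; case: ifPn => [t0|].
  by rewrite Rintegral_itvB//; [exact: continuous_integrable_itv|rewrite bnd_simp ltW..].
rewrite -ltNge => t0.
have := @Rintegral_itvB _ f (BLeft a) (BRight 0) t
  (continuous_integrable_itv a 0 cf).
by rewrite !bnd_simp (ltW at0) (ltW t0) => <- //; rewrite opprB.
Qed.

Lemma is_derive_primitive (f : R -> R) (t : R) : continuous f ->
  is_derive t 1 (primitive f) (f t).
Proof.
move=> cf; pose a := - `|t| - 1.
have at0 : a < t by rewrite /a; have := ler_norm (- t); rewrite normrN; lra.
have a0 : a < 0 by rewrite /a; have := normr_ge0 t; lra.
have [h1 h2] := @continuous_FTC1 R f (BLeft a) t (t + 1) (ltr_pwDr ltr01 (lexx t))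
  (continuous_integrable_itv a (t + 1) cf) at0 (cf t).
have hd : is_derive t 1 (fun x => \int[leb]_(s in `[a, x]) f s -
    \int[leb]_(x in `[a, 0]) f x) (f t).
  have h3 := DeriveDef h1 (etrans (esym (derive1E _ _)) h2).
  by apply: (is_derive_eq (is_deriveB h3 (is_derive_cst _ t 1))); rewrite subr0.
apply: (near_eq_is_derive _ hd); near=> s.
rewrite (primitiveE (a := a))//; near: s; exact: lt_nbhsr.
Unshelve. all: by end_near. Qed.

End primitive.

(** * The fundamental lemma of the calculus of variations *)

Section row_generators.
Context {R : realType} {n : nat}.

(** Open sets are a generating system stable under intersection, so that a
    finite signed measure is determined by its values on them. *)
Lemma measurable_row_open :
  @measurable _ 'rV[R]_n = <<s [set U : set 'rV[R]_n | open U] >>.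
Proof.
apply/seteqP; split; last first.
  apply: smallest_sub; first exact: sigma_algebra_measurable.
  by move=> U; exact: open_measurable_row.
apply: smallest_sub; first exact: smallest_sigma_algebra.
rewrite -bigcup_seq => A [i _ [C mC <-]]; rewrite setTI.
have : measurable_fun setT (row_coord i :
    g_sigma_algebraType [set U : set 'rV[R]_n | open U] -> measurableTypeR R).
  apply: (measurability _ (RGenOpens.measurableE R)).
  move=> _ [_ [a [b ->]] <-]; rewrite setTI; apply: sub_sigma_algebra => /=.
  have : continuous (fun x : 'rV[R]_n => x ord0 i) by exact: coord_continuous.
  by move/continuousP; apply; exact: interval_open.
by move=> /(_ measurableT C mC); rewrite setTI.
Qed.

End row_generators.

Section fundamental_lemma.
Context {R : realType} {n : nat} (Omega : set 'rV[R]_n).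
Local Notation mu := (@lebesgue_row R n).

(** For 0 <= phi <= 1 these functions increase to the indicator of the set
    where phi does not vanish. *)
Lemma test_function_flatten phi k : test_function Omega phi ->
  test_function Omega (fun x => 1 - (1 - phi x) ^+ k).
Proof.
move=> tphi.
have := @test_function_horner _ _ Omega phi (1 - (1 - 'X) ^+ k) _ tphi.
rewrite !hornerE subr0 expr1n subrr => /(_ erefl).
by congr test_function; apply/funext => x; rewrite !hornerE.
Qed.

(** U is the union of countably many open boxes; with b_j a bump on the j-th
    one, 1 - prod_(j < k) (1 - b_j)^k is a test function, and tends to 1 where
    some b_j is positive. *)
Lemma open_indicator_approx (U : set 'rV[R]_n) : open U -> U `<=` Omega ->
  exists phi_ : nat -> 'rV[R]_n -> R,
    [/\ forall k, test_function Omega (phi_ k), forall k x, 0 <= phi_ k x <= 1 &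
     forall x, phi_ k x @[k --> \oo] --> (\1_U x : R)].
Proof.
move=> oU UO.
pose adm p := `[< forall y : 'rV[R]_n,
  (forall i, (rat_box p).1 ord0 i <= y ord0 i <= (rat_box p).2 ord0 i) -> U y >].
pose b (j : nat) : 'rV[R]_n -> R :=
  if unpickle j is Some p then
    if adm p then box_bump (rat_box p).1 (rat_box p).2 else fun=> 0
  else fun=> 0.
have tb j : test_function Omega (b j).
  rewrite /b; case: unpickle => [p|]; last exact: test_function0.
  case: ifPn => [/asboolP h|_]; last exact: test_function0.
  by apply: test_function_box_bump => x hx; apply: UO; exact: h.
have b01 j x : 0 <= b j x <= 1.
  rewrite /b; case: unpickle => [p|]; last by rewrite lexx ler01.
  by case: ifPn => _; [exact: box_bump01|rewrite lexx ler01].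
have bU j x : ~ U x -> b j x = 0.
  move=> nU; rewrite /b; case: unpickle => [p|//]; case: ifPn => [/asboolP h|//].
  apply/eqP/negP => /negP /box_bump_neq0 hx; apply/nU/h => i.
  by have /andP[/ltW-> /ltW->] := hx i.
have Ub x : U x -> exists j, 0 < b j x.
  move=> Ux; have [p [xp pU]] := open_rat_box oU Ux.
  exists (pickle p); rewrite /b pickleK ifT; last exact/asboolP.
  rewrite lt_neqAle eq_sym; apply/andP; split; first exact/box_bump_neq0.
  by case/andP: (box_bump01 (rat_box p).1 (rat_box p).2 x).
pose phi k m x : R := 1 - \prod_(j < m) (1 - b j x) ^+ k.
have tphi k m : test_function Omega (phi k m).
  elim: m => [|m IH].
    rewrite (_ : phi k 0 = fun=> 0); first exact: test_function0.
    by apply/funext => x; rewrite /phi big_ord0 subrr.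
  have h1 := test_function_flatten k (tb m).
  have := test_function_add (test_function_add IH h1)
    (test_function_scale (-1) (test_function_mul IH (test_smooth h1))).
  congr test_function; apply/funext => x; rewrite /phi big_ord_recr/=; ring.
have pr01 k m x : 0 <= \prod_(j < m) (1 - b j x) ^+ k <= 1.
  have h j : 0 <= (1 - b j x) ^+ k <= 1.
    have /andP[h1 h2] := b01 j x.
    by rewrite exprn_ge0 ?subr_ge0//= exprn_ile1 ?subr_ge0// lerBlDr lerDl.
  apply/andP; split; first by apply: prodr_ge0 => j _; case/andP: (h j).
  by apply: prodr_ile1 => j _; exact: h.
exists (fun k => phi k k); split => //.
  by move=> k x; rewrite /phi subr_ge0 lerBlDr lerDl; have /andP[-> ->] := pr01 k k x.
move=> x; rewrite indicE; case: (boolP (x \in U)) => [/set_mem Ux|].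
  have [j bj] := Ub x Ux.
  have bj1 : `|1 - b j x| < 1.
    have /andP[_ h] := b01 j x; rewrite ger0_norm ?subr_ge0//.
    by rewrite ltrBlDr ltrDl.
  have h0 := cvg_geometric 1 bj1.
  rewrite -[X in _ --> X]subr0; apply: cvgB; first exact: cvg_cst.
  apply: (@squeeze_cvgr _ _ _ _ (fun=> 0) (geometric 1 (1 - b j x))) => //; last exact: cvg_cst.
  exists j.+1 => // k /= jk; have /andP[-> _] /= := pr01 k k x.
  rewrite /geometric/= mul1r (bigD1 (Ordinal jk))//=.
  apply: ler_piMr; first by rewrite exprn_ge0// subr_ge0; case/andP: (b01 j x).
  apply: prodr_ile1 => i _.
  have /andP[h1 h2] := b01 i x.
  by rewrite exprn_ge0 ?subr_ge0//= exprn_ile1 ?subr_ge0// lerBlDr lerDl.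
rewrite notin_setE => nU.
rewrite (_ : (fun k => phi k k x) = fun=> 0); first exact: cvg_cst.
apply/funext => k; rewrite /phi big1 ?subrr// => j _.
by rewrite bU// subr0 expr1n.
Qed.

(** The integral of v vanishes on open sets, by dominated convergence along
    the approximations of their indicators. The sets on which it vanishes form
    a Dynkin system, hence contain all Borel sets. *)
Lemma fundamental_lemma (v : 'rV[R]_n -> R) : open Omega ->
  rintegrable mu Omega v ->
  (forall phi, test_function Omega phi -> \int[mu]_(x in Omega) (v x * phi x) = 0) ->
  {ae mu, forall x, Omega x -> v x = 0}.
Proof.
move=> oO iv hv.
have mO : measurable Omega by exact: open_measurable_row.
pose f := (EFin \o v) \_ Omega.
have intf : mu.-integrable setT f by rewrite -integrable_mkcond.
have opn (U : set 'rV[R]_n) : open U -> (\int[mu]_(x in U) f x = 0)%E.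
  move=> oU; have mU := open_measurable_row oU.
  have [phi_ [tp p01 pc]] := @open_indicator_approx (U `&` Omega) (openI oU oO) (@subIsetr _ _ _).
  have v_phi k x : `|v x * phi_ k x| <= `|v x|.
    have /andP[h1 h2] := p01 k x.
    by rewrite normrM ler_piMr// ger0_norm.
  have mphi k : measurable_fun Omega (phi_ k).
    apply: measurable_funTS; apply: continuous_measurable_row.
    exact/smooth_continuous/(test_smooth (tp k)).
  have mv := rintegrable_measurable iv.
  have mV : measurable (U `&` Omega) by exact: measurableI.
  have mvphi k : measurable_fun Omega (fun x => v x * phi_ k x) by exact: measurable_funM.
  have mvU : measurable_fun Omega (fun x => v x * \1_(U `&` Omega) x).
    by apply: measurable_funM => //; apply: measurable_funTS; exact: measurable_indic.
  have [iU H] := dominated_cvg_real mO mvphi mvU (rintegrable_norm iv)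
    (aeW _ (fun x _ => cvgMl_tmp (a := v x) (pc x))) (fun k x _ => v_phi k x).
  have : (\int[mu]_(x in Omega) (v x * \1_(U `&` Omega) x)%:E = 0)%E.
    rewrite -(EFin_Rintegral mO iU); congr EFin.
    apply: (cvg_unique _ H) => //.
    rewrite (_ : (fun _ => _) = fun=> 0); first exact: cvg_cst.
    by apply/funext => k /=; rewrite hv.
  move=> <-; rewrite [LHS]integral_mkcond [RHS]integral_mkcond.
  apply: eq_integral => x _; rewrite !patchE indicE in_setI.
  by rewrite /f patchE; case: (x \in U); case: (x \in Omega); rewrite /= ?mulr1 ?mulr0.
have all0 A : measurable A -> (\int[mu]_(x in A) f x = 0)%E.
  rewrite measurable_row_open => mA.
  apply: (@dynkin_induction _ 'rV[R]_n _ (fun A => \int[mu]_(x in A) f x = 0)%E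
    measurable_row_open) mA.
  - by move=> A' B'; exact: openI.
  - exact/opn/openT.
  - exact: opn.
  - move=> S mS S0.
    have mS' : measurable S by [].
    have := opn setT openT; rewrite -(setUv S) integral_setU//; last 3 first.
    + exact: measurableC.
    + by rewrite setUv; exact: measurable_int intf.
    + by apply/disj_set2P; rewrite setICr.
    by rewrite S0 add0e.
  - move=> F mF tF F0.
    have := @charge_semi_sigma_additive _ _ _ (induced_charge intf) F mF tF (bigcup_measurable (fun k _ => mF k)).
    rewrite /induced_charge => h.
    have {}h : (fun k => \sum_(0 <= i < k) \int[mu]_(x in F i) f x)%E @ \oo -->
      (\int[mu]_(x in \bigcup_k F k) f x)%E by exact: h.
    apply: (cvg_unique _ h) => //.
    rewrite (_ : (fun _ => _) = fun=> 0%E); first exact: cvg_cst.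
    by apply/funext => k; rewrite big1.
have : ae_eq mu setT f (cst 0%E).
  apply: integral_ae_eq => // E _ mE; rewrite all0// integral0//.
apply: filterS => x /(_ Logic.I); rewrite /f patchE => h Ox.
by move: h; rewrite mem_set// => -[].
Qed.

End fundamental_lemma.

(** * The closure of the test functions in H^1 *)

Section sobolev_closure.
Context {R : realType} {n : nat} (Omega : set 'rV[R]_n).
Context (oO : open Omega) (bO : bounded_set Omega).
Local Notation mu := (@lebesgue_row R n).
Local Notation sqint := (sqint mu Omega).
Local Notation ip := (ip mu Omega).
Local Notation nrm2 := (nrm2 mu Omega).
Local Notation L2cvg := (L2cvg mu Omega).
Local Notation test := (test_function Omega).

Let mO : measurable Omega := open_measurable_row oO.

Lemma bounded_finite_measure : (mu Omega < +oo)%E.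
Proof.
have [M hM] := bounded_row_box bO.
apply: le_lt_trans (row_box_fin n M).
by apply: le_measure; rewrite ?inE//; exact: measurable_row_box.
Qed.
Let fO := bounded_finite_measure.

Lemma test_C1c phi : test phi -> exists M, C1c M phi.
Proof.
move=> tphi; have [sphi cphi _] := tphi.
have [M hM] := bounded_row_box (compact_bounded cphi).
exists M; split; first exact: smooth_continuous.
  move=> x nx; apply/eqP; apply: contrapT => /negP px; apply/nx/hM.
  exact: subset_closure.
move=> i; split.
- by move=> x; exact: smooth_derivable.
- exact/smooth_continuous/smooth_partial.
- by move=> x nx; apply: partial_out => /hM.
Qed.

Lemma test_bounded phi : test phi -> exists B : R, forall x, `|phi x| <= B.
Proof.
move=> /test_C1c[M [c s _]]; have [B B0 hB] := C1c_bounded c s.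
exists B => x; apply: le_trans (hB x) _; rewrite indicE.
by case: (_ \in _); rewrite ?mulr1 ?mulr0.
Qed.

Lemma test_measurable phi : test phi -> measurable_fun Omega phi.
Proof.
move=> tphi; apply: measurable_funTS; apply: continuous_measurable_row.
exact/smooth_continuous/(test_smooth tphi).
Qed.

Lemma test_sqint phi : test phi -> sqint phi.
Proof.
move=> tphi; have [B hB] := test_bounded tphi.
by apply: (sqint_bounded mO fO (B := B)) => //; exact: test_measurable.
Qed.

Lemma test_partial_sqint phi i : test phi -> sqint (partial i phi).
Proof. by move=> tphi; exact/test_sqint/test_function_partial. Qed.

Lemma integral_test_partial phi i : test phi ->
  \int[mu]_(x in Omega) partial i phi x = 0.
Proof.
move=> tphi; have [M Cphi] := test_C1c tphi.
rewrite /Rintegral integral_mkcond.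
rewrite (eq_integral (fun x => (partial i phi x)%:E)).
  by rewrite (integral_partial0 i Cphi).
move=> x _; rewrite patchE; case: ifPn => //; rewrite notin_setE => nx /=.
by rewrite (test_function_out (test_function_partial i tphi) nx).
Qed.

(** The integral of d_i (phi psi) vanishes. *)
Lemma integration_by_parts_test phi psi i : test phi -> test psi ->
  ip phi (partial i psi) = - ip (partial i phi) psi.
Proof.
move=> tphi tpsi; have := integral_test_partial i (test_function_mul tphi (test_smooth tpsi)).
rewrite (@eq_Rintegral _ _ _ mu Omega (fun x => phi x * partial i psi x +
    psi x * partial i phi x)); last first.
  by move=> x _; apply: partial_mul; [exact: (test_smooth tphi)|exact: (test_smooth tpsi)].
rewrite RintegralD//; last 2 first.
- exact: (sqint_mul mO (test_sqint tphi) (test_partial_sqint i tpsi)).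
- exact: (sqint_mul mO (test_sqint tpsi) (test_partial_sqint i tphi)).
by move=> /eqP; rewrite addr_eq0 => /eqP h; rewrite [ip (partial i phi) _]ipC; exact: h.
Qed.

(** The pair (w, G) is a limit in L^2 of pairs (phi, grad phi): this is the
    graph of the gradient on H^1_0. Carrying G as data keeps a single explicit
    representative of the gradient through all limits, whereas [grad] chooses
    one. *)
Definition h10 (w : 'rV[R]_n -> R) (G : 'I_n -> 'rV[R]_n -> R) : Prop :=
  [/\ sqint w, forall i, sqint (G i) & exists phi_ : nat -> 'rV[R]_n -> R,
    [/\ forall k, test (phi_ k), L2cvg phi_ w &
        forall i, L2cvg (fun k => partial i (phi_ k)) (G i)]].

Lemma h10_test phi : test phi -> h10 phi (fun i => partial i phi).
Proof.
move=> tphi; split; first exact: test_sqint.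
  by move=> i; exact: test_partial_sqint.
have z u : L2cvg (fun=> u) u.
  rewrite /L2cvg (_ : (fun _ => _) = fun=> 0); first exact: cvg_cst.
  apply/funext => k; rewrite /nrm2 (@eq_Rintegral _ _ _ mu Omega (fun=> 0)).
    by rewrite Rintegral_cst// mul0r.
  by move=> x _; rewrite subrr expr0n.
by exists (fun=> phi); split.
Qed.

Lemma h10_weak w G phi i : h10 w G -> test phi ->
  ip w (partial i phi) = - ip (G i) phi.
Proof.
move=> [sw sG [phi_ [tphi cw cG]]] tp.
have s1 k := test_sqint (tphi k).
have s2 k := test_partial_sqint i (tphi k).
have h1 := ip_cvg mO s1 sw (test_partial_sqint i tp) cw.
have h2 : - ip (partial i (phi_ k)) phi @[k --> \oo] --> - ip (G i) phi.
  exact: (cvgN (ip_cvg mO s2 (sG i) (test_sqint tp) (cG i))).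
apply: (cvg_unique _ h1) => //; apply: (eq_cvgn _ h2) => k.
by rewrite integration_by_parts_test.
Qed.

(** u - v is integrable since the domain has finite measure, so the
    fundamental lemma applies to it. *)
Lemma weak_unique u v : sqint u -> sqint v ->
  (forall phi, test phi -> ip u phi = ip v phi) ->
  {ae mu, forall x, Omega x -> u x = v x}.
Proof.
move=> su sv uv.
have h := @fundamental_lemma _ _ Omega (fun x => u x - v x) oO
  (sqint_rintegrable mO fO (sqintB mO su sv)).
have {h} : {ae mu, forall x, Omega x -> u x - v x = 0}.
  apply: h => phi tp.
  rewrite -[LHS]/(ip (fun x => u x - v x) phi) ipBl ?uv ?subrr//.
  exact: test_sqint.
by apply: filterS => x h Ox; apply/eqP; rewrite -subr_eq0 h.
Qed.

Lemma in_L2P u : in_Lp Omega 2%:E u <-> sqint u.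
Proof.
have E : measurable_fun setT (u \_ Omega) ->
    ('N[mu]_2[EFin \o (u \_ Omega)] < +oo)%E <->
    (\int[mu]_(x in Omega) `|u x ^+ 2|%:E < +oo)%E.
  move=> _; rewrite unlock.
  have -> : (\int[mu]_x `|(EFin \o (u \_ Omega)) x| `^ 2 =
             \int[mu]_(x in Omega) `|u x ^+ 2|%:E)%E.
    rewrite [RHS]integral_mkcond; apply: eq_integral => x _.
    rewrite /= !patchE; case: ifPn => _.
      by rewrite powR_mulrn// normrX.
    by rewrite normr0 powR0.
  have : (0 <= \int[mu]_(x in Omega) `|u x ^+ 2|%:E)%E.
    by apply: integral_ge0 => x _; rewrite lee_fin.
  case: (\int[mu]_(x in Omega) _)%E => [r| |]//= _; first by rewrite !ltry.
  by rewrite gt_eqF// invr_gt0.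
split=> [|[mu1 /rintegrableP[_ iu]]].
  rewrite /in_Lp inE => /andP[]; rewrite inE/= => m1; rewrite inE/= => f1.
  have m2 : measurable_fun Omega u by apply/(measurable_restrictT _ mO).
  split => //; apply/rintegrableP; split; first exact: measurable_funX.
  exact/E.
rewrite /in_Lp inE; apply/andP; split; rewrite inE/=.
  by apply/(measurable_restrictT _ mO).
by apply/E => //; apply/(measurable_restrictT _ mO).
Qed.

Lemma Lp_norm2E u : sqint u -> Lp_norm Omega 2%:E u = (Num.sqrt (nrm2 u))%:E.
Proof.
move=> [mu1 iu]; rewrite /Lp_norm unlock.
have -> : (\int[mu]_x `|(EFin \o (u \_ Omega)) x| `^ 2 = (nrm2 u)%:E)%E.
  rewrite EFin_Rintegral// [RHS]integral_mkcond; apply: eq_integral => x _.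
  rewrite /= !patchE; case: ifPn => _.
    by rewrite powR_mulrn// real_normK ?num_real.
  by rewrite normr0 powR0.
by rewrite poweR_EFin powR12_sqrt// nrm2_ge0.
Qed.

Lemma Lp_norm2_cvg (u_ : nat -> 'rV[R]_n -> R) u :
  (forall k, sqint (u_ k)) -> sqint u ->
  (Lp_norm Omega 2%:E (fun x => u_ k x - u x) @[k --> \oo] --> 0%E <-> L2cvg u_ u).
Proof.
move=> su_ su; have sd k := sqintB mO (su_ k) su.
rewrite (_ : (fun k => Lp_norm _ _ _) =
   (fun k => (Num.sqrt (nrm2 (fun x => u_ k x - u x)))%:E)); last first.
  by apply/funext => k; exact: Lp_norm2E.
split => h.
  have {}h : Num.sqrt (nrm2 (fun x => u_ k x - u x)) @[k --> \oo] --> (0 : R).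
    by apply: (fine_cvg h).
  pose a k := nrm2 (fun x => u_ k x - u x).
  have hh : Num.sqrt (a k) * Num.sqrt (a k) @[k --> \oo] --> (0 * 0 : R).
    exact: (cvgM h h).
  rewrite mulr0 in hh; apply: (eq_cvgn _ hh) => k.
  by rewrite -expr2 sqr_sqrtr ?nrm2_ge0.
apply: cvg_EFin_real; apply: cvg_sqrt0 => // k; exact: nrm2_ge0.
Qed.

Lemma weak_partialP i u v : sqint u -> sqint v ->
  weak_partial Omega i u v <->
  (forall phi, test phi -> ip u (partial i phi) = - ip v phi).
Proof.
move=> su sv; split => h phi tp; have := h phi tp;
  have i1 := sqint_mul mO su (test_partial_sqint i tp);
  have i2 := sqint_mul mO sv (test_sqint tp).
  by rewrite -!EFin_Rintegral// -EFinN => -[].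
by rewrite -!EFin_Rintegral// -EFinN => <-.
Qed.

Lemma H10_h10 u : H10 Omega u -> h10 u (fun i x => grad Omega u x ord0 i).
Proof.
move=> [[/in_L2P su exG] [phi_ [tp c1 c2]]].
have gP : L2_weak_gradient Omega u (grad Omega u) by apply: xgetPex.
have sg i : sqint (fun x => grad Omega u x ord0 i) by apply/in_L2P; have [] := gP i.
split => //; exists phi_; split => //.
  by apply/Lp_norm2_cvg => // k; exact: test_sqint.
by move=> i; apply/Lp_norm2_cvg => // k; exact: test_partial_sqint.
Qed.

(** G is a weak gradient, and weak gradients are unique almost everywhere, so
    the chosen gradient of u is also the limit of the gradients of the test
    functions. *)
Lemma h10_H10 u G : h10 u G -> H10 Omega u /\
  forall i, {ae mu, forall x, Omega x -> grad Omega u x ord0 i = G i x}.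
Proof.
move=> hG; have [su sG [phi_ [tp c1 c2]]] := hG.
pose G' x : 'rV[R]_n := \row_i G i x.
have G'E i : (fun x => G' x ord0 i) = G i by apply/funext => x; rewrite mxE.
have wG' : L2_weak_gradient Omega u G'.
  move=> i; rewrite G'E; split; first exact/in_L2P.
  by apply/weak_partialP => // phi tphi; exact: h10_weak.
have gP : L2_weak_gradient Omega u (grad Omega u) by apply: xgetPex; exists G'.
have sg i : sqint (fun x => grad Omega u x ord0 i) by apply/in_L2P; have [] := gP i.
have ae i : {ae mu, forall x, Omega x -> grad Omega u x ord0 i = G i x}.
  apply: weak_unique => // phi tphi; apply: oppr_inj.
  rewrite -(h10_weak i hG tphi); have [_ /weak_partialP] := gP i.
  by move=> /(_ su (sg i) phi tphi) ->.
split => //; split; first by split; [exact/in_L2P|exists G'].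
exists phi_; split => //; first by apply/Lp_norm2_cvg => // k; exact: test_sqint.
move=> i; apply/Lp_norm2_cvg => //; first by move=> k; exact: test_partial_sqint.
apply: (eq_cvgn _ (c2 i)) => k.
have [m1 _] := test_partial_sqint i (tp k); have [m2 _] := sG i; have [m3 _] := sg i.
apply: (nrm2_ae_eq mO); [exact: measurable_funB|exact: measurable_funB|].
by apply: filterS (ae i) => x h Ox; rewrite h.
Qed.

End sobolev_closure.

(** * Chain rule, Poincare inequality and Riesz representation in H^1_0 *)

Section chain_rule.
Context {R : realType} {n : nat} (Omega : set 'rV[R]_n).
Context (oO : open Omega) (bO : bounded_set Omega).
Local Notation mu := (@lebesgue_row R n).
Local Notation sqint := (sqint mu Omega).
Local Notation nrm2 := (nrm2 mu Omega).
Local Notation L2cvg := (L2cvg mu Omega).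
Local Notation test := (test_function Omega).
Local Notation h10 := (h10 Omega).

Let mO : measurable Omega := open_measurable_row oO.
Let fO := bounded_finite_measure oO bO.

Lemma nrm2_le (u v : 'rV[R]_n -> R) : measurable_fun Omega u -> sqint v ->
  (forall x, Omega x -> `|u x| <= `|v x|) -> nrm2 u <= nrm2 v.
Proof.
move=> mu1 [mv iv] uv; apply: le_Rintegral => //.
  apply: (rintegrable_le mO _ iv); first exact: measurable_funX.
  move=> x Ox; rewrite normrX -(real_normK (num_real (v x))).
  by apply: lerXn2r; rewrite ?nnegrE// uv.
move=> x Ox; rewrite -(real_normK (num_real (u x))) -(real_normK (num_real (v x))).
by apply: lerXn2r; rewrite ?nnegrE// uv.
Qed.

Lemma sqint_le (u v : 'rV[R]_n -> R) : measurable_fun Omega u -> sqint v ->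
  (forall x, Omega x -> `|u x| <= `|v x|) -> sqint u.
Proof.
move=> mu1 [mv iv] uv; split => //.
apply: (rintegrable_le mO _ iv); first exact: measurable_funX.
move=> x Ox; rewrite normrX -(real_normK (num_real (v x))).
by apply: lerXn2r; rewrite ?nnegrE// uv.
Qed.

Lemma L2cvg_perturb (u_ z_ : nat -> 'rV[R]_n -> R) u : (forall k, sqint (u_ k)) ->
  sqint u -> (forall k, sqint (z_ k)) -> L2cvg u_ u ->
  nrm2 (z_ k) @[k --> \oo] --> (0 : R) -> L2cvg (fun k x => z_ k x + u_ k x) u.
Proof.
move=> su_ su sz uu zz; rewrite /L2cvg.
apply: (@squeeze0 _ _ (fun k => 2 * nrm2 (z_ k) + 2 * nrm2 (fun x => u_ k x - u x))).
  move=> k; rewrite ger0_norm ?nrm2_ge0//.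
  apply: le_trans (nrm2_tri mO (sz k) (sqintB mO (su_ k) su)).
  rewrite le_eqVlt; apply/orP; left; apply/eqP.
  by apply: eq_Rintegral => x _; rewrite addrA.
rewrite -[X in _ --> X](_ : 2 * 0 + 2 * 0 = 0); last by rewrite mulr0 addr0.
by apply: cvgD; exact: cvgMl_tmp.
Qed.

(** Chain rule for a C^1 function g with bounded derivative and g 0 = 0. If
    test functions phi_k tend to w, then g (phi_k) tends to g (w) with its
    gradient, and on the range of phi_k, which is bounded, g is C^1-close to a
    polynomial P_k with P_k 0 = 0; so the test functions P_k (phi_k) do the
    same. They inherit the bounds of g up to 1, which later allows dominated
    convergence against a function that is merely integrable. *)
Lemma h10_comp (w : 'rV[R]_n -> R) G (g g' : R -> R) (L : R) : h10 w G ->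
  (forall t : R, is_derive t 1 g (g' t)) -> continuous g' ->
  (forall t, `|g' t| <= L) -> g 0 = 0 ->
  [/\ sqint (fun x => g (w x)), forall i, sqint (fun x => g' (w x) * G i x) &
   exists psi_ : nat -> 'rV[R]_n -> R,
   [/\ forall k, test (psi_ k), L2cvg psi_ (fun x => g (w x)),
     forall i, L2cvg (fun k => partial i (psi_ k)) (fun x => g' (w x) * G i x),
     {ae mu, forall x, Omega x -> psi_ k x @[k --> \oo] --> g (w x)} &
     forall B : R, (forall t, `|g t| <= B) -> forall k x, `|psi_ k x| <= B + 1]].
Proof.
move=> [sw sG [phi_ [tphi cw cG]]] dg cg' g'L g0.
have mw : measurable_fun Omega w by have [] := sw.
have cg : continuous g.
  move=> x; apply: differentiable_continuous.
  by apply/derivable1_diffP; have [] := dg x.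
have L0 : 0 <= L by apply: le_trans (g'L 0).
have gLip s t : `|g s - g t| <= L * `|s - t| by apply: (mean_value_bound dg) => x _.
have gle t : `|g t| <= L * `|t| by have := gLip t 0; rewrite g0 !subr0.
have mgw : measurable_fun Omega (fun x => g (w x)).
  exact: (measurableT_comp (continuous_measurable_fun cg) mw).
have mg'w : measurable_fun Omega (fun x => g' (w x)).
  exact: (measurableT_comp (continuous_measurable_fun cg') mw).
have sgw : sqint (fun x => g (w x)).
  apply: (sqint_le mgw (sqintZ mO L sw)) => x _.
  by rewrite normrM (ger0_norm L0).
have sgG i : sqint (fun x => g' (w x) * G i x).
  by apply: (sqint_bounded_mul mO (B := L)) => // x _; exact: g'L.
split => //.
have sphi k := test_sqint oO bO (tphi k).
have [s [hs aes]] := L2cvg_ae_subsequence mO fO sphi sw cw.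
pose phi k := phi_ (s k).
have tp k : test (phi k) by exact: tphi.
have sp k : sqint (phi k) by exact: sphi.
have spp i k : sqint (partial i (phi k)) := test_partial_sqint oO bO i (tp k).
have cphi : L2cvg phi w by exact: (cvg_subsequence hs cw).
have cphi' i : L2cvg (fun k => partial i (phi k)) (G i) by exact: (cvg_subsequence hs (cG i)).
(* The polynomial of index k approximates g and g' to within 1 / (k + 1) on
   the range of phi_k. *)
have exP k : exists P : {poly R}, P.[0] = 0 /\ forall x,
    `|P.[phi k x] - g (phi k x)| <= k.+1%:R^-1 /\
    `|P^`().[phi k x] - g' (phi k x)| <= k.+1%:R^-1.
  have [K hK] := test_bounded (tp k).
  have K0 : 0 < `|K| + 1 by rewrite ltr_wpDl.
  have e0 : 0 < k.+1%:R^-1 :> R by rewrite invr_gt0.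
  have [P [P0 hP]] := C1_polynomial_approx dg cg' g0 K0 e0.
  exists P; split => // x; apply: hP; apply: le_trans (hK x) _.
  by rewrite (le_trans (ler_norm _))// lerDl.
have [P hP] := choice exP.
pose psi k x := (P k).[phi k x].
have tpsi k : test (psi k) by apply: test_function_horner => //; have [] := hP k.
have sphi' k : smooth (phi k) := test_smooth (tp k).
have ppsi i k x : partial i (psi k) x = (P k)^`().[phi k x] * partial i (phi k) x.
  by apply: partial_comp => // t; exact: is_derive_poly.
have spsi k : sqint (psi k) := test_sqint oO bO (tpsi k).
have sppsi i k : sqint (partial i (psi k)) := test_partial_sqint oO bO i (tpsi k).
have inv0 : (k.+1%:R^-1 : R) @[k --> \oo] --> (0 : R).
  exact: cvg_harmonic.
have inv20 : (k.+1%:R^-1 ^+ 2 : R) @[k --> \oo] --> (0 : R).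
  rewrite -(mulr0 (0 : R)); exact: (cvgM inv0 inv0).
have mp k : measurable_fun Omega (phi k) by have [] := sp k.
have mgp k : measurable_fun Omega (fun x => g (phi k x)).
  exact: (measurableT_comp (continuous_measurable_fun cg) (mp k)).
have mg'p k : measurable_fun Omega (fun x => g' (phi k x)).
  exact: (measurableT_comp (continuous_measurable_fun cg') (mp k)).
have sgp k : sqint (fun x => g (phi k x)).
  apply: (sqint_le (mgp k) (sqintZ mO L (sp k))) => x _.
  by rewrite normrM (ger0_norm L0).
(* g is L-Lipschitz. *)
have cgp : L2cvg (fun k x => g (phi k x)) (fun x => g (w x)).
  apply: (@squeeze0 _ _ (fun k => L ^+ 2 * nrm2 (fun x => phi k x - w x))).
    move=> k; rewrite ger0_norm ?nrm2_ge0// -nrm2Z//; last exact: sqintB.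
    apply: nrm2_le; first exact: measurable_funB.
      by apply: sqintZ => //; exact: sqintB.
    by move=> x _; rewrite normrM (ger0_norm L0).
  by rewrite -(mulr0 (L ^+ 2)); exact: cvgMl_tmp.
exists psi; split => //.
- have sz k : sqint (fun x => psi k x - g (phi k x)) by exact: sqintB.
  have h := L2cvg_perturb sgp sgw sz cgp.
  have {h} : L2cvg (fun k x => psi k x - g (phi k x) + g (phi k x)) (fun x => g (w x)).
    apply: h.
    apply: (@squeeze0 _ _ (fun k => k.+1%:R^-1 ^+ 2 * fine (mu Omega))).
      move=> k; rewrite ger0_norm ?nrm2_ge0//.
      rewrite -(Rintegral_cst mu mO).
      apply: le_Rintegral => //.
      + by have [] := sz k.
      + exact: rintegrable_cst.
      + move=> x Ox; rewrite -(real_normK (num_real _)).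
        by apply: lerXn2r; rewrite ?nnegrE//; have [_ /(_ x)[]] := hP k.
    by rewrite -(mul0r (fine (mu Omega))); exact: cvgMr_tmp.
  apply: eq_cvgn => k; congr nrm2; apply/funext => x; by rewrite subrK.
- move=> i.
  have smul k : sqint (fun x => g' (phi k x) * partial i (phi k) x).
    by apply: (sqint_bounded_mul mO (B := L)) => // x _; exact: g'L.
  have cmul : L2cvg (fun k x => g' (phi k x) * partial i (phi k) x) (fun x => g' (w x) * G i x).
    apply: (L2cvg_mul mO (B := L)) => //.
    apply: filterS aes => x h Ox; exact: (cvg_comp _ _ (h Ox) (cg' (w x))).
  have sz k : sqint (fun x => ((P k)^`().[phi k x] - g' (phi k x)) * partial i (phi k) x).
    have := sqintB mO (sppsi i k) (smul k); congr sqint.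
    by apply/funext => x; rewrite ppsi mulrBl.
  have h := L2cvg_perturb smul (sgG i) sz cmul.
  have {h} : L2cvg (fun k x => ((P k)^`().[phi k x] - g' (phi k x)) * partial i (phi k) x
     + g' (phi k x) * partial i (phi k) x) (fun x => g' (w x) * G i x).
    apply: h.
    apply: (@squeeze0 _ _ (fun k => k.+1%:R^-1 ^+ 2 * nrm2 (partial i (phi k)))).
      move=> k; rewrite ger0_norm ?nrm2_ge0// -nrm2Z//.
      apply: nrm2_le; first by have [] := sz k.
        exact: sqintZ.
      move=> x _; rewrite !normrM ler_wpM2r// [leRHS]ger0_norm ?invr_ge0//.
      by have [_ /(_ x)[]] := hP k.
    rewrite -(mul0r (nrm2 (G i))); apply: cvgM => //.
    exact: (nrm2_cvg mO _ _ (cphi' i)).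
  apply: eq_cvgn => k; congr nrm2; apply/funext => x; by rewrite ppsi mulrBl subrK.
- apply: filterS aes => x h Ox.
  have h1 : g (phi k x) @[k --> \oo] --> g (w x) := cvg_comp _ _ (h Ox) (cg (w x)).
  have h2 : psi k x - g (phi k x) @[k --> \oo] --> (0 : R).
    by apply: (squeeze0 _ inv0) => k; have [_ /(_ x)[]] := hP k.
  have h3 : psi k x - g (phi k x) + g (phi k x) @[k --> \oo] --> 0 + g (w x).
    exact: (cvgD h2 h1).
  rewrite add0r in h3.
  by apply: (eq_cvgn _ h3) => k; rewrite /= subrK.
- move=> B gB k x.
  have -> : psi k x = g (phi k x) + (psi k x - g (phi k x)) by rewrite addrC subrK.
  apply: le_trans (ler_normD _ _) _; apply: lerD; first exact: gB.
  have [_ /(_ x)[h _]] := hP k; apply: le_trans h _.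
  by rewrite invf_le1// ler1n.
Qed.

End chain_rule.

Lemma cvg_bigsum {R : realType} (I : Type) (r : seq I) (a_ : nat -> I -> R) (a : I -> R) :
  (forall i, a_ k i @[k --> \oo] --> a i) ->
  \sum_(i <- r) a_ k i @[k --> \oo] --> \sum_(i <- r) a i.
Proof.
move=> h; elim: r => [|i r IH].
  by rewrite big_nil; apply: (eq_cvgn _ (cvg_cst 0)) => k; rewrite big_nil.
have c : a_ k i + \sum_(j <- r) a_ k j @[k --> \oo] --> a i + \sum_(j <- r) a j.
  exact: (cvgD (h i) IH).
by rewrite big_cons; apply: (eq_cvgn _ c) => k; rewrite big_cons.
Qed.

Section riesz.
Context {R : realType} {n : nat} (Omega : set 'rV[R]_n.+1).
Context (oO : open Omega) (bO : bounded_set Omega).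
Local Notation mu := (@lebesgue_row R n.+1).
Local Notation sqint := (sqint mu Omega).
Local Notation ip := (ip mu Omega).
Local Notation nrm2 := (nrm2 mu Omega).
Local Notation L2cvg := (L2cvg mu Omega).
Local Notation test := (test_function Omega).
Local Notation h10 := (h10 Omega).

Let mO : measurable Omega := open_measurable_row oO.
Let fO := bounded_finite_measure oO bO.

Definition gip (G H : 'I_n.+1 -> 'rV[R]_n.+1 -> R) : R := \sum_i ip (G i) (H i).
Definition grads (phi : 'rV[R]_n.+1 -> R) : 'I_n.+1 -> 'rV[R]_n.+1 -> R :=
  fun i => partial i phi.
Definition dirichlet phi : R := gip (grads phi) (grads phi).

Lemma gip_nrm2 G : gip G G = \sum_i nrm2 (G i).
Proof. by apply: eq_bigr => i _; exact: ip_nrm2. Qed.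

Lemma gip_ge0 G : 0 <= gip G G.
Proof. by rewrite gip_nrm2; apply: sumr_ge0 => i _; exact: nrm2_ge0. Qed.

Lemma nrm2_le_gip G i : nrm2 (G i) <= gip G G.
Proof.
rewrite gip_nrm2 (bigD1 i)//= lerDl; apply: sumr_ge0 => j _; exact: nrm2_ge0.
Qed.

(** Cauchy-Schwarz componentwise; the factor n + 1 only costs a constant. *)
Lemma gip_cauchy_schwarz G H : (forall i, sqint (G i)) -> (forall i, sqint (H i)) ->
  `|gip G H| <= n.+1%:R * (Num.sqrt (gip G G) * Num.sqrt (gip H H)).
Proof.
move=> sG sH; apply: le_trans (ler_norm_sum _ _ _) _.
rewrite mulr_natl -[X in _ *+ X](card_ord n.+1) -sumr_const.
apply: ler_sum => i _; apply: le_trans (cauchy_schwarz_norm mO (sG i) (sH i)) _.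
by apply: ler_pM; rewrite ?sqrtr_ge0// ler_wsqrtr// nrm2_le_gip.
Qed.

Lemma gip_cvg (G_ : nat -> 'I_n.+1 -> 'rV[R]_n.+1 -> R) G H :
  (forall k i, sqint (G_ k i)) -> (forall i, sqint (G i)) -> (forall i, sqint (H i)) ->
  (forall i, L2cvg (fun k => G_ k i) (G i)) ->
  gip (G_ k) H @[k --> \oo] --> gip G H.
Proof.
move=> sG_ sG sH cG; apply: (cvg_bigsum (a_ := fun k i => ip (G_ k i) (H i))) => i.
exact: ip_cvg.
Qed.

Lemma gip_nrm2_cvg (G_ : nat -> 'I_n.+1 -> 'rV[R]_n.+1 -> R) G :
  (forall k i, sqint (G_ k i)) -> (forall i, sqint (G i)) ->
  (forall i, L2cvg (fun k => G_ k i) (G i)) ->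
  gip (G_ k) (G_ k) @[k --> \oo] --> gip G G.
Proof.
move=> sG_ sG cG; rewrite gip_nrm2.
apply: (@eq_cvgn _ (fun k => \sum_i nrm2 (G_ k i))); first by move=> k; rewrite gip_nrm2.
apply: (cvg_bigsum (a_ := fun k i => nrm2 (G_ k i))) => i.
by apply: nrm2_cvg => // k.
Qed.

Lemma integral_Omega (g : 'rV[R]_n.+1 -> R) : (forall x, ~ Omega x -> g x = 0) ->
  (\int[mu]_(x in Omega) (g x)%:E = \int[mu]_x (g x)%:E)%E.
Proof.
move=> g0; rewrite integral_mkcond; apply: eq_integral => x _; rewrite patchE.
by case: ifPn => //; rewrite notin_setE => nx; rewrite g0.
Qed.

(** The integral of d_0 (x_0 phi^2) = phi^2 + 2 x_0 phi d_0 phi vanishes, and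
    x_0 is bounded on the domain, so Cauchy-Schwarz bounds |phi|^2 by
    C |phi| |d_0 phi|. *)
Lemma poincare : exists2 C : R, 0 < C & forall phi, test phi -> nrm2 phi <= C * dirichlet phi.
Proof.
have [M hM] := bounded_row_box bO.
exists (4 * M ^+ 2 + 1); first by rewrite ltr_wpDl// mulr_ge0// sqr_ge0.
move=> phi tphi; have sphi := test_smooth tphi.
pose X (x : 'rV[R]_n.+1) : R := x ord0 ord0; have sX : smooth X := smooth_coord ord0.
have XM x : Omega x -> `|X x| <= M by move=> /hM /(_ ord0).
have tsq := test_function_mul tphi sphi.
have := integral_test_partial ord0 (test_function_mul tsq sX).
have sp := test_sqint oO bO tphi; have spp := test_partial_sqint oO bO ord0 tphi.
have mX : measurable_fun Omega X.
  by apply: measurable_funTS; apply: continuous_measurable_row; exact: smooth_continuous.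
have sXp : sqint (fun x => X x * phi x) := sqint_bounded_mul mO mX XM sp.
have iXp := sqint_mul mO sXp spp; have i2 := rintegrableZ mO 2 iXp.
rewrite (@eq_Rintegral _ _ _ mu Omega
  (fun x => phi x ^+ 2 + 2 * (X x * phi x * partial ord0 phi x))); last first.
  move=> x _; rewrite (partial_mul ord0 x (smooth_mul sphi sphi) sX) (partial_mul ord0 x sphi sphi).
  by rewrite /X partial_coord /X; ring.
rewrite (RintegralD mO (proj2 sp) i2) (RintegralZl 2 mO iXp) -/(nrm2 phi).
rewrite -/(ip (fun x => X x * phi x) _) => /eqP; rewrite addr_eq0 => /eqP e.
have h1 := cauchy_schwarz mO sXp spp.
have h2 : nrm2 (fun x => X x * phi x) <= M ^+ 2 * nrm2 phi.
  rewrite -(nrm2Z mO M sp); apply: (nrm2_le oO (proj1 sXp) (sqintZ mO M sp)) => x Ox.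
  by rewrite !normrM ler_wpM2r// (le_trans (XM x Ox))// ler_norm.
have h3 := nrm2_le_gip (grads phi) ord0; rewrite -/(dirichlet phi) /grads in h3.
have a0 : 0 <= nrm2 phi := nrm2_ge0 mu Omega phi.
have b0 : 0 <= nrm2 (partial ord0 phi) := nrm2_ge0 mu Omega _.
move: e h1 h2 h3 a0 b0; move: (nrm2 phi) (ip (fun x => X x * phi x) (partial ord0 phi))
  (nrm2 (fun x => X x * phi x)) (nrm2 (partial ord0 phi)) (dirichlet phi).
move=> a i c b d e h1 h2 h3 a0 b0.
have h4 : a * a <= a * (4 * M ^+ 2 * d).
  have -> : a * a = 4 * i ^+ 2 by rewrite e; ring.
  have -> : a * (4 * M ^+ 2 * d) = 4 * (M ^+ 2 * a * d) by ring.
  rewrite ler_pM2l//; apply: le_trans h1 _; apply: (@le_trans _ _ (M ^+ 2 * a * b)).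
    exact: ler_wpM2r.
  by apply: ler_wpM2l => //; rewrite mulr_ge0// sqr_ge0.
have d0 : 0 <= d := le_trans b0 h3.
move: a0; rewrite le_eqVlt => /predU1P[<-|ap].
  by rewrite mulr_ge0// addr_ge0// mulr_ge0// sqr_ge0.
move: h4; rewrite (ler_pM2l ap) => h4; apply: le_trans h4 _.
by rewrite [leRHS]mulrDl mul1r lerDl.
Qed.

Lemma dirichletD phi psi c : test phi -> test psi ->
  dirichlet (fun x => phi x + c * psi x) =
  dirichlet phi + 2 * c * gip (grads phi) (grads psi) + c ^+ 2 * dirichlet psi.
Proof.
move=> tphi tpsi; rewrite /dirichlet !gip_nrm2 /gip !mulr_sumr -!big_split/=.
apply: eq_bigr => i _.
rewrite -(nrm2D mO c (test_partial_sqint oO bO i tphi) (test_partial_sqint oO bO i tpsi)).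
congr nrm2; apply/funext => x; rewrite /grads.
rewrite (partial_add i x (test_smooth tphi) (smooth_scale c (test_smooth tpsi))).
by rewrite (partial_scale c i x (test_smooth tpsi)).
Qed.

(** The Riesz representation theorem for the Dirichlet inner product, by the
    direct method. J phi = dirichlet phi / 2 - F phi is bounded below. A
    minimising sequence of test functions is Cauchy for the Dirichlet norm, by
    the parallelogram identity, hence for the L^2 norm by Poincare's
    inequality. Its limit is a critical point of J. *)
Lemma riesz_representation (F : ('rV[R]_n.+1 -> R) -> R) (C : R) : 0 <= C ->
  (forall phi psi c, test phi -> test psi ->
     F (fun x => phi x + c * psi x) = F phi + c * F psi) ->
  (forall phi, test phi -> F phi ^+ 2 <= C * dirichlet phi) ->
  exists w G, h10 w G /\ forall phi, test phi -> gip G (grads phi) = F phi.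
Proof.
move=> C0 linF bF.
pose J phi := dirichlet phi / 2 - F phi.
have Jge phi : test phi -> - (C / 2) <= J phi.
  move=> tphi; have d0 : 0 <= dirichlet phi by exact: gip_ge0.
  have h : F phi <= (C + dirichlet phi) / 2.
    have h1 : `|F phi| ^+ 2 <= ((C + dirichlet phi) / 2) ^+ 2.
      rewrite real_normK ?num_real//; apply: le_trans (bF phi tphi) _.
      have := sqr_ge0 (C - dirichlet phi); nra.
    apply: le_trans (ler_norm _) _.
    move: h1; rewrite ler_pXn2r// nnegrE divr_ge0// addr_ge0//.
  rewrite /J; lra.
pose E := [set J phi | phi in [set phi | test phi]].
have hE : has_inf E.
  split; first by exists (J (fun=> 0)), (fun=> 0) => //; exact: test_function0.
  by exists (- (C / 2)) => _ [phi tphi <-]; exact: Jge.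
pose d := inf E.
have Jd phi : test phi -> d <= J phi.
  by move=> tphi; apply: ge_inf; [case: hE|exists phi].
have exphi k : exists phi, test phi /\ J phi < d + k.+1%:R^-1.
  have e0 : 0 < k.+1%:R^-1 :> R by rewrite invr_gt0.
  by have [_ [phi tphi <-] h] := inf_adherent e0 hE; exists phi.
have [phi hphi] := choice exphi.
have tphi k : test (phi k) by case: (hphi k).
have Jphi k : J (phi k) < d + k.+1%:R^-1 by case: (hphi k).
pose B f g := gip (grads f) (grads g).
have JD f g c : test f -> test g ->
    J (fun x => f x + c * g x) = J f + c * (B f g - F g) + c ^+ 2 * (dirichlet g / 2).
  move=> tf tg; rewrite /J (dirichletD c tf tg) (linF _ _ c tf tg) -/(B f g).
  by move: (dirichlet f) (dirichlet g) (B f g) (F f) (F g) => *; field.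
have cauchy_phi j k : dirichlet (fun x => phi j x + (-1) * phi k x) <=
    4 * (j.+1%:R^-1 + k.+1%:R^-1).
  have tjk := test_function_add (tphi j) (test_function_scale (-1) (tphi k)).
  (* Parallelogram identity: J at the midpoint of phi_j and phi_k is at least
     the infimum d. *)
  have h0 := Jd _ (test_function_add (tphi k) (test_function_scale (1/2) tjk)).
  have h1 := JD (phi k) _ 1 (tphi k) tjk.
  have h2 := JD (phi k) _ (1 / 2) (tphi k) tjk.
  rewrite h2 in h0.
  have e : (fun x => phi k x + 1 * (phi j x + -1 * phi k x)) = phi j.
    by apply/funext => x; ring.
  rewrite e in h1; move: h0 (Jphi j) (Jphi k); rewrite h1 expr1n.
  have -> : (1 / 2 : R) ^+ 2 = 1 / 4 by field.
  move: (dirichlet _) (B _ _ - F _) (J _) (j.+1%:R^-1) (k.+1%:R^-1) => q b J0 x y.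
  clear; lra.
have inv_small (e : R) : 0 < e -> exists N, forall k, (N <= k)%N -> k.+1%:R^-1 <= e :> R.
  move=> e0; have [N _ h] := near_infty_natSinv_lt (PosNum e0).
  by exists N => k Nk; apply/ltW; exact: h.
have [Cp Cp0 hCp] := poincare.
have sub_test j k : (fun x => phi j x - phi k x) = (fun x => phi j x + (-1) * phi k x).
  by apply/funext => x; rewrite mulN1r.
have sphi k := test_sqint oO bO (tphi k).
have spphi i k := test_partial_sqint oO bO i (tphi k).
have tsub j k := test_function_add (tphi j) (test_function_scale (-1) (tphi k)).
have [w [sw cw]] : exists u, sqint u /\ L2cvg phi u.
  apply: L2_complete => // e e0.
  have [N hN] := inv_small (e / (8 * Cp)) (divr_gt0 e0 (mulr_gt0 (ltr0Sn _ _) Cp0)).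
  exists N => j k Nj Nk; rewrite sub_test.
  apply: le_trans (hCp _ (tsub j k)) _.
  have := cauchy_phi j k; have := hN j Nj; have := hN k Nk.
  rewrite !ler_pdivlMr ?mulr_gt0// => h1 h2 h3.
  apply: (@le_trans _ _ (Cp * (4 * (j.+1%:R^-1 + k.+1%:R^-1)))).
    by rewrite ler_wpM2l// ltW.
  rewrite (_ : Cp * _ = (j.+1%:R^-1 * (8 * Cp) + k.+1%:R^-1 * (8 * Cp)) / 2); last first.
    by move: (j.+1%:R^-1) (k.+1%:R^-1) => x y; field.
  by rewrite ler_pdivrMr// mulr_natr mulr2n lerD.
have psub i j k x : partial i (phi j) x - partial i (phi k) x =
    grads (fun x => phi j x + (-1) * phi k x) i x.
  rewrite /grads (partial_add i x (test_smooth (tphi j))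
    (smooth_scale (-1) (test_smooth (tphi k)))).
  by rewrite (partial_scale (-1) i x (test_smooth (tphi k))) mulN1r.
have exG i : exists u, sqint u /\ L2cvg (fun k => partial i (phi k)) u.
  apply: L2_complete => // e e0.
  have [N hN] := inv_small (e / 8) (divr_gt0 e0 (ltr0Sn _ _)).
  exists N => j k Nj Nk.
  under [X in nrm2 X]eq_fun do rewrite psub.
  apply: le_trans (nrm2_le_gip _ i) _.
  apply: le_trans (cauchy_phi j k) _.
  have h8 : e = 4 * (e / 8 + e / 8) by field.
  by rewrite [leRHS]h8 ler_pM2l// lerD// hN.
have [G hG] := choice exG.
have sG i : sqint (G i) by case: (hG i).
have cG i : L2cvg (fun k => partial i (phi k)) (G i) by case: (hG i).
exists w, G; split; first by split => //; exists phi; split.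
move=> psi tpsi.
have spsi i : sqint (grads psi i) := test_partial_sqint oO bO i tpsi.
(* J (phi_k + s psi) >= d, in the limit k --> oo. *)
have key s : 0 <= s * (gip G (grads psi) - F psi) + s ^+ 2 * (dirichlet psi / 2).
  have c1 : B (phi k) psi @[k --> \oo] --> gip G (grads psi).
    by apply: gip_cvg => // k i; exact: spphi.
  have c2 : s * (B (phi k) psi - F psi) + s ^+ 2 * (dirichlet psi / 2) + k.+1%:R^-1
      @[k --> \oo] --> s * (gip G (grads psi) - F psi) + s ^+ 2 * (dirichlet psi / 2) + 0.
    apply: cvgD; last exact: cvg_harmonic.
    apply: cvgD; last exact: cvg_cst.
    by apply: cvgMl_tmp; apply: cvgB => //; exact: cvg_cst.
  rewrite addr0 in c2.
  apply: (cvgr_to_ge c2); apply: nearW => k.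
  have := Jd _ (test_function_add (tphi k) (test_function_scale s tpsi)).
  rewrite JD//; move: (Jphi k).
  move: (J _) (B _ _ - F _) (dirichlet _) (k.+1%:R^-1) => a b q x.
  clear; lra.
pose e := gip G (grads psi) - F psi; pose q := dirichlet psi.
have q0 : 0 <= q by exact: gip_ge0.
(* This s makes the linear term dominate the quadratic one, since
   q / 2 < q + 1. *)
have := key (- e / (q + 1)); rewrite -/e -/q.
have q1 : 0 < q + 1 by rewrite ltr_wpDl.
have -> : - e / (q + 1) * e + (- e / (q + 1)) ^+ 2 * (q / 2) =
    - (e ^+ 2 * ((q + 2) / (2 * (q + 1) ^+ 2))) by field; rewrite gt_eqF.
rewrite oppr_ge0 => h.
have : e ^+ 2 <= 0.
  have p : 0 < (q + 2) / (2 * (q + 1) ^+ 2).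
    by rewrite divr_gt0 ?mulr_gt0 ?exprn_gt0// ltr_wpDl.
  by move: h; rewrite pmulr_lle0.
move=> h2; have : e ^+ 2 == 0 by rewrite eq_le h2 sqr_ge0.
by rewrite sqrf_eq0 /e subr_eq0 => /eqP.
Qed.

End riesz.

(** * Boundedness of solutions by truncation *)

Section stampacchia_iteration.
Context {R : realType}.

(** Stampacchia's lemma. Let k_j = K (1 - 2^-j). If A (k_j) <= A0 r^j, then
    the inequality for k_j and k_(j+1) multiplies the bound r^(j al) for
    A (k_(j+1))^al by (2 r^(be - al))^j. With r^(be - al) = 1/2 this factor is
    1, so that the geometric decay propagates once K is large, and A (K) = 0.
    The level K depends on A through the bound A0 only. *)
Lemma stampacchia_iteration (al be C A0 : R) : 0 < al -> al < be -> 0 <= C -> 0 < A0 ->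
  exists2 K : R, 0 < K & forall A : R -> R,
    (forall k, 0 <= A k) -> (forall h k, k <= h -> A h <= A k) -> A 0 <= A0 ->
    (forall k h : R, 0 <= k -> k < h -> (h - k) * A h `^ al <= C * A k `^ be) -> A K = 0.
Proof.
move=> al0 albe C0 A00.
pose r : R := (1 / 2) `^ (be - al)^-1.
have ba0 : 0 < be - al by rewrite subr_gt0.
have half0 : 0 < 1 / 2 :> R by [].
have r0 : 0 < r by exact: powR_gt0.
have r1 : r < 1.
  have := @gt0_ltr_powR R (be - al)^-1; rewrite invr_gt0 => /(_ ba0 (1 / 2) 1).
  rewrite !nnegrE powR1; apply => //; lra.
have rba : r `^ (be - al) = 1 / 2.
  by rewrite -powRrM mulVf ?gt_eqF// powRr1// ltW.
pose p := r `^ al; have p0 : 0 < p by exact: powR_gt0.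
have pb : r `^ be = p / 2.
  rewrite -[be in LHS](subrK al) powRD ?rba; last by rewrite (gt_eqF r0) implybT.
  by rewrite mul1r mulrC.
have rX (j : nat) (s : R) : (r ^+ j) `^ s = (r `^ s) ^+ j.
  by rewrite -powR_mulrn ?(ltW r0)// -powRrM mulrC powRrM powR_mulrn// powR_ge0.
have Aal : 0 < A0 `^ al by exact: powR_gt0.
pose K := 2 * C * A0 `^ be / (A0 `^ al * p) + 1.
have hK : 2 * C * A0 `^ be <= K * (A0 `^ al * p).
  have Ap0 : 0 < A0 `^ al * p by exact: mulr_gt0.
  by rewrite /K [leRHS]mulrDl divfK ?(gt_eqF Ap0)// mul1r lerDl ltW.
have K0 : 0 < K.
  rewrite ltr_wpDl// divr_ge0 ?mulr_ge0 ?powR_ge0//; exact: ltW.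
exists K => // A Ap Am A00' hA.
pose k_ (j : nat) := K * (1 - (1 / 2) ^+ j).
have k_K j : k_ j <= K by rewrite /k_ -[leRHS]mulr1 ler_pM2l// gerBl exprn_ge0.
have k_0 j : 0 <= k_ j.
  by rewrite mulr_ge0 ?(ltW K0)// subr_ge0 exprn_ile1//; lra.
have kS j : k_ j.+1 - k_ j = K * (1 / 2) ^+ j / 2.
  by rewrite /k_ exprS; move: ((1 / 2) ^+ j) => t; field.
have claim j : A (k_ j) <= A0 * r ^+ j.
  elim: j => [|j IH]; first by rewrite /k_ expr0 subrr mulr0 mulr1.
  have hj : 0 < K * (1 / 2) ^+ j / 2 by rewrite divr_gt0// mulr_gt0// exprn_gt0.
  have := hA (k_ j) (k_ j.+1) (k_0 j); rewrite -subr_gt0 kS => /(_ hj) h.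
  have r0j : 0 <= r ^+ j by rewrite exprn_ge0// ltW.
  have h2 : A (k_ j) `^ be <= A0 `^ be * (p ^+ j * (1 / 2) ^+ j).
    rewrite -exprMn mul1r -pb -rX -powRM//; last exact: ltW.
    apply: ge0_ler_powR => //; first by rewrite (le_trans _ (ltW albe))// ltW.
    by rewrite nnegrE Ap.
    by rewrite nnegrE mulr_ge0// ltW.
  have h3 : A (k_ j.+1) `^ al <= (A0 * r ^+ j.+1) `^ al.
    rewrite powRM ?exprn_ge0//; [|exact: ltW|exact: ltW]. 
    rewrite rX -/p exprS -(ler_pM2l hj).
    apply: le_trans h _; apply: le_trans (ler_wpM2l C0 h2) _.
    have -> : C * (A0 `^ be * (p ^+ j * (1 / 2) ^+ j)) =
        2 * C * A0 `^ be * (p ^+ j * (1 / 2) ^+ j / 2) by field.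
    have -> : K * (1 / 2) ^+ j / 2 * (A0 `^ al * (p * p ^+ j)) =
        K * (A0 `^ al * p) * (p ^+ j * (1 / 2) ^+ j / 2) by field.
    rewrite ler_wpM2r// divr_ge0// mulr_ge0// exprn_ge0//; exact: ltW.
  rewrite leNgt; apply/negP => lt.
  have := gt0_ltr_powR al0 _ _ lt; rewrite !nnegrE.
  rewrite ltNge h3 => hh; suff : false by []; apply: hh => //.
  by rewrite mulr_ge0 ?exprn_ge0// ltW.
apply/eqP; rewrite eq_le Ap andbT.
have c : A0 * r ^+ j @[j --> \oo] --> A0 * 0.
  by apply: cvgMl_tmp; apply: cvg_expr; rewrite ger0_norm// ltW.
rewrite mulr0 in c; apply: (cvgr_to_ge c); apply: nearW => j.
by apply: le_trans (claim j); exact: Am.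
Qed.

Lemma mean_value_ge (g g' : R -> R) (l s t : R) : (forall x : R, is_derive x 1 g (g' x)) ->
  s <= t -> (forall x, s <= x <= t -> l <= g' x) -> l * (t - s) <= g t - g s.
Proof.
move=> dg st gl.
have cg : continuous g.
  move=> x; apply: differentiable_continuous.
  by apply/derivable1_diffP; have [] := dg x.
have [c] := MVT_segment st (fun x _ => dg x) (continuous_subspaceT cg).
by rewrite in_itv/= => cst ->; rewrite ler_wpM2r ?subr_ge0// gl.
Qed.

(** A C^1 version of t |-> min (h - k) (max 0 (t - k)). Its derivative is a
    tent on the interval from k to h, equal to at least 1/2 on the middle
    half; hence the lower bound (h - k) / 4 beyond h. *)
Lemma truncation (k h : R) : 0 <= k -> k < h -> exists g g' : R -> R,
  [/\ forall t : R, is_derive t 1 g (g' t), continuous g',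
      forall t, 0 <= g' t <= 1, forall t, t <= k -> g t = 0 /\ g' t = 0 &
      (forall t, 0 <= g t <= h - k) /\ forall t, h <= t -> (h - k) / 4 <= g t].
Proof.
move=> k0 kh; pose d := (h - k) / 2; have d0 : 0 < d by rewrite divr_gt0// subr_gt0.
pose g' (t : R) : R := Num.max 0 (Num.min ((t - k) / d) ((h - t) / d)).
have cg' : continuous g'.
  have c1 : continuous (fun t : R => (t - k) / d).
    by move=> t; apply: cvgMr_tmp; apply: cvgB; [exact: cvg_id|exact: cvg_cst].
  have c2 : continuous (fun t : R => (h - t) / d).
    by move=> t; apply: cvgMr_tmp; apply: cvgB; [exact: cvg_cst|exact: cvg_id].
  have E : g' = ((fun=> 0 : R^o) \max ((fun t => (t - k) / d) \min (fun t => (h - t) / d)) : R -> R^o).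
    by [].
  move=> t; rewrite E; apply: continuous_max; first exact: cst_continuous.
  by apply: continuous_min; [exact: c1|exact: c2].
pose g := primitive g'.
have dg (t : R) : is_derive t 1 g (g' t) by exact: is_derive_primitive.
have g'0 (t : R) : 0 <= g' t by rewrite le_max lexx.
have g'1 (t : R) : g' t <= 1.
  rewrite ge_max ler01/= ge_min !ler_pdivrMr// !mul1r.
  by apply/orP; have [?|x] := leP (t - k) d; [left|right; rewrite /d in x *; lra].
have g'k (t : R) : t <= k -> g' t = 0.
  move=> tk; apply/max_idPl; rewrite ge_min ler_pdivrMr// mul0r.
  by rewrite subr_le0 tk.
have g'h (t : R) : h <= t -> g' t = 0.
  move=> tk; apply/max_idPl; rewrite ge_min orbC ler_pdivrMr// mul0r.
  by rewrite subr_le0 tk.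
have gk (t : R) : t <= k -> g t = 0.
  move=> tk; have e0 : g 0 = 0 by exact: primitive0.
  apply/eqP; rewrite -e0 -subr_eq0 -normr_le0 -[leRHS](mul0r `|t - 0|).
  apply: (mean_value_bound dg) => x /andP[_]; rewrite le_max => xm.
  by rewrite g'k ?normr0//; case/orP: xm => /le_trans; apply.
have gmono (s t : R) : s <= t -> g s <= g t.
  by move=> st; rewrite -subr_ge0 -(mul0r (t - s)); exact: (mean_value_ge dg st).
have gle (s t : R) : s <= t -> g t - g s <= t - s.
  move=> st; apply: le_trans (ler_norm _) _.
  rewrite -[leRHS]mul1r -[t - s]ger0_norm ?subr_ge0//.
  by apply: (mean_value_bound dg) => x _; rewrite ger0_norm.
have g0 (t : R) : 0 <= g t.
  have [tk|kt] := leP t k; first by rewrite gk.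
  by rewrite -(gk k (lexx _)) gmono// ltW.
have ghh (t : R) : h <= t -> g t = g h.
  move=> ht; apply/eqP; rewrite -subr_eq0 -normr_le0 -[leRHS](mul0r `|t - h|).
  apply: (mean_value_bound dg) => x /andP[+ _]; rewrite ge_min => xm.
  by rewrite g'h ?normr0//; case/orP: xm => // /(le_trans ht).
exists g, g'; split => //; [by move=> t; rewrite g'0 g'1|by move=> t tk; rewrite gk// g'k|].
split.
  move=> t; rewrite g0/=; have [th|/ltW ht] := leP t h.
    apply: le_trans (gmono _ _ th) _; rewrite -[g h]subr0 -(gk k (lexx _)).
    by apply: gle; exact: ltW.
  by rewrite ghh// -[g h]subr0 -(gk k (lexx _)) gle// ltW.
move=> t ht; rewrite ghh//.
have h1 : 1 / 2 * (h - d / 2 - (k + d / 2)) <= g (h - d / 2) - g (k + d / 2).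
  apply: (mean_value_ge dg); first by rewrite /d in d0 *; lra.
  move=> x /andP[x1 x2]; rewrite /g' le_max; apply/orP; right.
  by rewrite le_min !ler_pdivlMr//; apply/andP; split; rewrite /d in d0 x1 x2 *; lra.
have h2 := gmono (h - d / 2) h; have h3 := g0 (k + d / 2).
have {}h2 : g (h - d / 2) <= g h by apply: h2; rewrite /d in d0 *; lra.
rewrite /d in h1 h2 h3 *; lra.
Qed.

Lemma powR_cvg (c_ : nat -> R) (c p : R) : 1 <= p -> (forall k, 0 <= c_ k) ->
  c_ k @[k --> \oo] --> c -> c_ k `^ p @[k --> \oo] --> c `^ p.
Proof.
move=> p1 c_0 cc; have c0 : 0 <= c by apply: (cvgr_to_ge cc); exact: nearW.
have [c00|cn0] := eqVneq c 0.
  rewrite c00 powR0; last by rewrite gt_eqF// (lt_le_trans _ p1).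
  rewrite c00 in cc; apply: (squeeze_cvgr _ (cvg_cst 0) cc).
  have /cvgrPdist_lt /(_ 1 ltr01) := cc; apply: filterS => k.
  rewrite distrC subr0 ger0_norm// powR_ge0/= => ck1.
  have := c_0 k; rewrite le_eqVlt => /predU1P[<-|ck0].
    by rewrite powR0// gt_eqF// (lt_le_trans _ p1).
  by apply: ge1r_powR => //; rewrite ck0 ltW.
have cp : {for c, continuous (@powR R ^~ p)}; last exact: (cvg_comp _ _ cc cp).
apply: differentiable_continuous; apply/derivable1_diffP.
by apply: derivable_powR; rewrite in_itv/= andbT lt_neqAle eq_sym cn0.
Qed.

End stampacchia_iteration.

Section stampacchia.
Context {R : realType} {n : nat} (Omega : set 'rV[R]_n.+2).
Context (oO : open Omega) (bO : bounded_set Omega).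
Local Notation mu := (@lebesgue_row R n.+2).
Local Notation sqint := (sqint mu Omega).
Local Notation ip := (ip mu Omega).
Local Notation nrm2 := (nrm2 mu Omega).
Local Notation rint := (rintegrable mu Omega).
Local Notation L2cvg := (L2cvg mu Omega).
Local Notation test := (test_function Omega).
Local Notation h10 := (h10 Omega).
Local Notation gip := (gip Omega).
Local Notation p := (1 + n.+1%:R^-1 : R).

Let mO : measurable Omega := open_measurable_row oO.
Let fO := bounded_finite_measure oO bO.

(** The Gagliardo-Nirenberg-Sobolev inequality passes to the limit by Fatou's
    lemma on the left-hand side and by L^1 convergence of the gradients on the
    right-hand side. *)
Lemma h10_sobolev w G : h10 w G ->
  (\int[mu]_(x in Omega) (`|w x| `^ p)%:E <=
   ((\int[mu]_(x in Omega) (\sum_i `|G i x|)) `^ p)%:E)%E.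
Proof.
move=> [sw sG [phi_ [tphi_ cw cG]]].
have sphi_ k := test_sqint oO bO (tphi_ k).
have spphi_ i k := test_partial_sqint oO bO i (tphi_ k).
have [s [hs aes]] := L2cvg_ae_subsequence mO fO sphi_ sw cw.
pose phi k := phi_ (s k).
have tphi k : test (phi k) by exact: tphi_.
have p1 : 1 <= p by rewrite lerDl invr_ge0.
have mpow (u : 'rV[R]_n.+2 -> R) : measurable_fun Omega u ->
    measurable_fun Omega (fun x => `|u x| `^ p).
  move=> mu1; apply: (measurableT_comp (measurable_powR p)); exact: measurableT_comp.
pose c_ k := \int[mu]_(x in Omega) grad1 (phi k) x.
have sn1 i k : rint (fun x => `|partial i (phi k) x|).
  exact/rintegrable_norm/(sqint_rintegrable mO fO)/spphi_.
have sn2 i : rint (fun x => `|G i x|).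
  exact/rintegrable_norm/(sqint_rintegrable mO fO)/sG.
have igrad k : rint (grad1 (phi k)) by apply: rintegrable_sum => // i.
have iG : rint (fun x => \sum_i `|G i x|) by apply: rintegrable_sum => // i.
apply: (fatou_cvg mO (f_ := fun k x => `|phi k x| `^ p) (c_ := fun k => c_ k `^ p)).
- by move=> k; apply: mpow; exact: (test_measurable (tphi k)).
- by apply: mpow; have [] := sw.
- by move=> k x; exact: powR_ge0.
- by move=> x; exact: powR_ge0.
- apply: filterS aes => x h Ox; apply: powR_cvg => //; exact: (cvg_norm (h Ox)).
- move=> k; have [M Cphi] := test_C1c (tphi k).
  have p0 : p != 0 by rewrite gt_eqF// (lt_le_trans _ p1).
  have := gagliardo_nirenberg_sobolev Cphi.
  rewrite -(integral_Omega (Omega := Omega) (g := fun x => `|phi k x| `^ p)); last first.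
    by move=> x nx; rewrite (test_function_out (tphi k) nx) normr0 powR0.
  rewrite -(integral_Omega (Omega := Omega) (g := grad1 (phi k))); last first.
    move=> x nx; apply: big1 => i _.
    by rewrite (test_function_out (test_function_partial i (tphi k)) nx) normr0.
  by rewrite -(EFin_Rintegral mO (igrad k)) poweR_EFin.
- apply: powR_cvg => //.
    by move=> k; apply: Rintegral_ge0 => x _; exact: grad1_ge0.
  rewrite (Rintegral_sum mO)//.
  have h : \sum_i \int[mu]_(x in Omega) `|partial i (phi k) x| @[k --> \oo] -->
      \sum_i \int[mu]_(x in Omega) `|G i x|.
    apply: (cvg_bigsum (a_ := fun k i => \int[mu]_(x in Omega) `|partial i (phi k) x|)) => i.
    have sd k : sqint (fun x => partial i (phi k) x - G i x) by apply: sqintB => //; exact: spphi_.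
    have l := L2_L1_cvg mO fO sd (cvg_subsequence hs (cG i)).
    apply/subr_cvg0; apply: (squeeze0 _ l) => k.
    have i1 := sn1 i k; have i2 := sn2 i; have i3 := rintegrable_norm (sqint_rintegrable mO fO (sd k)).
    rewrite -(RintegralB mO i1 i2); have i4 := rintegrableB mO i1 i2.
    apply: le_trans (le_normr_Rintegral mO i4) _.
    apply: le_Rintegral => //.
    + exact: rintegrable_norm.
    + by move=> x _; exact: ler_dist_dist.
  apply: (eq_cvgn _ h) => k; rewrite /c_ -(Rintegral_sum mO)//.
Qed.

(** f is only integrable here, and the psi_k converge almost everywhere and
    boundedly, so the right-hand side is a case of dominated convergence. *)
Lemma weak_equation_bounded (f w z : 'rV[R]_n.+2 -> R) G H (B : R)
    (psi_ : nat -> 'rV[R]_n.+2 -> R) : rint f -> h10 w G ->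
  (forall psi, test psi -> gip G (grads psi) = \int[mu]_(x in Omega) (f x * psi x)) ->
  (forall k, test (psi_ k)) -> (forall i, sqint (H i)) ->
  (forall i, L2cvg (fun k => partial i (psi_ k)) (H i)) ->
  measurable_fun Omega z ->
  {ae mu, forall x, Omega x -> psi_ k x @[k --> \oo] --> z x} ->
  (forall k x, `|psi_ k x| <= B) ->
  gip G H = \int[mu]_(x in Omega) (f x * z x).
Proof.
move=> jf [sw sG _] eqf tpsi sH cH mz ae_z psiB.
have mf : measurable_fun Omega f := rintegrable_measurable jf.
have [_ c1] : rint (fun x => f x * z x) /\ \int[mu]_(x in Omega) (f x * psi_ k x)
    @[k --> \oo] --> \int[mu]_(x in Omega) (f x * z x).
  apply: (dominated_cvg_real mO (g := fun x => B * `|f x|)).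
  - by move=> k; apply: measurable_funM => //; exact: test_measurable.
  - exact: measurable_funM.
  - exact/rintegrableZ/rintegrable_norm.
  - by apply: filterS ae_z => x h Ox; apply: cvgMl_tmp; exact: h.
  - by move=> k x _; rewrite normrM mulrC ler_wpM2r.
have c2 : gip G (grads (psi_ k)) @[k --> \oo] --> gip G H.
  have gC A B' : gip A B' = gip B' A by apply: eq_bigr => i _; exact: ipC.
  rewrite gC.
  have h : gip (grads (psi_ k)) G @[k --> \oo] --> gip H G.
    by apply: gip_cvg => // k i; exact: (test_partial_sqint oO bO).
  by apply: (eq_cvgn _ h) => k; rewrite gC.
have {}c1 : gip G (grads (psi_ k)) @[k --> \oo] --> \int[mu]_(x in Omega) (f x * z x).
  by apply: (eq_cvgn _ c1) => k; rewrite eqf.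
exact: (cvg_unique _ c2 c1).
Qed.

Definition superlevel (w : 'rV[R]_n.+2 -> R) k := Omega `&` [set x | k < w x].

Lemma measurable_superlevel w k : measurable_fun Omega w -> measurable (superlevel w k).
Proof.
move=> mw; have := mw mO `]k, +oo[%classic (measurable_itv _).
by congr measurable; apply/seteqP; split => x [Ox /= h]; split => //=; move: h;
  rewrite in_itv/= andbT.
Qed.

Lemma superlevel_fin w k : measurable_fun Omega w -> (mu (superlevel w k) < +oo)%E.
Proof.
move=> mw; apply: le_lt_trans fO; apply: le_measure; rewrite ?inE//.
  exact: measurable_superlevel.
by move=> x [].
Qed.

Lemma Rintegral_mul_indic A (v : 'rV[R]_n.+2 -> R) : A `<=` Omega ->
  \int[mu]_(x in Omega) (v x * \1_A x) = \int[mu]_(x in A) v x.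
Proof.
move=> AO; rewrite -[A in RHS](setIidr AO) Rintegral_mkcondr.
apply: eq_Rintegral => x _; rewrite indicE patchE.
by case: (_ \in _); rewrite ?mulr1 ?mulr0.
Qed.

(** Test the equation with the truncation g (w), where g lives between the
    levels k and h. The right-hand side is at most (h - k) times the integral
    of |f| over the set where w > k. The left-hand side bounds the integral of
    (g' (w) |G|)^2, hence, by Cauchy-Schwarz on the same set, the L^1 norm of
    the gradient of g (w), and by Sobolev's inequality the L^p norm of g (w),
    which is at least (h - k) / 4 on the set where w > h. *)
Lemma stampacchia_step (f w : 'rV[R]_n.+2 -> R) G (F th k h : R) : 0 <= F -> 0 <= th ->
  rint f ->
  (forall A, measurable A -> A `<=` Omega ->
     \int[mu]_(x in A) `|f x| <= F * fine (mu A) `^ th) ->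
  h10 w G ->
  (forall psi, test psi -> gip G (grads psi) = \int[mu]_(x in Omega) (f x * psi x)) ->
  0 <= k -> k < h ->
  (h - k) * fine (mu (superlevel w h)) `^ (2 / p) <=
  16 * n.+2%:R ^+ 2 * F * fine (mu (superlevel w k)) `^ (1 + th).
Proof.
move=> F0 th0 jf hF hw eqf k0 kh.
have pow1 (a : R) : 0 <= a -> a * a `^ th = a `^ (1 + th).
  move=> a0; rewrite powRD ?powRr1//; apply/implyP => /eqP e; move: e th0; lra.
have [sw sG _] := hw.
have mw : measurable_fun Omega w by have [] := sw.
have mf : measurable_fun Omega f := rintegrable_measurable jf.
have [g [g' [dg cg' g'01 gk [gb gh]]]] := truncation k0 kh.
have g0 : g 0 = 0 by have [] := gk 0 k0.
have g'1 t : `|g' t| <= 1 by have /andP[a b] := g'01 t; rewrite ger0_norm.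
have [sgw sgG [psi_ [tpsi cpsi cpsi' ae_psi bpsi]]] := h10_comp oO bO hw dg cg' g'1 g0.
have hgw : h10 (fun x => g (w x)) (fun i x => g' (w x) * G i x).
  by split => //; exists psi_; split.
pose Ek := superlevel w k; have mEk : measurable Ek by exact: measurable_superlevel.
pose Eh := superlevel w h; have mEh : measurable Eh by exact: measurable_superlevel.
pose ak := fine (mu Ek); pose ah := fine (mu Eh).
have ak0 : 0 <= ak by exact: fine_ge0.
have ah0 : 0 <= ah by exact: fine_ge0.
have hk0 : 0 < h - k by rewrite subr_gt0.
pose H i x := g' (w x) * G i x.
have eqH : gip G H = \int[mu]_(x in Omega) (f x * g (w x)).
  apply: (@weak_equation_bounded f w _ G H (h - k + 1) psi_) => //; first by case: sgw.
  by apply: bpsi => t; have /andP[a b] := gb t; rewrite ger0_norm.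
have E1 : gip G H <= (h - k) * (F * ak `^ th).
  rewrite eqH; apply: (@le_trans _ _ (\int[mu]_(x in Omega) ((h - k) * (`|f x| * \1_Ek x)))).
    have iE : rint (fun x => `|f x| * \1_Ek x).
      apply: (rintegrable_le mO (v := fun x => `|f x|)).
      - apply: measurable_funM; first exact: measurableT_comp.
        exact: measurable_indic.
      - exact: rintegrable_norm.
      - move=> x _; rewrite indicE; case: (_ \in _); rewrite ?mulr1 ?mulr0 ?normr_id//.
        by rewrite normr0.
    apply: le_Rintegral => //.
    - apply: (rintegrable_le mO (v := fun x => (h - k) * `|f x|)).
      + by apply: measurable_funM => //; case: sgw.
      + exact/rintegrableZ/rintegrable_norm.
      + move=> x _; rewrite normrM mulrC ler_wpM2r//.
        by have /andP[a b] := gb (w x); rewrite ger0_norm.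
    - exact: rintegrableZ.
    - move=> x Ox; rewrite indicE; case: (boolP (_ \in _)) => [_|].
        rewrite mulr1; apply: le_trans (ler_norm _) _; rewrite normrM mulrC ler_wpM2r//.
        by have /andP[a b] := gb (w x); rewrite ger0_norm.
      rewrite notin_setE => nE; have [|-> _] := gk (w x); last by rewrite !mulr0.
      by rewrite leNgt; apply/negP => kw; apply: nE.
  rewrite (@eq_Rintegral _ _ _ mu Omega (fun x => (h - k) * `|f x| * \1_Ek x)); last first.
    by move=> x _; rewrite mulrA.
  rewrite Rintegral_mul_indic; last by move=> x [].
  rewrite RintegralZl//; last first.
    by apply: (integrableS mO) => //; [move=> x []|exact: rintegrable_norm].
  by rewrite ler_pM2l//; apply: hF => // x [].
have ipge i : 0 <= ip (G i) (H i).
  apply: Rintegral_ge0 => x _; rewrite /H mulrCA mulr_ge0//.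
    by have /andP[] := g'01 (w x).
  by rewrite -expr2 sqr_ge0.
have E0 : 0 <= gip G H by exact: sumr_ge0.
(* 0 <= g' <= 1, so the square of g' is at most g'. *)
have nH i : nrm2 (H i) <= gip G H.
  apply: (@le_trans _ _ (ip (G i) (H i))).
    apply: le_Rintegral => //; first by have [] := sgG i.
      exact: (sqint_mul mO (sG i) (sgG i)).
    move=> x _; have /andP[b0 b1] := g'01 (w x); rewrite /H.
    have -> : (g' (w x) * G i x) ^+ 2 = g' (w x) * (g' (w x) * G i x ^+ 2) by ring.
    by rewrite [leRHS]mulrCA -[G i x * G i x]expr2 -[leRHS]mul1r ler_wpM2r// mulr_ge0// sqr_ge0.
  by rewrite /gip (bigD1 i)//= lerDl sumr_ge0.
have iH i : \int[mu]_(x in Omega) `|H i x| <= Num.sqrt ak * Num.sqrt (gip G H).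
  have s1 : sqint (\1_Ek : _ -> R).
    apply: (sqint_bounded mO fO (B := 1)); first exact: measurable_indic.
    by move=> x _; rewrite indicE; case: (_ \in _); rewrite ?normr1 ?normr0.
  have n1 : nrm2 (\1_Ek : _ -> R) = ak.
    rewrite /nrm2 (@eq_Rintegral _ _ _ mu Omega (fun x => 1 * \1_Ek x)); last first.
      by move=> x _; rewrite indicE; case: (_ \in _); rewrite ?expr1n ?mulr1// expr0n mulr0.
    by rewrite Rintegral_mul_indic ?Rintegral_cst ?mul1r// => x [].
  have := cauchy_schwarz_norm mO s1 (sqint_norm (sgG i)).
  rewrite n1 nrm2_norm => cs.
  apply: le_trans (ler_wpM2l (sqrtr_ge0 _) (ler_wsqrtr (nH i))).
  apply: le_trans cs; apply: le_trans (ler_norm _).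
  rewrite le_eqVlt; apply/orP; left; apply/eqP; apply: eq_Rintegral => x.
  rewrite inE => Ox; rewrite indicE; case: (boolP (_ \in _)); first by rewrite mul1r.
  rewrite notin_setE => nE; rewrite mul0r /H.
  have [|_ ->] := gk (w x); last by rewrite mul0r normr0.
  by rewrite leNgt; apply/negP => kw; apply: nE.
pose I := \int[mu]_(x in Omega) (\sum_i `|H i x|).
have I0 : 0 <= I by apply: Rintegral_ge0 => x _; exact: sumr_ge0.
have I1 : I <= n.+2%:R * (Num.sqrt ak * Num.sqrt (gip G H)).
  rewrite /I (Rintegral_sum mO); last first.
    by move=> i; exact/rintegrable_norm/(sqint_rintegrable mO fO)/sgG.
  rewrite mulr_natl -[X in _ *+ X](card_ord n.+2) -sumr_const.
  by apply: ler_sum => i _; exact: iH.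
have p1 : 1 <= p by rewrite lerDl invr_ge0.
have p0 : 0 < p by exact: lt_le_trans ltr01 p1.
pose c := (h - k) / 4; have c0 : 0 <= c by rewrite divr_ge0// ltW.
have low : c `^ p * ah <= I `^ p.
  rewrite -lee_fin; apply: le_trans (h10_sobolev hgw).
  have -> : ((c `^ p * ah)%:E = \int[mu]_(x in Omega) (c `^ p * \1_Eh x)%:E)%E.
    rewrite -(EFin_Rintegral mO); last first.
      apply: (rintegrable_bounded mO fO (B := c `^ p)).
        by apply: measurable_funM => //; exact: measurable_indic.
      move=> x _; rewrite indicE; case: (_ \in _); rewrite ?mulr1 ?mulr0 ?normr0 ?powR_ge0//.
      by rewrite ger0_norm ?powR_ge0.
    by rewrite Rintegral_mul_indic ?Rintegral_cst// => x [].
  apply: ge0_le_integral => //.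
  - by move=> x _; rewrite lee_fin mulr_ge0// powR_ge0.
  - apply/measurable_EFinP; apply: measurable_funM => //; exact: measurable_indic.
  - apply/measurable_EFinP; apply: (measurableT_comp (measurable_powR p)).
    by apply: measurableT_comp => //; case: sgw.
  - move=> x Ox; rewrite lee_fin indicE; case: (boolP (_ \in _)) => [|_].
      rewrite inE => -[_ /= hw']; rewrite mulr1; apply: ge0_ler_powR; rewrite ?nnegrE//.
      by apply: le_trans (ler_norm _); apply: gh; exact: ltW.
    by rewrite mulr0 powR_ge0.
(* Extract p-th roots; the factors h - k cancel after squaring. *)
have low1 : c * ah `^ p^-1 <= I.
  have := @ge0_ler_powR R p^-1 _ _ _ _ _ low.
  rewrite invr_ge0 (ltW p0) !nnegrE powR_ge0 mulr_ge0 ?powR_ge0//.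
  by rewrite powRM ?powR_ge0// -!powRrM mulfV ?gt_eqF// !powRr1//; apply.
have low2 : c ^+ 2 * ah `^ (2 / p) <= n.+2%:R ^+ 2 * ak * ((h - k) * (F * ak `^ th)).
  have -> : c ^+ 2 * ah `^ (2 / p) = (c * ah `^ p^-1) ^+ 2.
    have pw : (ah `^ p^-1) ^+ 2 = ah `^ (2 / p).
      by rewrite -powR_mulrn ?powR_ge0// -powRrM mulrC.
    by rewrite [RHS]exprMn pw.
  apply: (@le_trans _ _ (I ^+ 2)).
    by apply: lerXn2r; rewrite ?nnegrE// mulr_ge0// powR_ge0.
  apply: (@le_trans _ _ ((n.+2%:R * (Num.sqrt ak * Num.sqrt (gip G H))) ^+ 2)).
    by apply: lerXn2r; rewrite ?nnegrE// mulr_ge0// mulr_ge0// sqrtr_ge0.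
  have -> : (n.+2%:R * (Num.sqrt ak * Num.sqrt (gip G H))) ^+ 2 = n.+2%:R ^+ 2 * ak * gip G H.
    by rewrite exprMn exprMn (sqr_sqrtr ak0) (sqr_sqrtr E0) mulrA.
  apply: (ler_wpM2l _ E1); apply: (mulr_ge0 _ ak0); exact: sqr_ge0.
have key (a x y : R) : ((h - k) / 4) ^+ 2 * x <= n.+2%:R ^+ 2 * a * ((h - k) * (F * y)) ->
    (h - k) * x <= 16 * n.+2%:R ^+ 2 * F * (a * y).
  have -> : ((h - k) / 4) ^+ 2 * x = (h - k) * ((h - k) * x / 16) by field.
  have -> : n.+2%:R ^+ 2 * a * ((h - k) * (F * y)) =
     (h - k) * (n.+2%:R ^+ 2 * F * (a * y)) by ring.
  rewrite (ler_pM2l hk0) ler_pdivrMr// => l; apply: le_trans l _.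
  by rewrite le_eqVlt; apply/orP; left; apply/eqP; ring.
apply: le_trans (key _ _ _ low2) _.
by rewrite (pow1 ak ak0).
Qed.

Lemma h10_neg w G : h10 w G -> h10 (fun x => - w x) (fun i x => - G i x).
Proof.
move=> hw.
have d (t : R) : is_derive t 1 (fun t => - t) ((fun=> -1) t).
  by have := is_deriveN (is_derive_id t (1 : R)).
have [s1 s2 [psi_ [tp c1 c2 _ _]]] := h10_comp oO bO (L := 1) hw d (fun=> cvg_cst _)
  (fun=> ltac:(by rewrite normrN normr1)) (oppr0 _).
have E i : (fun x => -1 * G i x) = (fun x => - G i x).
  by apply/funext => x; rewrite mulN1r.
split => //; first by move=> i; rewrite -E.
by exists psi_; split => // i; rewrite -E.
Qed.

(** The exponents satisfy the hypothesis of Stampacchia's lemma because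
    2 / p < 1 + th. The bound K depends on f through F and th only, so that it
    is uniform over the truncations of f. *)
Lemma solution_le (F th : R) : 0 <= F -> 0 <= th -> 2 / p < 1 + th ->
  exists2 K : R, 0 < K & forall (f w : 'rV[R]_n.+2 -> R) G, rint f ->
  (forall A, measurable A -> A `<=` Omega ->
     \int[mu]_(x in A) `|f x| <= F * fine (mu A) `^ th) ->
  h10 w G ->
  (forall psi, test psi -> gip G (grads psi) = \int[mu]_(x in Omega) (f x * psi x)) ->
  {ae mu, forall x, Omega x -> w x <= K}.
Proof.
move=> F0 th0 hth.
have p0 : 0 < p by rewrite ltr_wpDr.
have C0 : 0 <= 16 * n.+2%:R ^+ 2 * F by rewrite !mulr_ge0.
have A0 : 0 < fine (mu Omega) + 1 by rewrite ltr_wpDl// fine_ge0.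
have [K K0 hK] := stampacchia_iteration (divr_gt0 (ltr0Sn _ _) p0) hth C0 A0.
exists K => // f w G jf hF hw eqf.
have mw : measurable_fun Omega w by case: hw => [[]].
have mS k := measurable_superlevel k mw.
have fS k : mu (superlevel w k) \is a fin_num.
  by rewrite (ge0_fin_numE (measure_ge0 _ _)); exact: superlevel_fin.
have z : fine (mu (superlevel w K)) = 0.
  apply: (hK (fun k => fine (mu (superlevel w k)))).
  - by move=> k; exact: fine_ge0.
  - move=> h k kh; apply: (fine_le (fS h) (fS k)).
    apply: le_measure; [by rewrite inE; exact: mS|by rewrite inE; exact: mS|].
    by move=> x [Ox /= hx]; split => //=; exact: le_lt_trans hx.
  - apply: (@le_trans _ _ (fine (mu Omega))); last by rewrite lerDl.
    have fOm : mu Omega \is a fin_num by rewrite (ge0_fin_numE (measure_ge0 _ _)).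
    apply: (fine_le (fS 0) fOm).
    by apply: le_measure; [by rewrite inE; exact: mS|by rewrite inE|move=> x []].
  - by move=> k h k0 kh; exact: (stampacchia_step F0 th0 jf hF hw eqf).
exists (superlevel w K); split => //; first by rewrite -(fineK (fS K)) z.
move=> x /= /not_implyP[Ox /negP]; rewrite -ltNge => Kw; by split.
Qed.

(** Apply the one-sided bound to w and to - w, the solution for - f. *)
Lemma solution_bounded (F th : R) : 0 <= F -> 0 <= th -> 2 / p < 1 + th ->
  exists2 K : R, 0 < K & forall (f w : 'rV[R]_n.+2 -> R) G, rint f ->
  (forall A, measurable A -> A `<=` Omega ->
     \int[mu]_(x in A) `|f x| <= F * fine (mu A) `^ th) ->
  h10 w G ->
  (forall psi, test psi -> gip G (grads psi) = \int[mu]_(x in Omega) (f x * psi x)) ->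
  {ae mu, forall x, Omega x -> `|w x| <= K}.
Proof.
move=> F0 th0 hth; have [K K0 hK] := solution_le F0 th0 hth; exists K => // f w G jf hF hw eqf.
have h1 := hK f w G jf hF hw eqf.
have h2 : {ae mu, forall x, Omega x -> - w x <= K}.
  apply: (hK (fun x => - f x) _ (fun i x => - G i x)).
  - have := rintegrableZ mO (-1) jf; congr rint.
    by apply/funext => x; rewrite mulN1r.
  - move=> A mA AO; under eq_Rintegral do rewrite normrN; exact: hF.
  - exact: h10_neg.
  - move=> psi tpsi.
    have jfp : rint (fun x => f x * psi x).
      have [B hB] := test_bounded tpsi.
      apply: (rintegrable_le mO (v := fun x => B * `|f x|)).
      + by apply: measurable_funM; [exact: rintegrable_measurable jf|exact: test_measurable].
      + exact/rintegrableZ/rintegrable_norm.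
      + by move=> x _; rewrite normrM mulrC ler_wpM2r.
    have -> : \int[mu]_(x in Omega) (- f x * psi x) = - gip G (grads psi).
      rewrite eqf// -mulN1r -RintegralZl//; apply: eq_Rintegral => x _.
      by rewrite mulN1r mulNr.
    rewrite /gip -sumrN; apply: eq_bigr => i _.
    have [_ sG _] := hw.
    rewrite -mulN1r -(ipZl mO) //; last exact: (test_partial_sqint oO bO).
    by apply: eq_Rintegral => x _; rewrite mulN1r.
apply: filterS2 h1 h2 => x a b Ox; rewrite ler_norml a// andbT lerNl; exact: b.
Qed.

End stampacchia.

(** * The right-hand side as an element of the dual of H^1_0 *)

Section smooth_abs.
Context {R : realType}.

(** The square root of t^2 + e^2 lies between |t| and |t| + e. *)
Lemma smooth_abs (e : R) : 0 < e -> exists g g' : R -> R,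
  [/\ forall t : R, is_derive t 1 g (g' t), continuous g', forall t, `|g' t| <= 1,
      g 0 = 0 & forall t, `|t| - e <= g t].
Proof.
move=> e0; pose q (t : R) : R := Num.sqrt (t ^+ 2 + e ^+ 2).
have s0 (t : R) : 0 < t ^+ 2 + e ^+ 2 by rewrite ltr_wpDl ?sqr_ge0// exprn_gt0.
have q0 t : 0 < q t by rewrite sqrtr_gt0.
have tq t : `|t| <= q t.
  by rewrite -sqrtr_sqr ler_wsqrtr// lerDl sqr_ge0.
have dq (t : R) : is_derive t 1 q (t / q t).
  have d1 : is_derive t 1 (fun t : R => t ^+ 2 + e ^+ 2) (t *+ 2).
    have -> : (fun t : R => t ^+ 2 + e ^+ 2) = horner ('X^2 + (e ^+ 2)%:P).
      by apply/funext => s; rewrite hornerD hornerXn hornerC.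
    have := is_derive_poly ('X^2 + (e ^+ 2)%:P) t.
    by rewrite derivD derivC derivXn addr0 hornerMn hornerXn.
  have -> : t / q t = (2 * q t)^-1 * (t *+ 2).
    by have := q0 t; move: (q t) => y y0; field; rewrite gt_eqF.
  exact: (@is_derive_comp1 _ _ Num.sqrt _ t 1 _ _ (is_derive1_sqrt (s0 t)) d1).
have cq : continuous q.
  move=> t; apply: differentiable_continuous.
  by apply/derivable1_diffP; have [] := dq t.
exists (fun t => q t - e), (fun t => t / q t); split.
- move=> t; have := is_deriveB (dq t) (is_derive_cst e t (1 : R)).
  by rewrite subr0.
- by move=> t; apply: cvgM; [exact: cvg_id|apply: cvgV; [rewrite gt_eqF|exact: cq]].
- by move=> t; rewrite normrM normfV (ger0_norm (ltW (q0 t))) ler_pdivrMr// mul1r.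
- by rewrite /q expr0n add0r sqrtr_sqr ger0_norm ?subrr// ltW.
- by move=> t; rewrite lerD2r.
Qed.

End smooth_abs.

Lemma Rintegral_ae_le d (T : measurableType d) (R : realType)
    (mu : {measure set T -> \bar R}) (D : set T) (u v : T -> R) : measurable D ->
  rintegrable mu D u -> rintegrable mu D v ->
  {ae mu, forall x, D x -> u x <= v x} ->
  \int[mu]_(x in D) u x <= \int[mu]_(x in D) v x.
Proof.
move=> mD iu iv uv; rewrite -subr_ge0 -RintegralB//.
have i1 := rintegrableB mD iv iu.
have -> : \int[mu]_(x in D) (v x - u x) = \int[mu]_(x in D) `|v x - u x|.
  congr fine; apply: ae_eq_integral => //.
  - exact/measurable_EFinP/(rintegrable_measurable i1).
  - exact/measurable_EFinP/(rintegrable_measurable (rintegrable_norm i1)).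
  - by apply: filterS uv => x h Dx; rewrite ger0_norm// subr_ge0 h.
exact: Rintegral_ge0.
Qed.

Section dual.
Context {R : realType} {n : nat} (Omega : set 'rV[R]_n.+2).
Context (oO : open Omega) (bO : bounded_set Omega).
Local Notation mu := (@lebesgue_row R n.+2).
Local Notation sqint := (sqint mu Omega).
Local Notation ip := (ip mu Omega).
Local Notation nrm2 := (nrm2 mu Omega).
Local Notation rint := (rintegrable mu Omega).
Local Notation L2cvg := (L2cvg mu Omega).
Local Notation test := (test_function Omega).
Local Notation h10 := (h10 Omega).
Local Notation gip := (gip Omega).
Local Notation dirichlet := (dirichlet Omega).
Local Notation p := (1 + n.+1%:R^-1 : R).

Let mO : measurable Omega := open_measurable_row oO.
Let fO := bounded_finite_measure oO bO.

(** For a datum in L^2 Poincare's inequality makes phi |-> integral of v phi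
    continuous for the Dirichlet norm. *)
Lemma sqint_riesz v : sqint v -> exists w G, h10 w G /\
  forall phi, test phi -> gip G (grads phi) = \int[mu]_(x in Omega) (v x * phi x).
Proof.
move=> sv; have [C C0 hC] := poincare oO bO.
apply: (riesz_representation oO bO (C := nrm2 v * C)).
- by rewrite mulr_ge0 ?nrm2_ge0// ltW.
- move=> phi psi c tp tq; have sp := test_sqint oO bO tp; have sq := test_sqint oO bO tq.
  rewrite -/(ip v _) ipC (ipDl mO sp (sqintZ mO c sq) sv) (ipZl mO c sq sv).
  by rewrite [ip phi v]ipC [ip psi v]ipC.
- move=> phi tp; rewrite -/(ip v _).
  apply: le_trans (cauchy_schwarz mO sv (test_sqint oO bO tp)) _.
  by rewrite -mulrA ler_wpM2l ?nrm2_ge0// hC.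
Qed.

Lemma weak_equation_h10 v w G z H : sqint v -> h10 w G ->
  (forall phi, test phi -> gip G (grads phi) = \int[mu]_(x in Omega) (v x * phi x)) ->
  h10 z H -> gip G H = ip v z.
Proof.
move=> sv [sw sG _] eqv [sz sH [psi_ [tpsi cz cH]]].
have spsi k := test_sqint oO bO (tpsi k).
have sppsi k i := test_partial_sqint oO bO i (tpsi k).
have c1 : ip (psi_ k) v @[k --> \oo] --> ip z v by exact: (ip_cvg mO).
have c2 : gip (grads (psi_ k)) G @[k --> \oo] --> gip H G by apply: gip_cvg.
have gC A B' : gip A B' = gip B' A by apply: eq_bigr => i _; exact: ipC.
rewrite gC ipC.
have {}c2 : ip (psi_ k) v @[k --> \oo] --> gip H G.
  by apply: (eq_cvgn _ c2) => k; rewrite gC eqv// -/(ip v _) ipC.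
exact: (cvg_unique _ c2 c1).
Qed.

Context (f : 'rV[R]_n.+2 -> R) (F th : R) (jf : rint f).
Context (F0 : 0 <= F) (th0 : 0 <= th) (hth : 2 / p < 1 + th).
Context (hF : forall A, measurable A -> A `<=` Omega ->
     \int[mu]_(x in A) `|f x| <= F * fine (mu A) `^ th).

Let mf : measurable_fun Omega f := rintegrable_measurable jf.
Let L := \int[mu]_(x in Omega) `|f x|.
Let L0 : 0 <= L. Proof. exact: Rintegral_ge0. Qed.

Let f_ (j : nat) (x : 'rV[R]_n.+2) : R := Num.min `|f x| j%:R.

Let f_ge0 j x : 0 <= f_ j x. Proof. by rewrite le_min normr_ge0 ler0n. Qed.
Let f_le j x : f_ j x <= `|f x|. Proof. by rewrite ge_min lexx. Qed.
Let f_j j x : f_ j x <= j%:R. Proof. by rewrite ge_min lexx orbT. Qed.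

Let mf_ j : measurable_fun Omega (f_ j).
Proof. by apply: measurable_minr => //; exact: measurableT_comp. Qed.

Let sf_ j : sqint (f_ j).
Proof. by apply: (sqint_bounded mO fO (B := j%:R)) => // x _; rewrite ger0_norm. Qed.

Let jf_ j : rint (f_ j). Proof. exact: (sqint_rintegrable mO fO (sf_ j)). Qed.

Let If_ j : \int[mu]_(x in Omega) f_ j x <= L.
Proof. by apply: (le_Rintegral mO (jf_ j) (rintegrable_norm jf)). Qed.

(** Multiplication by |f| belongs to the dual of H^1_0. This is obtained from
    the boundedness of solutions rather than from an embedding of H^1_0. Let
    f_j = min |f| j and let w_j solve the equation for f_j. The w_j are
    bounded by a constant K that does not depend on j, so their energies, the
    integrals of f_j w_j, are at most K times the integral of |f|. Testing the
    equation for w_j with a C^1 version of |phi| bounds the integral of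
    f_j |phi| by the product of the energy norms of w_j and phi, uniformly in
    j. *)
Lemma integral_mul_test_le : exists2 C : R, 0 <= C & forall phi, test phi ->
  \int[mu]_(x in Omega) (`|f x| * `|phi x|) <= C * Num.sqrt (dirichlet phi).
Proof.
have [K K0 hK] := solution_bounded oO bO F0 th0 hth.
exists (n.+2%:R * Num.sqrt (K * L)); first by rewrite mulr_ge0 ?sqrtr_ge0.
move=> phi tphi; have [B hB] := test_bounded tphi.
have sphi := test_sqint oO bO tphi.
have hj j : \int[mu]_(x in Omega) (f_ j x * `|phi x|) <=
    n.+2%:R * Num.sqrt (K * L) * Num.sqrt (dirichlet phi).
  have [w [G [hw eqw]]] := sqint_riesz (sf_ j).
  have [sw sG _] := hw.
  have wK : {ae mu, forall x, Omega x -> `|w x| <= K}.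
    apply: (hK (f_ j) w G) => // A mA AO; apply: le_trans (hF mA AO).
    have iA : mu.-integrable A (EFin \o f) by exact: (integrableS mO mA AO).
    have iAj : mu.-integrable A (EFin \o f_ j) by exact: (integrableS mO mA AO (jf_ j)).
    apply: le_Rintegral => //; [exact: rintegrable_norm|exact: rintegrable_norm|].
    by move=> x _; rewrite ger0_norm.
  have energy : gip G G <= K * L.
    rewrite (weak_equation_h10 (sf_ j) hw eqw hw).
    apply: (@le_trans _ _ (\int[mu]_(x in Omega) (K * f_ j x))).
      apply: Rintegral_ae_le => //.
      + exact: (sqint_mul mO (sf_ j) sw).
      + exact: rintegrableZ.
      + apply: filterS wK => x h Ox; rewrite mulrC ler_wpM2r//.
        by apply: le_trans (h Ox); exact: ler_norm.
    by rewrite (RintegralZl K mO (jf_ j)) ler_wpM2l// ltW.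
  apply/ler_addgt0Pr => e e0.
  have e1 : 0 < e / (L + 1) by rewrite divr_gt0// ltr_wpDl.
  have [g [g' [dg cg' g'1 g0 gabs]]] := smooth_abs e1.
  have [sz sH [psi_ [tp c1 c2 _ _]]] := h10_comp oO bO (h10_test oO bO tphi) dg cg' g'1 g0.
  have hz : h10 (fun x => g (phi x)) (fun i x => g' (phi x) * partial i phi x).
    by split => //; exists psi_; split.
  have eqz := weak_equation_h10 (sf_ j) hw eqw hz.
  have low : \int[mu]_(x in Omega) (f_ j x * `|phi x|) - e <= ip (f_ j) (fun x => g (phi x)).
    have i1 : rint (fun x => f_ j x * `|phi x|) by exact: (sqint_mul mO (sf_ j) (sqint_norm sphi)).
    have i2 : rint (fun x => e / (L + 1) * f_ j x) by exact: rintegrableZ.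
    have h1 : e / (L + 1) * \int[mu]_(x in Omega) f_ j x <= e.
      have h : e / (L + 1) * \int[mu]_(x in Omega) f_ j x <= e / (L + 1) * (L + 1).
        by rewrite ler_pM2l// (le_trans (If_ j))// lerDl.
      by apply: le_trans h _; rewrite divfK// gt_eqF// ltr_wpDl.
    apply: (@le_trans _ _ (\int[mu]_(x in Omega) (f_ j x * `|phi x| - e / (L + 1) * f_ j x))).
      by rewrite (RintegralB mO i1 i2) (RintegralZl _ mO (jf_ j)) lerB.
    apply: le_Rintegral => //; first exact: rintegrableB.
      exact: (sqint_mul mO (sf_ j) sz).
    by move=> x _; rewrite [_ * f_ j x]mulrC -mulrBr ler_wpM2l.
  have up : gip G (fun i x => g' (phi x) * partial i phi x) <=
      n.+2%:R * Num.sqrt (K * L) * Num.sqrt (dirichlet phi).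
    apply: le_trans (ler_norm _) _; apply: le_trans (gip_cauchy_schwarz oO sG sH) _.
    rewrite -mulrA ler_wpM2l// ler_pM ?sqrtr_ge0// ler_wsqrtr//.
    rewrite /dirichlet !gip_nrm2; apply: ler_sum => i _.
    apply: (nrm2_le oO (proj1 (sH i)) (test_partial_sqint oO bO i tphi)) => x _.
    by rewrite normrM -[leRHS]mul1r ler_wpM2r.
  move: low up; rewrite -eqz.
  move: (gip _ _) (\int[mu]_(x in Omega) _) (_ * Num.sqrt (dirichlet _)) => a b c; lra.
have [_ c] : rint (fun x => `|f x| * `|phi x|) /\
    \int[mu]_(x in Omega) (f_ j x * `|phi x|) @[j --> \oo] -->
    \int[mu]_(x in Omega) (`|f x| * `|phi x|).
  have mphi : measurable_fun Omega (fun x => `|phi x|).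
    by apply: measurableT_comp => //; exact: test_measurable.
  apply: (dominated_cvg_real mO (g := fun x => B * `|f x|)).
  - by move=> j; exact: measurable_funM.
  - by apply: measurable_funM => //; exact: measurableT_comp.
  - exact/rintegrableZ/rintegrable_norm.
  - apply: aeW => x Ox; apply: cvgMr_tmp; apply: cvg_near_cst.
    exists (Num.truncn `|f x|).+1 => //= j /= hj'; apply/min_idPl.
    apply: le_trans (_ : (Num.truncn `|f x|).+1%:R <= _); last by rewrite ler_nat.
    by apply: ltW; exact: truncnS_gt.
  - move=> j x _; rewrite normrM normr_id mulrC ler_pM//.
    by rewrite ger0_norm.
by apply: (cvgr_to_le c); exact: nearW.
Qed.

(** The solution w of the Poisson equation for f, from Riesz' theorem. Since
    |f| is in the dual of H^1_0, the equation extends from test functions to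
    the whole of H^1_0: for test functions phi_k tending to z, Fatou's lemma
    bounds the integral of |f| |phi_k - z| by the Dirichlet norm of phi_k - z. *)
Lemma linear_solution : exists w G (K : R), [/\ h10 w G, 0 < K,
  {ae mu, forall x, Omega x -> `|w x| <= K},
  forall phi, test phi -> gip G (grads phi) = \int[mu]_(x in Omega) (f x * phi x) &
  forall z H, h10 z H -> rint (fun x => f x * z x) /\
    gip G H = \int[mu]_(x in Omega) (f x * z x)].
Proof.
have [C C0 hC] := integral_mul_test_le.
have jft phi : test phi -> rint (fun x => f x * phi x).
  move=> tphi; have [B hB] := test_bounded tphi.
  apply: (rintegrable_le mO (v := fun x => B * `|f x|)).
  + by apply: measurable_funM => //; exact: test_measurable.
  + exact/rintegrableZ/rintegrable_norm.
  + by move=> x _; rewrite normrM mulrC ler_wpM2r.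
have dir0 phi : 0 <= dirichlet phi by exact: gip_ge0.
have [w [G [hw eqw]]] : exists w G, h10 w G /\
    forall phi, test phi -> gip G (grads phi) = \int[mu]_(x in Omega) (f x * phi x).
  apply: (riesz_representation oO bO (sqr_ge0 C)).
  - move=> phi psi c tp tq.
    have i1 := jft _ tp; have i2 := jft _ tq; have i3 := rintegrableZ mO c i2.
    rewrite -(RintegralZl c mO i2) -(RintegralD mO i1 i3).
    by apply: eq_Rintegral => x _; rewrite mulrDr mulrCA.
  - move=> phi tphi; rewrite -[dirichlet phi]sqr_sqrtr// -exprMn -real_normK ?num_real//.
    apply: lerXn2r; rewrite ?nnegrE ?mulr_ge0 ?sqrtr_ge0//.
    apply: le_trans (hC phi tphi); apply: le_trans (le_normr_Rintegral mO (jft _ tphi)) _.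
    by under eq_Rintegral do rewrite normrM.
have [sw sG _] := hw.
have [K K0 hK] := solution_bounded oO bO F0 th0 hth.
exists w, G, K; split => //; first exact: (hK f w G).
move=> z H [sz sH [phi_ [tphi_ cz cH]]].
have sphi_ k := test_sqint oO bO (tphi_ k).
have spphi_ k i := test_partial_sqint oO bO i (tphi_ k).
have [s [hs aes]] := L2cvg_ae_subsequence mO fO sphi_ sz cz.
pose phi k := phi_ (s k).
have tphi k : test (phi k) by exact: tphi_.
have sphi k := test_sqint oO bO (tphi k).
have spphi k i := test_partial_sqint oO bO i (tphi k).
have cH' i : L2cvg (fun k => partial i (phi k)) (H i) by exact: (cvg_subsequence hs (cH i)).
pose e k := \sum_i nrm2 (fun x => partial i (phi k) x - H i x).
have mz : measurable_fun Omega z by case: sz.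
have mphi k : measurable_fun Omega (phi k) by exact: (test_measurable (tphi k)).
have mdiff k : measurable_fun Omega (fun x => `|f x| * `|phi k x - z x|).
  apply: measurable_funM; first exact: measurableT_comp.
  by apply: measurableT_comp => //; exact: measurable_funB.
(* The bound for phi_k - phi_j, in the limit j --> oo. *)
have hk k : (\int[mu]_(x in Omega) (`|f x| * `|phi k x - z x|)%:E <=
    (C * Num.sqrt (e k))%:E)%E.
  pose ph j x := phi k x + (-1) * phi j x.
  have tph j : test (ph j) := test_function_add (tphi k) (test_function_scale (-1) (tphi j)).
  have phE j x : ph j x = phi k x - phi j x by rewrite /ph mulN1r.
  have iph j : rint (fun x => `|f x| * `|ph j x|).
    have := rintegrable_norm (jft _ (tph j)); congr rint.
    by apply/funext => x; rewrite normrM.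
  apply: (fatou_cvg mO (f_ := fun j x => `|f x| * `|ph j x|)
    (c_ := fun j => C * Num.sqrt (dirichlet (ph j)))) => //.
  - by move=> j; exact: rintegrable_measurable (iph j).
  - apply: filterS aes => x h Ox; apply: cvgMl_tmp.
    have h1 : phi k x - phi j x @[j --> \oo] --> phi k x - z x.
      by apply: cvgB; [exact: cvg_cst|exact: h].
    have h2 : `|phi k x - phi j x| @[j --> \oo] --> `|phi k x - z x| by exact: (cvg_norm h1).
    by apply: (eq_cvgn _ h2) => j; rewrite phE.
  - by move=> j; rewrite -(EFin_Rintegral mO (iph j)) lee_fin; exact: hC.
  - apply: cvgMl_tmp; have c1 : dirichlet (ph j) @[j --> \oo] --> e k.
      rewrite /e.
      apply: (@eq_cvgn _ (fun j => \sum_i nrm2 (grads (ph j) i))).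
        by move=> j; rewrite /dirichlet gip_nrm2.
      apply: (cvg_bigsum (a_ := fun j i => nrm2 (grads (ph j) i))) => i.
      have gE j : grads (ph j) i = fun x => partial i (phi k) x - partial i (phi j) x.
        apply/funext => x; rewrite /grads /ph.
        rewrite (partial_add i x (test_smooth (tphi k)) (smooth_scale (-1) (test_smooth (tphi j)))).
        by rewrite (partial_scale (-1) i x (test_smooth (tphi j))) mulN1r.
      apply: (nrm2_cvg mO) => //.
      + by move=> j; exact: (test_partial_sqint oO bO i (tph j)).
      + by apply: (sqintB mO); [exact: spphi|exact: sH].
      + apply: (eq_cvgn _ (cH' i)) => j; apply: eq_Rintegral => x _.
        by rewrite gE; ring.
    exact: (cvg_comp _ _ c1 (@sqrt_continuous _ _)).
have jd k : rint (fun x => f x * (phi k x - z x)).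
  apply/rintegrableP; split.
    by apply: measurable_funM => //; exact: measurable_funB.
  apply: le_lt_trans (ltry (C * Num.sqrt (e k))); apply: le_trans (hk k).
  by under eq_integral do rewrite normrM.
have jfz : rint (fun x => f x * z x).
  have := rintegrableB mO (jft _ (tphi 0)) (jd 0); congr rint.
  by apply/funext => x; ring.
split => //.
have e0 : e k @[k --> \oo] --> (0 : R).
  rewrite [X in _ --> X](_ : 0 = \sum_(i < n.+2) (0 : R)); last by rewrite big1.
  by apply: (cvg_bigsum (a_ := fun k i => nrm2 (fun x => partial i (phi k) x - H i x))).
have c1 : \int[mu]_(x in Omega) (f x * phi k x) @[k --> \oo] -->
    \int[mu]_(x in Omega) (f x * z x).
  apply/subr_cvg0; apply: (squeeze0 (b_ := fun k => C * Num.sqrt (e k))); last first.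
    rewrite -[X in _ --> X](mulr0 C); apply: cvgMl_tmp; apply: cvg_sqrt0 => // k.
    by apply: sumr_ge0 => i _; exact: nrm2_ge0.
  move=> k; rewrite -(RintegralB mO (jft _ (tphi k)) jfz).
  rewrite -lee_fin; apply: le_trans (hk k).
  have -> : \int[mu]_(x in Omega) (f x * phi k x - f x * z x) =
      \int[mu]_(x in Omega) (f x * (phi k x - z x)).
    by apply: eq_Rintegral => x _; rewrite mulrBr.
  apply: (@le_trans _ _ (\int[mu]_(x in Omega) `|f x * (phi k x - z x)|)%:E).
    by rewrite lee_fin; exact: (le_normr_Rintegral mO (jd k)).
  rewrite (EFin_Rintegral mO (rintegrable_norm (jd k))).
  by under eq_integral do rewrite normrM.
have c2 : gip (grads (phi k)) G @[k --> \oo] --> gip H G by apply: gip_cvg.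
have gC A B' : gip A B' = gip B' A by apply: eq_bigr => i _; exact: ipC.
rewrite gC; have {}c2 : \int[mu]_(x in Omega) (f x * phi k x) @[k --> \oo] --> gip H G.
  by apply: (eq_cvgn _ c2) => k; rewrite gC eqw.
exact: (cvg_unique _ c2 c1).
Qed.

End dual.

(** * The change of unknown *)

Section change_of_unknown.
Context {R : realType} (a : R -> R -> R) (m1 : R) (m10 : 0 < m1).
Context (am1 : forall t r, m1 <= a t r).
Context (ca : continuous (fun p : R * R => a p.1 p.2)).
Local Notation leb := (@lebesgue_measure R).

Lemma coefficient_cvg (t_ r_ : nat -> R) (t r : R) :
  t_ k @[k --> \oo] --> t -> r_ k @[k --> \oo] --> r ->
  a (t_ k) (r_ k) @[k --> \oo] --> a t r.
Proof.
move=> ct cr; have h : (t_ k, r_ k) @[k --> \oo] --> (t, r).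
  exact: (@cvg_pair _ _ _ _ (nbhs t) (nbhs r) _ _ _ _ _ ct cr).
have c : a p.1 p.2 @[p --> (t, r)] --> a t r := @ca (t, r).
exact: (cvg_comp (fun k => (t_ k, r_ k)) (fun p => a p.1 p.2) h c).
Qed.

Lemma coefficient_continuous r : continuous (a ^~ r).
Proof.
move=> t; have h : (x, r) @[x --> t] --> (t, r).
  by apply: (@cvg_pair _ _ _ _ (nbhs t) (nbhs r)); [exact: cvg_id|exact: cvg_cst].
have c : a p.1 p.2 @[p --> (t, r)] --> a t r := @ca (t, r).
exact: (cvg_comp (fun x => (x, r)) (fun p => a p.1 p.2) h c).
Qed.

(** The r_k stay in a compact interval. *)
Lemma coefficient_bounded (r_ : nat -> R) (r A B : R) : r_ k @[k --> \oo] --> r ->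
  exists K : R, forall k t, A <= t <= B -> `|a t (r_ k)| <= K.
Proof.
move=> cr; have [M [_ hM]] := cvg_seq_bounded (cvgP _ cr).
have hr k : `|r_ k| <= M + 1 by apply: hM; rewrite ?ltrDl.
pose S : set (R * R) := `[A, B]%classic `*` `[- (M + 1), M + 1]%classic.
have cS : compact S by apply: compact_setX; exact: segment_compact.
have cT : compact ((fun p : R * R => a p.1 p.2) @` S).
  by apply: continuous_compact => //; apply: continuous_subspaceT.
have [K [_ hK]] := compact_bounded cT.
exists (K + 1) => k t tAB; apply: (hK (K + 1)); first by rewrite ltrDl.
exists (t, r_ k) => //; split; rewrite /= in_itv/=; first exact: tAB.
by rewrite -ler_norml.
Qed.

Local Notation M r := (primitive (a ^~ r)).

Let dM r (t : R) : is_derive t 1 (M r) (a t r).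
Proof. exact/is_derive_primitive/coefficient_continuous. Qed.

Let Mexp r s t : s <= t -> m1 * (t - s) <= M r t - M r s.
Proof. by move=> st; apply: (mean_value_ge (dM r) st) => x _. Qed.

(** The primitive has slope at least m1. *)
Lemma primitive_expansive r s t : m1 * `|t - s| <= `|M r t - M r s|.
Proof.
wlog st : s t / s <= t => [H|].
  have [st|ts] := leP s t; first exact: H.
  by rewrite distrC [leRHS]distrC; apply: H; exact: ltW.
rewrite ger0_norm ?subr_ge0//; apply: le_trans (ler_norm _); exact: Mexp.
Qed.

Lemma primitive_surjective r s : exists t, M r t = s.
Proof.
have cM : continuous (M r).
  move=> x; apply: differentiable_continuous.
  by apply/derivable1_diffP; have [] := dM r x.
pose b := `|s| / m1; have b0 : 0 <= b by rewrite divr_ge0// ltW.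
have mb : m1 * b = `|s| by rewrite /b mulrC divfK// gt_eqF.
have h1 := Mexp r b0; rewrite subr0 primitive0 subr0 mb in h1.
have bN : - b <= 0 by rewrite oppr_le0.
have h2 := Mexp r bN; rewrite primitive0 sub0r opprK mb sub0r lerNr in h2.
have bb : - b <= b by exact: le_trans bN b0.
have [] := @IVT R (M r) (- b) b s bb (continuous_subspaceT cM).
  rewrite ge_min le_max; apply/andP; split; apply/orP; [left|right].
    by apply: le_trans h2 _; rewrite lerNl -normrN ler_norm.
  by apply: le_trans h1; exact: ler_norm.
by move=> t _ <-; exists t.
Qed.

(** Dominated convergence on a bounded interval. *)
Lemma primitive_cvg_parameter (r_ : nat -> R) r t : r_ k @[k --> \oo] --> r ->
  M (r_ k) t @[k --> \oo] --> M r t.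
Proof.
move=> cr.
have key A B : A <= B -> \int[leb]_(x in `]A, B]) a x (r_ k) @[k --> \oo] -->
    \int[leb]_(x in `]A, B]) a x r.
  move=> AB; have [K hK] := coefficient_bounded A B cr.
  have mI : measurable (`]A, B]%classic : set R) by exact: measurable_itv.
  have fI : (leb (`]A, B]%classic : set R) < +oo)%E.
    by rewrite lebesgue_measure_itv/=; case: ifP => _; rewrite ltry.
  have mea r' : measurable_fun (`]A, B]%classic : set R) (a ^~ r').
    have mc := continuous_measurable_fun (@coefficient_continuous r').
    exact: measurable_funTS.
  suff [] : rintegrable leb `]A, B] (a ^~ r) /\ \int[leb]_(x in `]A, B]) a x (r_ k)
    @[k --> \oo] --> \int[leb]_(x in `]A, B]) a x r by [].
  apply: (@dominated_cvg_real _ _ _ leb _ mI (fun k x => a x (r_ k)) (a ^~ r) (fun=> K)) => //.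
  - by move=> k; exact: mea.
  - exact: mea.
  - exact (@rintegrable_cst _ _ _ leb _ mI fI K).
  - by apply: aeW => x _; exact: (coefficient_cvg (cvg_cst x) cr).
  - by move=> k x /=; rewrite in_itv/= => /andP[/ltW Ax xB]; apply: hK; rewrite Ax xB.
rewrite /primitive; case: ifPn => t0; first exact: key.
by apply: cvgN; apply: key; rewrite ltW// ltNge.
Qed.

(** The primitive of a (., r) is an expansive bijection of the line, so its
    inverse g r is C^1 and Lipschitz with constant 1 / m1. It is continuous in
    r because, for t_k = g (r_k) s and t = g r s, expansiveness gives
    m1 |t_k - t| <= |s - M (r_k) t|, and s = M r t. *)
Lemma inverse_primitive : exists g : R -> R -> R,
  [/\ forall r s, M r (g r s) = s, forall r, g r 0 = 0,
    forall r (s : R), is_derive s 1 (g r) (a (g r s) r)^-1,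
    forall r, continuous (g r) &
    forall s r (r_ : nat -> R), r_ k @[k --> \oo] --> r -> g (r_ k) s @[k --> \oo] --> g r s].
Proof.
have ex (p : R * R) : exists t, M p.1 t = p.2 by exact: primitive_surjective.
have [g_ hg] := choice ex.
pose g r s := g_ (r, s); have Mg r s : M r (g r s) = s by exact: (hg (r, s)).
have Minj r s t : M r s = M r t -> s = t.
  move=> e; have := primitive_expansive r s t; rewrite e subrr normr0.
  rewrite pmulr_rle0// normr_le0 subr_eq0 => /eqP //.
have gM r t : g r (M r t) = t by apply: (@Minj r); rewrite Mg.
have dg r (s : R) : is_derive s 1 (g r) (a (g r s) r)^-1.
  rewrite -{1}(Mg r s); apply: is_derive_inverse.
  - by near=> z; exact: gM.
  - near=> z; apply: differentiable_continuous.
    by apply/derivable1_diffP; have [] := dM r z.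
  - exact: dM.
  - by rewrite gt_eqF// (lt_le_trans m10).
exists g; split => //.
- by move=> r; apply: (@Minj r); rewrite Mg primitive0.
- move=> r x; apply: differentiable_continuous.
  by apply/derivable1_diffP; have [] := dg r x.
- move=> s r r_ cr; apply/subr_cvg0.
  apply: (squeeze0 (b_ := fun k => `|s - M (r_ k) (g r s)| / m1)).
    move=> k; rewrite ler_pdivlMr// mulrC; apply: le_trans (primitive_expansive (r_ k) _ _) _.
    by rewrite Mg.
  rewrite -(mul0r m1^-1); apply: cvgMr_tmp; apply/norm_cvg0P.
  have c := @primitive_cvg_parameter r_ r (g r s) cr; rewrite Mg in c.
  by rewrite -[X in _ --> X](subrr s); apply: cvgB; [exact: cvg_cst|exact: c].
Unshelve. all: by end_near. Qed.

End change_of_unknown.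

(** * The nonlocal quasilinear problem *)

Section quasilinear.
Context {R : realType} {n : nat} (Omega : set 'rV[R]_n.+2).
Context (oO : open Omega) (bO : bounded_set Omega).
Local Notation mu := (@lebesgue_row R n.+2).
Local Notation sqint := (sqint mu Omega).
Local Notation ip := (ip mu Omega).
Local Notation nrm2 := (nrm2 mu Omega).
Local Notation rint := (rintegrable mu Omega).
Local Notation L2cvg := (L2cvg mu Omega).
Local Notation test := (test_function Omega).
Local Notation h10 := (h10 Omega).
Local Notation gip := (gip Omega).
Local Notation p := (1 + n.+1%:R^-1 : R).

Let mO : measurable Omega := open_measurable_row oO.
Let fO := bounded_finite_measure oO bO.

Context (f : 'rV[R]_n.+2 -> R) (F th : R) (jf : rint f).
Context (F0 : 0 <= F) (th0 : 0 <= th) (hth : 2 / p < 1 + th).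
Context (hF : forall A, measurable A -> A `<=` Omega ->
     \int[mu]_(x in A) `|f x| <= F * fine (mu A) `^ th).
Context (a : R -> R -> R) (m1 : R) (m10 : 0 < m1).
Context (am1 : forall t r, m1 <= a t r).
Context (ca : continuous (fun p : R * R => a p.1 p.2)).

Lemma ae_bounded_in_Lpy (u : 'rV[R]_n.+2 -> R) (K : R) : 0 <= K -> measurable_fun Omega u ->
  {ae mu, forall x, Omega x -> `|u x| <= K} -> in_Lp Omega +oo%E u.
Proof.
move=> K0 mu1 uK; have mr : measurable_fun setT (u \_ Omega) 
  by apply/(measurable_restrictT _ mO).
rewrite /in_Lp inE; apply/andP; split; rewrite inE//= /finite_norm unlock; case: ifP => _; last exact: ltry.
apply: (@le_lt_trans _ _ K%:E); last exact: ltry.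
apply/ess_supP; apply: filterS uK => x h /=; rewrite lee_fin patchE.
by case: ifPn => [|_]; [rewrite inE; exact: h|rewrite normr0].
Qed.

(** If w = 0, integrating by parts once more kills the left-hand side of the
    equation, so that f is orthogonal to all test functions. *)
Lemma solution_nontrivial w G : h10 w G ->
  (forall phi, test phi -> gip G (grads phi) = \int[mu]_(x in Omega) (f x * phi x)) ->
  nontrivial Omega f -> nontrivial Omega w.
Proof.
move=> hw eqw nf w0; apply: nf; apply: (fundamental_lemma oO jf) => phi tphi.
rewrite -eqw// /gip big1// => i _; rewrite /grads.
have tp := test_function_partial i tphi.
have e := h10_weak oO bO i hw tp; have [sw _ _] := hw.
suff z : ip w (partial i (partial i phi)) = 0.
  by apply/eqP; rewrite -oppr_eq0 -e z.
have tpp := test_function_partial i tp.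
have -> : ip w (partial i (partial i phi)) = ip (fun=> 0) (partial i (partial i phi)).
  congr fine; apply: ae_eq_integral => //.
  - apply/measurable_EFinP; apply: measurable_funM; first by case: sw.
    exact: (test_measurable tpp).
  - apply/measurable_EFinP; apply: measurable_funM => //.
    exact: (test_measurable tpp).
  - by apply: filterS w0 => x h Ox; rewrite h.
rewrite /ip (@eq_Rintegral _ _ _ mu Omega (fun=> 0)); last by move=> x _; rewrite mul0r.
by rewrite Rintegral_cst// mul0r.
Qed.

(** Let w solve the Poisson equation for f. For each r the function
    u_r = M_r^-1 (w), with M_r the primitive of a (., r), has gradient
    G / a (u_r, r), so that a (u_r, r) grad u_r = G: it solves the equation
    with the number r in place of |grad u|^2. It remains to find r with
    |grad u_r|^2 = r; the left-hand side is a continuous and bounded function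
    of r, and the intermediate value theorem applies. *)
Theorem quasilinear_solution : exists u, weak_solution Omega a f u /\
  (nontrivial Omega f -> nontrivial Omega u).
Proof.
have [w [G [K [hw K0 wK eqw eqh]]]] := linear_solution oO bO jf F0 th0 hth hF.
have [sw sG _] := hw; have mw : measurable_fun Omega w by case: sw.
have [g [Mg g0 dg cg cgp]] := inverse_primitive m10 am1 ca.
have a0 t r : 0 < a t r by exact: lt_le_trans (am1 t r).
pose b r t := (a (g r t) r)^-1.
have b0 r t : 0 <= b r t by rewrite invr_ge0 ltW.
have b1 r t : `|b r t| <= m1^-1 
  by rewrite ger0_norm// /b lef_pV2 ?posrE.
have cb r : continuous (b r).
  move=> t; apply: cvgV; first by rewrite gt_eqF.
  exact: (cvg_comp _ _ (cg r t) (@coefficient_continuous _ _ ca r (g r t))).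
have mb r : measurable_fun Omega (fun x => b r (w x)).
  exact: (measurableT_comp (continuous_measurable_fun (cb r)) mw).
pose H r i x := b r (w x) * G i x.
have hH r : h10 (fun x => g r (w x)) (H r).
  have [s1 s2 [psi_ [tp c1 c2 _ _]]] := h10_comp oO bO hw (dg r) (cb r) (b1 r) (g0 r).
  by split => //; exists psi_; split.
have sH r i : sqint (H r i) by have [] := hH r.
pose h r := gip (H r) (H r).
have ch : continuous h.
  move=> r; apply/(@cvg_nbhsP _ R^o) => r_ cr.
  apply: gip_nrm2_cvg => // i.
  apply: (L2cvg_mul mO (B := m1^-1)) => //.
  - apply: aeW => x Ox; apply: cvgV; first by rewrite gt_eqF.
    by apply: coefficient_cvg => //; exact: cgp.
  - rewrite /L2cvg (_ : (fun _ => _) = fun=> 0); first exact: cvg_cst.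
    apply/funext => _; rewrite /nrm2 (@eq_Rintegral _ _ _ mu Omega (fun=> 0)).
      by rewrite Rintegral_cst// mul0r.
    by move=> x _; rewrite subrr expr0n.
pose B := m1^-1 ^+ 2 * gip G G.
have B0 : 0 <= B by rewrite mulr_ge0 ?gip_ge0// sqr_ge0.
have hB r : h r <= B.
  rewrite /h /B !gip_nrm2 mulr_sumr; apply: ler_sum => i _.
  rewrite -(nrm2Z mO m1^-1 (sG i)).
  apply: (nrm2_le oO (proj1 (sH r i)) (sqintZ mO _ (sG i))) => x _.
  by rewrite !normrM [`|m1^-1|]ger0_norm ?invr_ge0 ?(ltW m10)// ler_wpM2r.
(* h r - r is nonnegative at 0 and nonpositive at B. *)
have [r r0 hr] : exists2 r, 0 <= r & h r = r.
  have cd : continuous (fun s => h s - s).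
    by move=> s; apply: cvgB; [exact: ch|exact: cvg_id].
  have [] := @IVT R (fun s => h s - s) 0 B 0 B0 (continuous_subspaceT cd).
    by rewrite ge_min le_max subr0 gip_ge0/= subr_le0 hB orbT.
  by move=> r; rewrite in_itv/= => /andP[r0 _] /eqP; rewrite subr_eq0 => /eqP; exists r.
pose u x := g r (w x).
have [Hu gu] := h10_H10 oO bO (hH r).
have [su sgu _] := H10_h10 oO bO Hu.
have gn : grad_norm2 Omega u = r.
  rewrite -[RHS]hr /h gip_nrm2 /grad_norm2 /dotrow (Rintegral_sum mO); last first.
    by move=> i; exact: (sqint_mul mO (sgu i) (sgu i)).
  apply: eq_bigr => i _; rewrite -/(ip _ _) ip_nrm2; apply: (nrm2_ae_eq mO).
  - by case: (sgu i).
  - by case: (sH r i).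
  - exact: gu.
exists u; split.
  split => //.
  - apply: (@ae_bounded_in_Lpy _ (m1^-1 * K)); first by rewrite mulr_ge0 ?invr_ge0 ?ltW.
      by case: su.
    apply: filterS wK => x h1 Ox; have h2 := @mean_value_bound _ (g r) (b r) m1^-1 (w x) 0 (dg r).
    rewrite g0 !subr0 in h2; apply: le_trans (h2 _) _; first by move=> t _.
    by rewrite ler_wpM2l ?invr_ge0 ?(ltW m10)// h1.
  - move=> phi Hphi; have hphi := H10_h10 oO bO Hphi.
    have [sphi sgphi _] := hphi.
    have [jfp e] := eqh _ _ hphi.
    rewrite gn -(EFin_Rintegral mO jfp) -e.
    have sGp i := sqint_mul mO (sG i) (sgphi i).
    rewrite /gip /ip -(Rintegral_sum mO)// (EFin_Rintegral mO); last exact: rintegrable_sum.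
    apply: ae_eq_integral => //.
    + apply/measurable_EFinP; apply: measurable_funM.
        apply: (measurableT_comp (continuous_measurable_fun (@coefficient_continuous _ _ ca r))).
        by case: su.
      by apply: measurable_sum => i; apply: measurable_funM; [case: (sgu i)|case: (sgphi i)].
    + apply/measurable_EFinP; apply: measurable_sum => i.
      by apply: measurable_funM; [case: (sG i)|case: (sgphi i)].
    + have gu' : {ae mu, forall x i, Omega x -> grad Omega u x ord0 i = H r i x}.
        by apply: filter_forall => i; exact: gu.
      apply: filterS gu' => x h1 Ox; congr EFin; rewrite /dotrow mulr_sumr; apply: eq_bigr => i _.
      by rewrite h1// /H /b mulrA mulrA mulfV ?mul1r// gt_eqF.
move=> nf u0; apply: (solution_nontrivial hw eqw nf).
apply: filterS u0 => x h1 Ox; rewrite -(Mg r (w x)) -/(u x) h1// primitive0//.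
Qed.

End quasilinear.

(** * Functions in L^q, and the theorem *)

Section integrability.
Context {R : realType} {n : nat} (Omega : set 'rV[R]_n.+2).
Context (oO : open Omega) (bO : bounded_set Omega).
Local Notation mu := (@lebesgue_row R n.+2).
Local Notation rint := (rintegrable mu Omega).
Local Notation p := (1 + n.+1%:R^-1 : R).

Let mO : measurable Omega := open_measurable_row oO.
Let fO := bounded_finite_measure oO bO.

(** 2 / p = 2 - 2 / N in dimension N = n + 2: an integrability exponent th of
    f is admissible exactly when th > 1 - 2 / N. *)
Lemma two_div_p : 2 / p = 2 - 2 / n.+2%:R.
Proof.
rewrite -[n.+2]addn1 natrD; have : 0 < n.+1%:R :> R by [].
move: (n.+1%:R) => x x0; field; do ?[apply/andP; split]; rewrite gt_eqF//; lra.
Qed.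

(** Hoelder's inequality for f and the indicator of A. *)
Lemma Lq_integral_le (f : 'rV[R]_n.+2 -> R) (q : R) A : 1 < q -> in_Lp Omega q%:E f ->
  measurable A -> A `<=` Omega ->
  (\int[mu]_(x in A) `|f x|%:E <=
   (fine (Lp_norm Omega q%:E f) * fine (mu A) `^ (1 - q^-1))%:E)%E.
Proof.
move=> q1; rewrite /in_Lp inE => /andP[]; rewrite inE/= => mf; rewrite inE/= => Nf mA AO.
have q0 : 0 < q by exact: lt_trans q1.
pose th := 1 - q^-1.
have th0 : 0 < th by rewrite subr_gt0 invf_lt1.
have e : q^-1 + th^-1^-1 = 1 by rewrite invrK addrC subrK.
have m1 : measurable_fun setT (\1_A : 'rV[R]_n.+2 -> R) by exact: measurable_indic.
have thi : 0 < th^-1 by rewrite invr_gt0.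
have := hoelder mu mf m1 q0 thi e.
have -> : ('N[mu]_1[(EFin \o ((f \_ Omega) \* \1_A)%R)] = \int[mu]_(x in A) `|f x|%:E)%E.
  rewrite Lnorm1 [RHS]integral_mkcond; apply: eq_integral => x _.
  rewrite /= !patchE indicE; case: (boolP (x \in A)) => [|_]; last by rewrite mulr0 normr0.
  by rewrite inE => Ax; rewrite ifT ?mulr1// inE; exact: AO.
have -> : ('N[mu]_(th^-1)%:E[(EFin \o (\1_A : _ -> R))] = (fine (mu A) `^ th)%:E)%E.
  rewrite [in LHS]unlock invrK.
  have -> : (\int[mu]_x `|(EFin \o \1_A) x| `^ th^-1 = \int[mu]_x (\1_A x)%:E)%E.
    apply: eq_integral => x _; rewrite /= indicE; case: (_ \in _).
      by rewrite normr1 powR1.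
    by rewrite normr0 powR0// gt_eqF.
  have fA : mu A \is a fin_num.
    rewrite (ge0_fin_numE (measure_ge0 _ _)); apply: le_lt_trans fO.
    by apply: le_measure; rewrite ?inE.
  have -> : (\int[mu]_x (\1_A x)%:E = (fine (mu A))%:E)%E.
    by have := @integral_indic _ _ _ mu setT measurableT A mA; rewrite setIT (fineK fA).
  by rewrite poweR_EFin.
have -> : ('N[mu]_q%:E[(EFin \o (f \_ Omega))] = (fine (Lp_norm Omega q%:E f))%:E)%E.
  by rewrite /Lp_norm fineK// (ge0_fin_numE (Lnorm_ge0 _ _ _)).
by rewrite -EFinM.
Qed.

Lemma Linfty_bounded (f : 'rV[R]_n.+2 -> R) : in_Lp Omega +oo%E f ->
  exists2 K : R, 0 <= K & {ae mu, forall x, Omega x -> `|f x| <= K}.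
Proof.
rewrite /in_Lp inE => /andP[]; rewrite inE/= => mf; rewrite inE/= /finite_norm unlock.
have fE x : Omega x -> (f \_ Omega) x = f x by move=> Ox; rewrite patchE ifT// inE.
case: ifPn => [_ lt|]; last first.
  rewrite -leNgt => T0; exists 0 => //; exists setT; split => //.
  by apply/eqP; rewrite eq_le T0 measure_ge0.
set es := ess_sup mu _ in lt.
have esK : (es <= `|fine es|%:E)%E.
  by move: lt; case: es => [r _| |]//=; rewrite ?leNye// lee_fin ler_norm.
exists `|fine es|; first exact: normr_ge0.
move/ess_supP: esK; apply: filterS => x /=; rewrite lee_fin => h Ox.
by rewrite -(fE x Ox).
Qed.

(** For finite q take th = 1 - 1/q, where q > N/2 means th > 1 - 2/N; for
    q = +oo take th = 1. *)
Lemma Lq_small_sets (f : 'rV[R]_n.+2 -> R) (q : \bar R) :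
  ((n.+2%:R / 2 : R)%:E < q)%E -> in_Lp Omega q f ->
  exists F th : R, [/\ rint f, 0 <= F, 0 <= th, 2 / p < 1 + th &
    forall A, measurable A -> A `<=` Omega ->
     \int[mu]_(x in A) `|f x| <= F * fine (mu A) `^ th].
Proof.
have N0 : 0 < n.+2%:R :> R by [].
have N2 : 2 <= n.+2%:R :> R by rewrite ler_nat.
case: q => [q| |]//; last first.
  move=> _ hf; have [K K0 fK] := Linfty_bounded hf.
  move: hf; rewrite /in_Lp inE => /andP[]; rewrite inE/= => mf _.
  have {}mf : measurable_fun Omega f by apply/(measurable_restrictT _ mO).
  have jf : rint f.
    apply/rintegrableP; split => //.
    apply: (@le_lt_trans _ _ (\int[mu]_(x in Omega) K%:E)%E).
      apply: ae_ge0_le_integral => //.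
      by apply/measurable_EFinP; exact: measurableT_comp.
    by rewrite integral_cst//; exact: lte_mul_pinfty.
  exists K, 1; split => //.
    by rewrite two_div_p ltrBlDr ltrDl divr_gt0.
  move=> A mA AO; have iA : rintegrable mu A f by exact: (integrableS mO mA AO jf).
  have fA : (mu A < +oo)%E.
    by apply: le_lt_trans fO; apply: le_measure; rewrite ?inE.
  rewrite powRr1 ?fine_ge0// -(Rintegral_cst mu mA).
  apply: Rintegral_ae_le => //.
  - exact: rintegrable_norm.
  - exact: (rintegrable_cst mA fA).
  - by apply: filterS fK => x h Ax; apply: h; exact: AO.
rewrite lte_fin => hq hf.
have q1 : 1 < q by move: hq; rewrite ltr_pdivrMr//; lra.
have q0 : 0 < q by lra.
have key := Lq_integral_le q1 hf.
have mf : measurable_fun Omega f.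
  move: hf; rewrite /in_Lp inE => /andP[]; rewrite inE/= => mf _.
  by apply/(measurable_restrictT _ mO).
have jf : rint f.
  by apply/rintegrableP; split => //; apply: le_lt_trans (key _ mO _) _ => //; exact: ltry.
exists (fine (Lp_norm Omega q%:E f)), (1 - q^-1); split => //.
- by rewrite fine_ge0// Lnorm_ge0.
- by rewrite subr_ge0 invf_le1// ltW.
- rewrite two_div_p; suff : q^-1 < 2 / n.+2%:R.
    by move: (q^-1) (2 / n.+2%:R) => x y; lra.
  by rewrite -[2 / _]invf_div ltf_pV2// posrE// divr_gt0.
- move=> A mA AO; rewrite -lee_fin; apply: le_trans (key A mA AO).
  rewrite EFin_Rintegral//; apply: rintegrable_norm.
  exact: (integrableS mO mA AO jf).
Qed.

End integrability.

(** Extending m by its values at r = 0 to negative r makes it continuous on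
    the whole plane. *)
Lemma positive_part_continuous {R : realType} (m : R -> R -> R) :
  {within [set p : R * R | 0 <= p.2], continuous (fun p : R * R => m p.1 p.2)} ->
  continuous (fun p : R * R => m p.1 (Num.max p.2 0)).
Proof.
move=> /subspace_continuousP cm p.
pose h (p : R * R) : R * R := (p.1, Num.max p.2 0).
have h0 z : 0 <= (h z).2 by rewrite le_max lexx orbT.
have ch : h x @[x --> p] --> h p.
  apply: (@cvg_pair _ _ _ _ (nbhs p.1) (nbhs (Num.max p.2 0))); first exact: cvg_fst.
  have c : {for p, continuous ((fun z : R * R => z.2 : R^o) \max (fun=> 0 : R^o))}.
    by apply: continuous_max; [exact: cvg_snd|exact: cst_continuous].
  exact: c.
move=> A /(cm (h p) (h0 p)) hA.
have hn : \forall z \near p, 0 <= (h z).2 -> A (m (h z).1 (h z).2) by exact: (ch _ hA).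
suff : \forall z \near p, A (m z.1 (Num.max z.2 0)) by [].
by apply: filterS hn => z; apply; exact: h0.
Qed.

Theorem theorem3p1 (R : realType) (N : nat) (hN : (2 <= N)%N)
    (Omega : set 'rV[R]_N)
    (hOmega : bounded_domain Omega) (hbd : smooth_boundary Omega)
    (m : R -> R -> R)
    (hpos : forall t r, 0 <= r -> 0 < m t r)
    (hm0 : {within [set p : R * R | 0 <= p.2],
             continuous (fun p : R * R => m p.1 p.2)})
    (hm1 : exists m1 : R, 0 < m1 /\ forall t r, 0 <= r -> m1 <= m t r)
    (hm2 : forall r, 0 <= r ->
       (forall s t, s < t -> t < 0 -> m t r < m s r) /\
       (forall s t, 0 < s -> s < t -> m s r < m t r))
    (f : 'rV[R]_N -> R) (q : \bar R)
    (hq : ((N%:R / 2 : R)%:E < q)%E)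
    (hf : in_Lp Omega q f) (hf0 : nontrivial Omega f) :
  exists u : 'rV[R]_N -> R, weak_solution Omega m f u /\ nontrivial Omega u.
Proof.
move: N hN Omega hOmega hbd f hq hf hf0 => [|[|n]]// _ Omega [_ oO _ bO] _ f hq hf hf0.
have [m1 [m10 hm]] := hm1.
have [F [th [jf F0 th0 hth hF]]] := Lq_small_sets oO bO hq hf.
pose a t r := m t (Num.max r 0).
have am1 t r : m1 <= a t r by apply: hm; rewrite le_max lexx orbT.
have [u [[Hu uoo equ] nu]] := quasilinear_solution oO bO jf F0 th0 hth hF m10 am1
  (positive_part_continuous hm0).
exists u; split; last exact: nu.
split => // phi Hphi; rewrite -equ//.
have g0 : 0 <= grad_norm2 Omega u.
  by apply: Rintegral_ge0 => x _; apply: sumr_ge0 => i _; rewrite -expr2 sqr_ge0.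
by apply: eq_integral => x _; rewrite /a max_l.
Qed.
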